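(* Let $\Gamma\cong\Gamma_1*_{\Gamma_0}\Gamma_2$ be an amalgamated product, where $\Gamma_i$ is of type $\mathrm{FP}_\infty$ for $i\in\{0,1,2\}$. Let $\alpha\colon\Gamma\curvearrowright(X,\mu)$ be a standard action. For $i\in\{0,1,2\}$, write $\alpha_i=\alpha|_{\Gamma_i}\colon\Gamma_i\curvearrowright(X,\mu)$ for the restricted action. Let $Z$ be $\mathbb{Z}$ or a finite field. For all $n\in\mathbb{N}$, the following hold: (i) $\mathrm{medim}^Z_n(\alpha)\le\mathrm{medim}^Z_n(\alpha_1)+\mathrm{medim}^Z_n(\alpha_2)+\mathrm{medim}^Z_{n-1}(\alpha_0)$; (ii) If $\Gamma_0\cong\{1\}$ and $n\ge1$, then $\mathrm{mevol}_n(\alpha)\le\mathrm{mevol}_n(\alpha_1)+\mathrm{mevol}_n(\alpha_2)$; (iii) If $\Gamma_0\cong\mathbb{Z}$, then $\mathrm{mevol}_n(\alpha)\le\mathrm{mevol}_n(\alpha_1)+\mathrm{mevol}_n(\alpha_2)$.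
   Context: An amalgamated product is a pushout of groups along injective structure maps $\Gamma_0\to\Gamma_1$, $\Gamma_0\to\Gamma_2$. Convention: $\mathrm{medim}^Z_{-1}=0$. $\mathbb{N}$ contains $0$. $Z$ denotes $\mathbb{Z}$ with the usual absolute value or a finite field with the trivial norm ($|0|=0$, $|x|=1$ for $x\neq 0$). A group $\Gamma$ is of type $\mathrm{FP}_m$ if the trivial $\mathbb{Z}\Gamma$-module $\mathbb{Z}$ has a projective resolution that is finitely generated in degrees $\le m$; type $\mathrm{FP}_\infty$ means finitely generated in all degrees. Standard actions. A standard $\Gamma$-action $\alpha\colon\Gamma\curvearrowright(X,\mu)$ is an essentially free, probability measure preserving action of a countable group on a standard Borel probability space. $L^\infty(\alpha,Z)=L^\infty(X,\mu,Z)$ is the ring of essentially bounded measurable functions $X\to Z$ modulo a.e. equality, with $(\gamma\cdot\lambda)(x)=\lambda(\gamma^{-1}x)$. The crossed product ring $R=L^\infty(\alpha,Z)*\Gamma$ is the free $L^\infty(\alpha,Z)$-module with basis $\Gamma$ (elements are finite sums of terms $(\lambda,\gamma)$) with multiplication $(\lambda,\gamma)(\lambda',\gamma')=(\lambda\cdot(\gamma\cdot\lambda'),\gamma\gamma')$. It contains $Z\Gamma$ via $\gamma\mapsto(1,\gamma)$ and acts on $L^\infty(\alpha,Z)$ by $(\lambda,\gamma)\cdot f=\lambda\cdot(\gamma\cdot f)$. Marked modules. For measurable $A\subset X$ put $\langle A\rangle=R\cdot(\chi_A,1)$. A marked projective $R$-module is an $R$-module $M$ with a finite family $(A_i)_{i\in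 I}$ of measurable subsets of $X$ and an isomorphism $M\cong\bigoplus_{i\in I}\langle A_i\rangle$ (suppressed from notation); $\dim_R(M)=\sum_i\mu(A_i)$. On $R$ let $|\sum_\gamma(\lambda_\gamma,\gamma)|_1=\sum_\gamma\int_X|\lambda_\gamma|\,d\mu$; elements of $M\subset\bigoplus_I R$ have norm $\|\sum_i\lambda_ie_i\|_1=\sum_i|\lambda_i|_1$. For an $R$-homomorphism $f\colon M\to N$ of marked projective modules, $\|f\|$ is the least $c$ with $\|f(z)\|_1\le c\|z\|_1$ for all $z$ (always finite). A marked direct summand of $\bigoplus_j\langle B_j\rangle$ is a submodule $\bigoplus_j\langle B_j'\rangle$ with $B_j'\subset B_j$ measurable. A finite marked decomposition of $M=\bigoplus_i\langle A_i\rangle$ is a finite family $(M_k)_k$ with $M_k=\bigoplus_i\langle A_{i,k}\rangle$ for measurable partitions $A_i=\bigsqcup_kA_{i,k}$. Logarithmic norm. $\log_+(t)=\max\{\log t,0\}$ (and $\log_+0=0$). $\mathrm{rk}(f)=\inf\{\dim N'\mid N'\subset N\text{ marked direct summand with }f(M)\subset N'\}$; $\mathrm{lognorm}'(f)=\min\{\dim(M)\log_+\|f\|,\ \mathrm{rk}(f)\log_+\|f\|\}$; $\mathrm{lognorm}(f)=\inf\sum_k\mathrm{lognorm}'(f|_{M_k}\colon M_k\to N)$, the infimum over all finite marked decompositions $(M_k)_k$ of $M$. Measured embeddings. A marked projective augmented $R$-chain complex $D_*\twoheadrightarrow L^\infty(\alpha,Z)$ is a chain complex $(D_k)_{k\ge0}$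 of marked projective $R$-modules with a surjective $R$-homomorphism $\eta\colon D_0\to L^\infty(\alpha,Z)$, $\eta\circ\partial_1=0$. Fix a free $Z\Gamma$-resolution $C_*\twoheadrightarrow Z$ (the following is independent of the choice). An $\alpha$-embedding (up to degree $n$) is such a complex together with a $Z\Gamma$-chain map $C_*\to D_*$ up to degree $n+1$ extending the inclusion $Z\to L^\infty(\alpha,Z)$ as constant functions. $A_n(\alpha)$ is the class of all augmented complexes $D_*$ arising in this way. For $\Gamma$ of type $\mathrm{FP}_{n+1}$: $\mathrm{medim}^Z_n(\alpha)=\inf_{D_*\in A_n(\alpha)}\dim_R(D_n)$, and (for $Z=\mathbb{Z}$) $\mathrm{mevol}_n(\alpha)=\inf_{D_*\in A_n(\alpha)}\mathrm{lognorm}(\partial^D_{n+1})$. *)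

(* Defs.v *)
From HB Require Import structures.
From mathcomp Require Import all_boot all_order all_algebra ring_quotient.
From mathcomp Require Import finmap.
From mathcomp Require Import all_classical all_reals all_analysis.
From mathcomp Require monalg.
Import -(notations) monalg.
Set Implicit Arguments.
Unset Strict Implicit.
Unset Printing Implicit Defensive.
Import Order.TTheory GRing.Theory Num.Theory.
Local Open Scope classical_set_scope.
Local Open Scope ring_scope.
Local Open Scope quotient_scope.

Record ring_action (G : groupType) (L : comNzRingType) := RingAction {
  ract :> G -> L -> L;
  ract1 : forall a, ract 1%g a = a;
  ractM : forall g h a, ract (g * h)%g a = ract g (ract h a);
  ractB : forall g, {morph ract g : a b / a - b};
  ract_mul : forall g, {morph ract g : a b / a * b};
  ract_one : forall g, ract g 1 = 1
}.

Definition trivial_action (G : groupType) (L : comNzRingType) :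
  ring_action G L :=
  @RingAction G L (fun _ a => a) (fun _ => erefl) (fun _ _ _ => erefl)
    (fun _ _ _ => erefl) (fun _ _ _ => erefl) (fun _ => erefl).

(* Finitely supported functions G -> L, with (x, g) (y, h) = (x (g . y), g h). *)
Definition crossed_product (G : groupType) (L : comNzRingType)
  (s : ring_action G L) : Type := malg G L.

HB.instance Definition _ G L (s : ring_action G L) :=
  GRing.Zmodule.copy (crossed_product s) (malg G L).

(* L as a left module over the crossed product: (x, g) . y = x (g . y). *)
Definition base_module (G : groupType) (L : comNzRingType)
  (s : ring_action G L) : Type := L.

HB.instance Definition _ G L (s : ring_action G L) :=
  GRing.Zmodule.copy (base_module s) L.

Section CrossedProduct.
Context (G : groupType) (L : comNzRingType) (s : ring_action G L).

HB.instance Definition _ g :=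
  GRing.isZmodMorphism.Build L L (s g) (@ractB _ _ s g).

Implicit Types a b c : crossed_product s.

(* The element written (x, g). *)
Definition cp_term (g : G) (x : L) : crossed_product s := mkmalgU g x.

Lemma cp_termB g : {morph cp_term g : x y / x - y}.
Proof. by move=> x y; exact: (raddfB (mkmalgU g)). Qed.

HB.instance Definition _ g :=
  GRing.isZmodMorphism.Build L (crossed_product s) (cp_term g) (cp_termB g).

Definition cp_one : crossed_product s := cp_term 1%g 1.

Definition cp_mul a b : crossed_product s :=
  \sum_(g <- msupp a) \sum_(h <- msupp b)
    cp_term (g * h)%g (mcoeff g a * s g (mcoeff h b)).

Lemma cp_mulw (d1 d2 : {fset G}) a b :
  fsubset (msupp a) d1 -> fsubset (msupp b) d2 ->
  cp_mul a b = \sum_(g <- d1) \sum_(h <- d2)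
    cp_term (g * h)%g (mcoeff g a * s g (mcoeff h b)).
Proof.
move=> le1 le2; rewrite /cp_mul (big_fset_incl _ le1) /=.
  apply: eq_bigr => g _; apply: big_fset_incl => // h _ /mcoeff_outdom ->.
  by rewrite raddf0 mulr0 raddf0.
move=> g _ /mcoeff_outdom ag.
by rewrite big1 // => h _; rewrite ag mul0r raddf0.
Qed.

Lemma cp_mulDl : left_distributive cp_mul +%R.
Proof.
move=> a b c; pose d := fsetU (msupp a) (msupp b).
rewrite !(@cp_mulw d (msupp c)) ?fsubsetUl ?fsubsetUr ?fsubset_refl //;
  last exact: msuppD_le.
rewrite -big_split /=; apply: eq_bigr => g _.
rewrite -big_split /=; apply: eq_bigr => h _.
by rewrite mcoeffD mulrDl raddfD.
Qed.

Lemma cp_mulDr : right_distributive cp_mul +%R.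
Proof.
move=> c a b; pose d := fsetU (msupp a) (msupp b).
rewrite !(@cp_mulw (msupp c) d) ?fsubsetUl ?fsubsetUr ?fsubset_refl //;
  last exact: msuppD_le.
rewrite -big_split /=; apply: eq_bigr => g _.
rewrite -big_split /=; apply: eq_bigr => h _.
by rewrite mcoeffD raddfD mulrDr raddfD.
Qed.

Lemma cp_mul0l : left_zero 0 cp_mul.
Proof. by move=> a; rewrite /cp_mul msupp0 big_seq_fset0. Qed.

Lemma cp_mul0r : right_zero 0 cp_mul.
Proof.
by move=> a; rewrite /cp_mul msupp0 big1 // => g _; rewrite big_seq_fset0.
Qed.

Lemma cp_mulUU g h x y :
  cp_mul (cp_term g x) (cp_term h y) = cp_term (g * h)%g (x * s g y).
Proof.
by rewrite (cp_mulw msuppU_le msuppU_le) !big_seq_fset1 !mcoeffUU.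
Qed.

Lemma cp_sum a : a = \sum_(g <- msupp a) cp_term g (mcoeff g a).
Proof. exact: monalgE. Qed.

Lemma cp_mul_suml I (r : seq I) (F : I -> crossed_product s) b :
  cp_mul (\sum_(i <- r) F i) b = \sum_(i <- r) cp_mul (F i) b.
Proof. exact: (big_morph (cp_mul^~ b) (fun _ _ => cp_mulDl _ _ _) (cp_mul0l b)). Qed.

Lemma cp_mul_sumr I (r : seq I) (F : I -> crossed_product s) b :
  cp_mul b (\sum_(i <- r) F i) = \sum_(i <- r) cp_mul b (F i).
Proof. exact: (big_morph (cp_mul b) (fun _ _ => cp_mulDr _ _ _) (cp_mul0r b)). Qed.

Lemma cp_mulA : associative cp_mul.
Proof.
move=> a b c; rewrite (cp_sum a) cp_mul_suml [in RHS]cp_mul_suml cp_mul_suml.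
apply: eq_bigr => g _; rewrite (cp_sum b) cp_mul_suml [in RHS]cp_mul_sumr.
rewrite cp_mul_suml cp_mul_sumr; apply: eq_bigr => h _.
rewrite (cp_sum c) !cp_mul_sumr; apply: eq_bigr => k _.
by rewrite !cp_mulUU ract_mul ractM mulgA mulrA.
Qed.

Lemma cp_mul1l : left_id cp_one cp_mul.
Proof.
move=> a; rewrite [in LHS](cp_sum a) cp_mul_sumr [in RHS](cp_sum a).
by apply: eq_bigr => g _; rewrite cp_mulUU mul1g ract1 mul1r.
Qed.

Lemma cp_mul1r : right_id cp_one cp_mul.
Proof.
move=> a; rewrite [in LHS](cp_sum a) cp_mul_suml [in RHS](cp_sum a).
by apply: eq_bigr => g _; rewrite cp_mulUU mulg1 ract_one mulr1.
Qed.

Lemma cp_one_neq0 : cp_one != 0.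
Proof.
apply/eqP => /malgP/(_ 1%g); rewrite mcoeffUU mcoeff0; apply/eqP.
exact: oner_neq0.
Qed.

HB.instance Definition _ := GRing.Zmodule_isNzRing.Build (crossed_product s)
  cp_mulA cp_mul1l cp_mul1r cp_mulDl cp_mulDr cp_one_neq0.

Definition cp_scale a (x : base_module s) : base_module s :=
  \sum_(g <- msupp a) mcoeff g a * s g x.

Lemma cp_scalew (d : {fset G}) a (x : base_module s) : fsubset (msupp a) d ->
  cp_scale a x = \sum_(g <- d) mcoeff g a * s g x.
Proof.
move=> le; apply: big_fset_incl => // g _ /mcoeff_outdom ->.
by rewrite mul0r.
Qed.

Lemma cp_scaleDl (x : base_module s) : {morph cp_scale^~ x : a b / a + b}.
Proof.
move=> a b; pose d := fsetU (msupp a) (msupp b).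
rewrite !(@cp_scalew d) ?fsubsetUl ?fsubsetUr //; last exact: msuppD_le.
by rewrite -big_split; apply: eq_bigr => g _; rewrite mcoeffD mulrDl.
Qed.

Lemma cp_scaleDr : right_distributive cp_scale +%R.
Proof.
move=> a x y; rewrite /cp_scale -big_split; apply: eq_bigr => g _.
by rewrite raddfD mulrDr.
Qed.

Lemma cp_scale0 (x : base_module s) : cp_scale 0 x = 0.
Proof. by rewrite /cp_scale msupp0 big_seq_fset0. Qed.

Lemma cp_scaler0 a : cp_scale a 0 = 0.
Proof. by rewrite /cp_scale big1 // => g _; rewrite raddf0 mulr0. Qed.

Lemma cp_scaleU g y (x : base_module s) : cp_scale (cp_term g y) x = y * s g x.
Proof. by rewrite (cp_scalew _ msuppU_le) big_seq_fset1 mcoeffUU. Qed.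

Lemma cp_scaleA a b (x : base_module s) :
  cp_scale a (cp_scale b x) = cp_scale (a * b) x.
Proof.
have suml I (r : seq I) (F : I -> crossed_product s) (y : base_module s) :
    cp_scale (\sum_(i <- r) F i) y = \sum_(i <- r) cp_scale (F i) y.
  exact: (big_morph (cp_scale^~ y) (cp_scaleDl y) (cp_scale0 y)).
have sumr I (r : seq I) (F : I -> base_module s) c :
    cp_scale c (\sum_(i <- r) F i) = \sum_(i <- r) cp_scale c (F i).
  exact: (big_morph (cp_scale c) (cp_scaleDr c) (cp_scaler0 c)).
rewrite [a * b]/GRing.mul /= (cp_sum a) cp_mul_suml !suml.
apply: eq_bigr => g _; rewrite (cp_sum b) cp_mul_sumr !suml sumr.
apply: eq_bigr => h _.
by rewrite cp_mulUU !cp_scaleU ract_mul ractM mulrA.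
Qed.

Lemma cp_scale1 : left_id 1 cp_scale.
Proof.
move=> x; rewrite [X in cp_scale X]/GRing.one /= cp_scaleU ract1.
exact: mul1r.
Qed.

HB.instance Definition _ :=
  GRing.Zmodule_isLmodule.Build (crossed_product s) (base_module s)
    cp_scaleA cp_scale1 cp_scaleDr cp_scaleDl.

End CrossedProduct.


Record normed_ring (R : realType) := NormedRing {
  nr_ring :> countComNzRingType;
  nr_norm : nr_ring -> R;
  nr_norm_ge0 : forall z, 0 <= nr_norm z;
  nr_normN : forall z, nr_norm (- z) = nr_norm z;
  nr_normD : forall z w, nr_norm (z + w) <= nr_norm z + nr_norm w;
  nr_normM : forall z w, nr_norm (z * w) <= nr_norm z * nr_norm w
}.

Section NormedRingInstances.
Variable R : realType.

Definition int_norm (z : int) : R := `|z|%:~R.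

Lemma int_norm_ge0 z : 0 <= int_norm z.
Proof. by rewrite ler0z normr_ge0. Qed.

Lemma int_normN z : int_norm (- z) = int_norm z.
Proof. by rewrite /int_norm normrN. Qed.

Lemma int_normD z w : int_norm (z + w) <= int_norm z + int_norm w.
Proof. by rewrite -intrD ler_int ler_normD. Qed.

Lemma int_normM z w : int_norm (z * w) <= int_norm z * int_norm w.
Proof. by rewrite -intrM ler_int normrM. Qed.

Definition normed_int : normed_ring R :=
  @NormedRing R int int_norm int_norm_ge0 int_normN int_normD int_normM.

Variable F : finFieldType.

Definition trivial_norm (z : F) : R := (z != 0)%:R.

Lemma trivial_norm_ge0 z : 0 <= trivial_norm z.
Proof. exact: ler0n. Qed.

Lemma trivial_normN z : trivial_norm (- z) = trivial_norm z.
Proof. by rewrite /trivial_norm oppr_eq0. Qed.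

Lemma trivial_normD z w :
  trivial_norm (z + w) <= trivial_norm z + trivial_norm w.
Proof.
rewrite /trivial_norm -natrD ler_nat.
have [->|z0] := eqVneq z 0; first by rewrite !add0r.
by rewrite (leq_trans (leq_b1 _)) // leq_addr.
Qed.

Lemma trivial_normM z w :
  trivial_norm (z * w) <= trivial_norm z * trivial_norm w.
Proof. by rewrite /trivial_norm -natrM ler_nat mulf_eq0 negb_or mulnb. Qed.

Definition normed_finfield : normed_ring R :=
  @NormedRing R F trivial_norm
    trivial_norm_ge0 trivial_normN trivial_normD trivial_normM.

End NormedRingInstances.

Variant coefficient_ring (R : realType) : normed_ring R -> Prop :=
| coefficient_int : coefficient_ring (normed_int R)
| coefficient_finfield (F : finFieldType) :
    coefficient_ring (normed_finfield R F).

Section Linf.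
Context d (X : measurableType d) (R : realType) (mu : probability X R).
Context (Z : normed_ring R).

(* Measurability is with respect to the discrete sigma-algebra on Z; countability
   of Z makes these functions a ring. *)
Definition ess_bounded (f : X -> Z) : Prop :=
  (forall B : set Z, measurable (f @^-1` B)) /\
  exists M : R, \forall x \ae mu, nr_norm (f x) <= M.

Definition linf_pred : {pred X -> Z} := fun f => `[< ess_bounded f >].

Lemma linf_predP f : reflect (ess_bounded f) (f \in linf_pred).
Proof. exact: asboolP. Qed.

Lemma measurable_op2 (op : Z -> Z -> Z) (f g : X -> Z) :
  (forall B : set Z, measurable (f @^-1` B)) ->
  (forall B : set Z, measurable (g @^-1` B)) ->
  forall B : set Z, measurable ((fun x => op (f x) (g x)) @^-1` B).
Proof.
move=> mf mg B.
rewrite (_ : _ @^-1` B = \bigcup_(p : Z * Z)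
    (f @^-1` [set a | a = p.1 /\ B (op p.1 p.2)] `&` g @^-1` [set p.2])).
  apply: countable_bigcupT_measurable => [|p]; last exact: measurableI.
  exact: countableP.
apply/seteqP; split=> [x /= Bx|x /= [[a b] _ /= [[-> ?] ->]]//].
by exists (f x, g x).
Qed.

Lemma linf_subring : subring_closed linf_pred.
Proof.
split.
- apply/linf_predP; split=> [B|].
    have [B1|B1] := pselect (B 1).
      by rewrite (_ : _ @^-1` B = setT)//; apply/seteqP; split.
    by rewrite (_ : _ @^-1` B = set0)//; apply/seteqP; split=> // x /B1.
  by exists (nr_norm (1 : Z)); apply: aeW.
- move=> f g /linf_predP[mf [M fM]] /linf_predP[mg [N gN]].
  apply/linf_predP; split; first exact: (@measurable_op2 (fun a b => a - b)).
  exists (M + N); near=> x.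
  rewrite (le_trans (nr_normD _ _))// nr_normN lerD//; near: x; assumption.
- move=> f g /linf_predP[mf [M fM]] /linf_predP[mg [N gN]].
  apply/linf_predP; split; first exact: (@measurable_op2 *%R).
  exists (M * N); near=> x.
  rewrite (le_trans (nr_normM _ _))// ler_pM ?nr_norm_ge0//; near: x; assumption.
Unshelve. all: by end_near. Qed.

HB.instance Definition _ :=
  GRing.isSubringClosed.Build (X -> Z) linf_pred linf_subring.

Record linf_fun := LinfFun {
  linf_val :> X -> Z;
  linf_valP : linf_val \in linf_pred }.

HB.instance Definition _ := [isSub for linf_val].
HB.instance Definition _ := [Choice of linf_fun by <:].
HB.instance Definition _ :=
  [SubChoice_isSubComNzRing of linf_fun by <:].

Definition linf_null : {pred linf_fun} :=
  fun f => `[< \forall x \ae mu, f x = 0 >].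

Lemma linf_nullP (f : linf_fun) :
  reflect (\forall x \ae mu, f x = 0) (f \in linf_null).
Proof. exact: asboolP. Qed.

Lemma linf_null_ideal : idealr_closed linf_null.
Proof.
split.
- by apply/linf_nullP; apply: aeW.
- apply/linf_nullP => h.
  have : \forall x \ae mu, False.
    near=> x; have : (1 : linf_fun) x = 0 by near: x.
    by move/eqP; rewrite oner_eq0.
  move=> [A [mA A0 TA]]; have AT : A = setT by apply/seteqP; split=> // x _; apply: TA.
  by move: A0; rewrite AT probability_setT => /eqP; rewrite onee_eq0.
- move=> a f g /linf_nullP f0 /linf_nullP g0; apply/linf_nullP.
  near=> x; have fx : f x = 0 by near: x.
  have gx : g x = 0 by near: x.
  by rewrite [LHS](_ : _ = a x * f x + g x)// fx gx mulr0 addr0.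
Unshelve. all: by end_near. Qed.

HB.instance Definition _ := isIdealr.Build linf_fun linf_null linf_null_ideal.

Definition Linf : Type := {ideal_quot linf_null}.

HB.instance Definition _ := GRing.ComNzRing.on Linf.
HB.instance Definition _ := EqQuotient.on Linf.

(* The class of f, or 0 if f is not measurable and essentially bounded. *)
Definition linf_class (f : X -> Z) : Linf := \pi_Linf (insubd (0 : linf_fun) f).

Definition linf_repr (l : Linf) : X -> Z := repr l.


Lemma linf_reprP (l : Linf) : linf_repr l \in linf_pred.
Proof. exact: linf_valP. Qed.

Lemma linf_reprK (l : Linf) : linf_class (linf_repr l) = l.
Proof. by rewrite /linf_class valKd reprK. Qed.

Lemma linf_class_eqP f g : f \in linf_pred -> g \in linf_pred ->
  linf_class f = linf_class g <-> \forall x \ae mu, f x = g x.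
Proof.
move=> fP gP; rewrite /linf_class; split.
  move/eqP; rewrite -Quotient.idealrBE => /linf_nullP h.
  near=> x; have : (insubd (0 : linf_fun) f - insubd 0 g) x = 0 by near: x.
  rewrite [X in X = 0](_ : _ = insubd (0 : linf_fun) f x
    - insubd (0 : linf_fun) g x)//.
  by rewrite !(insubdK 0)// => /subr0_eq.
move=> fg; apply/eqP; rewrite -Quotient.idealrBE; apply/linf_nullP.
near=> x; have fgx : f x = g x by near: x.
rewrite [LHS](_ : _ = insubd (0 : linf_fun) f x
    - insubd (0 : linf_fun) g x)//.
by rewrite !(insubdK 0)// fgx subrr.
Unshelve. all: by end_near. Qed.

Lemma linf_classK f : f \in linf_pred ->
  \forall x \ae mu, linf_repr (linf_class f) x = f x.
Proof. by move=> fP; apply/linf_class_eqP; rewrite ?linf_reprK ?linf_reprP. Qed.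

Lemma linf_classB f g : f \in linf_pred -> g \in linf_pred ->
  linf_class (fun x => f x - g x) = linf_class f - linf_class g.
Proof.
move=> fP gP; rewrite /linf_class -rmorphB /=; congr (\pi_ _ _).
have fgP : (fun x => f x - g x) \in linf_pred by exact: (rpredB fP gP).
apply: val_inj; rewrite (insubdK 0)//.
by rewrite rmorphB /= !(insubdK 0).
Qed.

Lemma linf_classM f g : f \in linf_pred -> g \in linf_pred ->
  linf_class (fun x => f x * g x) = linf_class f * linf_class g.
Proof.
move=> fP gP; rewrite /linf_class -rmorphM /=; congr (\pi_ _ _).
have fgP : (fun x => f x * g x) \in linf_pred by exact: (rpredM fP gP).
apply: val_inj; rewrite (insubdK 0)//.
by rewrite rmorphM /= !(insubdK 0).
Qed.

Lemma linf_class1 : linf_class (fun=> 1) = 1.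
Proof.
rewrite /linf_class -(rmorph1 (\pi_Linf)); congr (\pi_ _ _).
by apply: val_inj; rewrite (insubdK 0)//; exact: (rpred1 linf_pred).
Qed.

Definition linf_const (z : Z) : Linf := linf_class (fun=> z).

Definition linf_indic (A : set X) : Linf :=
  linf_class (fun x => if x \in A then 1 else 0).

End Linf.

Arguments linf_pred {d X R} mu Z _.
Arguments linf_const {d X R} mu {Z} z.
Arguments linf_indic {d X R} mu Z A.
Arguments linf_class {d X R} mu {Z} f.

Record pmp_action d (X : measurableType d) (R : realType)
  (mu : probability X R) (G : groupType) := PmpAction {
  pact :> G -> X -> X;
  pact1 : forall x, pact 1%g x = x;
  pactM : forall g h x, pact (g * h)%g x = pact g (pact h x);
  pact_measurable : forall g, measurable_fun setT (pact g);
  pact_preserving : forall g (A : set X), measurable A ->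
    mu (pact g @^-1` A) = mu A
}.

Section LinfAction.
Context d (X : measurableType d) (R : realType) (mu : probability X R).
Context (G : groupType) (a : pmp_action mu G) (Z : normed_ring R).

Lemma pact_ae (P : X -> Prop) g :
  (\forall x \ae mu, P x) -> \forall x \ae mu, P (a g x).
Proof.
move=> [N [mN N0 PN]]; exists (a g @^-1` N); split.
- by rewrite -[X in measurable X]setTI; exact: pact_measurable.
- by rewrite pact_preserving.
- by move=> x; exact: PN.
Qed.

Lemma linf_pred_comp (f : X -> Z) g :
  f \in linf_pred mu Z -> (fun x => f (a g x)) \in linf_pred mu Z.
Proof.
move=> /linf_predP[mf [M fM]]; apply/linf_predP; split=> [B|].
  rewrite -[X in measurable X]setTI.
  exact: (pact_measurable a g measurableT (mf B)).
by exists M; exact: (pact_ae (P := fun x => nr_norm (f x) <= M)).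
Qed.

Definition linf_translate (g : G) (l : Linf mu Z) : Linf mu Z :=
  linf_class mu (fun x => linf_repr l (a g^-1%g x)).

Lemma linf_translate_class g (f : X -> Z) : f \in linf_pred mu Z ->
  linf_translate g (linf_class mu f) = linf_class mu (fun x => f (a g^-1%g x)).
Proof.
move=> fP; apply/linf_class_eqP; rewrite ?linf_pred_comp ?linf_reprP//.
exact: (pact_ae (P := fun x => linf_repr (linf_class mu f) x = f x))
  (linf_classK fP).
Qed.

Lemma linf_translate1 l : linf_translate 1%g l = l.
Proof.
rewrite -[l]linf_reprK linf_translate_class ?linf_reprP// invg1.
by congr linf_class; apply/funext => x; rewrite pact1.
Qed.

Lemma linf_translateM g h l :
  linf_translate (g * h)%g l = linf_translate g (linf_translate h l).
Proof.
rewrite [linf_translate h l]/linf_translate linf_translate_class.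
  by congr linf_class; apply/funext => x; rewrite invgM pactM.
by rewrite linf_pred_comp ?linf_reprP.
Qed.

Lemma linf_translateB g : {morph linf_translate g : l m / l - m}.
Proof.
move=> l m; rewrite -[l]linf_reprK -[m]linf_reprK -linf_classB ?linf_reprP//.
rewrite !linf_translate_class ?linf_reprP//.
  by rewrite linf_classB ?linf_pred_comp ?linf_reprP.
exact: (rpredB (linf_reprP l) (linf_reprP m)).
Qed.

Lemma linf_translate_mul g : {morph linf_translate g : l m / l * m}.
Proof.
move=> l m; rewrite -[l]linf_reprK -[m]linf_reprK -linf_classM ?linf_reprP//.
rewrite !linf_translate_class ?linf_reprP//.
  by rewrite linf_classM ?linf_pred_comp ?linf_reprP.
exact: (rpredM (linf_reprP l) (linf_reprP m)).
Qed.

Lemma linf_translate_one g : linf_translate g 1 = 1.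
Proof.
by rewrite -linf_class1 linf_translate_class//; exact: (rpred1 (linf_pred mu Z)).
Qed.

Definition linf_action : ring_action G (Linf mu Z) :=
  RingAction linf_translate1 linf_translateM linf_translateB
    linf_translate_mul linf_translate_one.

End LinfAction.

Section Restriction.
Context d (X : measurableType d) (R : realType) (mu : probability X R).
Context (H G : groupType) (f : {multiplicative H -> G}) (a : pmp_action mu G).

Lemma restrict_pact1 x : a (f 1%g) x = x.
Proof.
have -> : f 1%g = 1%g by apply: (mulgI (f 1%g)); rewrite -gmulfM !mulg1.
exact: pact1.
Qed.

Lemma restrict_pactM g h x : a (f (g * h)%g) x = a (f g) (a (f h) x).
Proof. by rewrite gmulfM pactM. Qed.

Definition restrict_action : pmp_action mu H :=
  @PmpAction _ X R mu H (fun h => a (f h)) restrict_pact1 restrict_pactM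
    (fun h => pact_measurable a (f h)) (fun h => @pact_preserving _ _ _ _ _ a (f h)).

End Restriction.

Definition standard_borel d (X : measurableType d) (R : realType) : Prop :=
  exists (Y : completePseudoMetricType R) (f : X -> Y),
    [/\ hausdorff_space Y, @second_countable Y, bijective f &
        forall A : set X, measurable A <-> <<s @open Y >> (f @` A)].

Definition essentially_free d (X : measurableType d) (R : realType)
  (mu : probability X R) (G : groupType) (a : pmp_action mu G) : Prop :=
  \forall x \ae mu, forall g : G, a g x = x -> g = 1%g.

Definition standard_action d (X : measurableType d) (R : realType)
  (mu : probability X R) (G : groupType) (a : pmp_action mu G) : Prop :=
  [/\ standard_borel X R, countable [set: G] & essentially_free a].

Definition amalgamated_product (G0 G1 G2 G : groupType)
  (i1 : {multiplicative G0 -> G1}) (i2 : {multiplicative G0 -> G2})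
  (j1 : {multiplicative G1 -> G}) (j2 : {multiplicative G2 -> G}) : Prop :=
  [/\ injective i1, injective i2, j1 \o i1 =1 j2 \o i2 &
    forall (H : groupType) (f1 : {multiplicative G1 -> H})
      (f2 : {multiplicative G2 -> H}), f1 \o i1 =1 f2 \o i2 ->
      exists f : {multiplicative G -> H},
        [/\ f \o j1 =1 f1, f \o j2 =1 f2 &
            forall g : {multiplicative G -> H},
              g \o j1 =1 f1 -> g \o j2 =1 f2 -> g =1 f]].

Section Modules.
Context (A : nzRingType) (M : lmodType A).

Definition free_module : Prop :=
  exists (I : choiceType) (b : I -> M), forall x : M,
    exists! c : {fsfun I -> A with 0}, x = \sum_(i <- finsupp c) c i *: b i.

Definition projective_module : Prop :=
  forall (N N' : lmodType A) (p : {linear N -> N'}) (f : {linear M -> N'}),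
    (forall y, exists x, p x = y) ->
    exists h : {linear M -> N}, p \o h =1 f.

Definition finitely_generated : Prop :=
  exists (n : nat) (b : 'I_n -> M), forall x : M,
    exists c : 'I_n -> A, x = \sum_i c i *: b i.

End Modules.

(* For the trivial action the crossed product is the group ring L[G], and the
   base module is L with the trivial G-action. *)
Notation group_ring L G := (crossed_product (trivial_action G L)).
Notation trivial_module L G := (base_module (trivial_action G L)).

Record resolution (L : comNzRingType) (G : groupType) := Resolution {
  res_mod :> nat -> lmodType (group_ring L G);
  res_d : forall k, {linear res_mod k.+1 -> res_mod k};
  res_aug : {linear res_mod 0%N -> trivial_module L G};
  res_aug_surj : forall z, exists x, res_aug x = z;
  res_exact0 : forall x, res_aug x = 0 <-> exists y, res_d 0%N y = x;
  res_exact : forall k x, res_d k x = 0 <-> exists y, res_d k.+1 y = x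
}.

Record free_resolution (L : comNzRingType) (G : groupType) := FreeResolution {
  fres :> resolution L G;
  fres_free : forall k, free_module (fres k)
}.

Definition type_FPinfty (G : groupType) : Prop :=
  exists P : resolution int G,
    forall k, projective_module (P k) /\ finitely_generated (P k).

Definition log_plus (R : realType) (t : R) : R := Num.max (ln t) 0.

Section MeasuredEmbeddings.
Context d (X : measurableType d) (R : realType) (mu : probability X R).
Context (G : groupType) (a : pmp_action mu G) (Z : normed_ring R).

Local Notation LZ := (linf_action a Z).
Local Notation RZ := (crossed_product LZ).

(* The left ideal R (chi_A, 1), written <A>. *)
Definition ideal_of (A : set X) : set RZ :=
  [set r * cp_term LZ 1%g (linf_indic mu Z A) | r in setT].

Definition norm1 (r : RZ) : R :=
  \sum_(g <- msupp r) \int[mu]_x nr_norm (linf_repr (mcoeff g r) x).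

(* The marking isomorphism with the direct sum of the <A_i> is given as an
   injective linear map into the free module R^I with image that sum. *)
Record marked_module := MarkedModule {
  mm_mod :> lmodType RZ;
  mm_idx : finType;
  mm_set : mm_idx -> set X;
  mm_measurable : forall i, measurable (mm_set i);
  mm_iso : {linear mm_mod -> {ffun mm_idx -> RZ^o}};
  mm_iso_inj : injective mm_iso;
  mm_iso_range :
    range mm_iso = [set z | forall i, ideal_of (mm_set i) (z i)]
}.

Definition measure_sum (I : finType) (B : I -> set X) : R :=
  \sum_i fine (mu (B i)).

Definition mdim (M : marked_module) : R := measure_sum (@mm_set M).

Definition mnorm (M : marked_module) (x : M) : R := \sum_i norm1 (mm_iso M x i).

Definition msub (M : marked_module) (B : mm_idx M -> set X) : set M :=
  [set x | forall i, ideal_of (B i) (mm_iso M x i)].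

Definition marked_subfamily (M : marked_module) (B : mm_idx M -> set X) :
  Prop := forall i, measurable (B i) /\ B i `<=` mm_set i.

Definition marked_decomposition (M : marked_module) (m : nat)
  (B : 'I_m -> mm_idx M -> set X) : Prop :=
  forall i, [/\ forall k, measurable (B k i),
    mm_set i = \bigcup_(k in [set: 'I_m]) B k i &
    trivIset [set: 'I_m] (fun k => B k i)].

(* Marked summands of M are represented by families B of subsets of the marking
   sets.  [opnorm], [marked_rank] and [lognorm'] at B are those of the restriction
   of f to the summand [msub B] of M. *)
Section Lognorm.
Context (M N : marked_module) (f : {linear M -> N}).

(* The set is closed, and it is nonempty for every f between marked modules, so
   this infimum is the least such c. *)
Definition opnorm (B : mm_idx M -> set X) : R :=
  inf [set c | 0 <= c /\
    forall z, msub B z -> mnorm (f z) <= c * mnorm z].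

Definition marked_rank (B : mm_idx M -> set X) : R :=
  inf [set measure_sum B' | B' in [set B' : mm_idx N -> set X |
    marked_subfamily B' /\ f @` msub B `<=` msub B']].

Definition lognorm' (B : mm_idx M -> set X) : R :=
  Num.min (measure_sum B * log_plus (opnorm B))
          (marked_rank B * log_plus (opnorm B)).

Definition lognorm : R :=
  inf [set r | exists (m : nat) (B : 'I_m -> mm_idx M -> set X),
    marked_decomposition B /\ r = \sum_k lognorm' (B k)].

End Lognorm.

Record marked_complex := MarkedComplex {
  mc_mod :> nat -> marked_module;
  mc_d : forall k, {linear mc_mod k.+1 -> mc_mod k};
  mc_aug : {linear mc_mod 0%N -> base_module LZ};
  mc_dd : forall k x, mc_d k (mc_d k.+1 x) = 0;
  mc_aug_surj : forall z, exists x, mc_aug x = z;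
  mc_augd : forall x, mc_aug (mc_d 0%N x) = 0
}.

Definition group_ring_incl (r : group_ring Z G) : RZ :=
  \sum_(g <- msupp r) cp_term LZ g (linf_const mu (mcoeff g r)).

(* D receives a G-equivariant chain map from C up to degree n + 1 that extends the
   inclusion of constants Z -> L^oo; the class of all such D is A_n(a). *)
Definition embeds (C : free_resolution Z G) (n : nat) (D : marked_complex) :
  Prop :=
  exists f : forall k, C k -> D k,
    [/\ forall k, (k <= n.+1)%N ->
          GRing.linear_for (group_ring_incl \; *:%R) (f k),
        forall x, mc_aug D (f 0%N x) = linf_const mu (res_aug C x) &
        forall k, (k <= n)%N -> forall x,
          mc_d D k (f k.+1 x) = f k (res_d C k x)].

Definition medim (C : free_resolution Z G) (n : nat) : \bar R :=
  ereal_inf [set r | exists D, embeds C n D /\ r = (mdim (D n))%:E].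

(* medim in degree n - 1, with value 0 in degree -1. *)
Definition medim_pred (C : free_resolution Z G) (n : nat) : \bar R :=
  if n is m.+1 then medim C m else 0%E.

End MeasuredEmbeddings.

Definition mevol d (X : measurableType d) (R : realType)
  (mu : probability X R) (G : groupType) (a : pmp_action mu G)
  (C : free_resolution (normed_int R) G) (n : nat) : \bar R :=
  ereal_inf [set r | exists D : marked_complex a (normed_int R),
    embeds C n D /\ r = (lognorm (mc_d D n))%:E].

(* Main.v *)
(* Let G = G1 *_G0 G2. Embeddings are taken on homogeneous bar chains: a chain map
   out of a free resolution amounts to equivariant maps G^(k+1) -> D_k commuting
   with the boundaries. Given such maps phi_i for complexes D1, D2 (over G1, G2) and
   D0 (over G0), and a chain map psi from D0 to the L^oo-linear bar resolution of G,
   the cone Ind D1 + Ind D2 + Ind D0[1] is twisted by phi_1 psi - phi_2 psi. It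
   receives the bar resolution of G: the maps coming from phi_1 and phi_2 are
   G0-equivariantly homotopic, and the homotopies are summed along paths of the
   Bass-Serre tree; the sum along a path is expressed by the derivation of G that
   vanishes on G1 and is the coboundary of the homotopy on G2. The dimension of the
   cone gives (i). Its logarithmic norm in degree n exceeds the contributions of D1
   and D2 by at most dim (D0)_n * log_+ of the norm of the twist on generators. For
   trivial G0 take D0 concentrated in degree 0, which gives (ii). For G0 = Z, a
   Rokhlin-type marker A with mu A <= 1/N that every point visits within 2N steps
   yields a two-term complex <A> -> <A> on which the twist has norm O(N), so that
   the excess is O(log N / N), which gives (iii). *)
Require Import Defs.
From HB Require Import structures.
From mathcomp Require Import finmap.
From mathcomp Require monalg.
Import -(notations) monalg.
From mathcomp Require Import all_boot all_order all_algebra.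
From mathcomp Require Import all_classical all_reals all_analysis.
From mathcomp Require Import measurable_realfun.
From mathcomp Require Import zify lra.
Set Implicit Arguments.
Unset Strict Implicit.
Unset Printing Implicit Defensive.
Import Order.TTheory GRing.Theory Num.Theory.
Local Open Scope classical_set_scope.
Local Open Scope ring_scope.

(** * Groups *)

(** The amalgam is given only by its universal property, so generation, injectivity of [j1] and
    [j2], and the derivation are each obtained by letting G1 and G2 act on a well chosen set,
    compatibly on G0; no normal form of words is used. The obstacle in the cone is that D1 and D2
    are not assumed acyclic: no comparison theorem makes the maps coming from phi_1 and phi_2
    homotopic inside the induced complexes. The comparison is therefore made in [bar LG], which has
    an explicit contraction, and is evaluated in the cone through [ev1] and [ev2]. Each phi_i lives
    on tuples of G_i; equivariant retractions G -> G_i extend it to tuples of G. Induced modules are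
    not formed as tensor products: the marked module with the same sets represents them, and maps
    out of them are semilinear maps. For [mevol], D0 may depend on D1, D2 and the tolerance, since
    the norm of the twist depends on phi_1 and phi_2. In (iii) the twist has to be bounded before
    the marker is chosen; this works because psi sends the generators of D0 to multiples of two
    cells that do not depend on the marker. *)

Section Bijections.
Variable S : Type.

(** Groups of bijections are the targets on which the universal property is tested: actions of G1
    and G2 on S that agree on G0 are combined into an action of G. *)
Record sperm := Sperm {
  sp_fun :> S -> S;
  sp_inv : S -> S;
  sp_funK : cancel sp_fun sp_inv;
  sp_invK : cancel sp_inv sp_fun }.

HB.instance Definition _ := gen_eqMixin sperm.
HB.instance Definition _ := gen_choiceMixin sperm.

Lemma spermP (p q : sperm) : p =1 q -> p = q.
Proof.
case: p q => [f f' fK f'K] [g g' gK g'K] /= /funext fg.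
move: fK f'K; rewrite fg => fK f'K.
have f'g' : f' = g' by apply/funext => x; rewrite -{1}(g'K x) fK.
by move: fK f'K; rewrite f'g' => fK f'K; congr Sperm; exact: Prop_irrelevance.
Qed.

Definition sperm1 : sperm := @Sperm id id (fun=> erefl) (fun=> erefl).
Definition spermM (p q : sperm) : sperm :=
  Sperm (can_comp (@sp_funK p) (@sp_funK q))
        (can_comp (@sp_invK q) (@sp_invK p)).
Definition spermV (p : sperm) : sperm := Sperm (@sp_invK p) (@sp_funK p).

Lemma spermA : associative spermM. Proof. by move=> ? ? ?; exact: spermP. Qed.
Lemma sperm1m : left_id sperm1 spermM. Proof. by move=> ?; exact: spermP. Qed.
Lemma spermm1 : right_id sperm1 spermM. Proof. by move=> ?; exact: spermP. Qed.
Lemma spermVm : left_inverse sperm1 spermV spermM.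
Proof. by move=> p; apply: spermP => x /=; exact: sp_funK. Qed.
Lemma spermmV : right_inverse sperm1 spermV spermM.
Proof. by move=> p; apply: spermP => x /=; exact: sp_invK. Qed.

HB.instance Definition _ :=
  isGroup.Build sperm spermA sperm1m spermm1 spermVm spermmV.

Lemma spermME (p q : sperm) x : (p * q)%g x = p (q x).
Proof. by []. Qed.

End Bijections.

Section PermutationRepresentation.
Variables (G : groupType) (S : Type) (act : G -> S -> S).
Hypotheses (act1 : act 1%g =1 id)
  (actM : forall g h x, act (g * h)%g x = act g (act h x)).

Lemma perm_rep_funK g : cancel (act g) (act g^-1%g).
Proof. by move=> x; rewrite -actM mulVg act1. Qed.

Lemma perm_rep_invK g : cancel (act g^-1%g) (act g).
Proof. by move=> x; rewrite -actM mulgV act1. Qed.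

Definition perm_rep_fun g := Sperm (@perm_rep_funK g) (@perm_rep_invK g).

Lemma perm_rep_morph : {morph perm_rep_fun : g h / (g * h)%g}.
Proof. by move=> g h; apply: spermP => x /=; rewrite actM. Qed.

HB.instance Definition _ :=
  monoid.isMultiplicative.Build G (sperm S) perm_rep_fun perm_rep_morph.

Definition perm_rep : {multiplicative G -> sperm S} := perm_rep_fun.

End PermutationRepresentation.

Section Conjugation.
Variables (G : groupType) (S : Type) (act : G -> S -> S) (p : sperm S).
Hypotheses (act1 : act 1%g =1 id)
  (actM : forall g h x, act (g * h)%g x = act g (act h x)).

Definition conj_act g x := sp_inv p (act g (p x)).

Lemma conj_act1 : conj_act 1%g =1 id.
Proof. by move=> x; rewrite /conj_act act1 sp_funK. Qed.

Lemma conj_actM g h x : conj_act (g * h)%g x = conj_act g (conj_act h x).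
Proof. by rewrite /conj_act sp_invK actM. Qed.

Definition conj_rep : {multiplicative G -> sperm S} :=
  perm_rep conj_act1 conj_actM.

End Conjugation.

Lemma multiplicative1 (G H : groupType) (f : {multiplicative G -> H}) :
  f 1%g = 1%g.
Proof. by apply: (mulgI (f 1%g)); rewrite -gmulfM !mulg1. Qed.

Lemma multiplicativeV (G H : groupType) (f : {multiplicative G -> H}) g :
  f g^-1%g = (f g)^-1%g.
Proof.
by apply: (mulgI (f g)); rewrite -gmulfM !mulgV multiplicative1.
Qed.

Section EquivariantRetraction.
Variables (H G : groupType) (j : {multiplicative H -> G}).
Hypothesis j_inj : injective j.

Let orbit_rep (x : G) : G := xget 1%g [set y | exists h, x = (j h * y)%g].

Lemma orbit_repP x : exists h, x = (j h * orbit_rep x)%g.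
Proof.
apply: (@xgetI _ _ [set y | exists h, x = (j h * y)%g] x).
by exists 1%g; rewrite multiplicative1 mul1g.
Qed.

(** The orbits of the two points are equal as sets, so the choice operator returns the same
    representative for both. *)
Lemma orbit_repM h x : orbit_rep (j h * x)%g = orbit_rep x.
Proof.
rewrite /orbit_rep; set A := [set y | _]; set B := [set y | _].
suff -> : A = B by [].
apply/seteqP; split=> y [k].
  move=> /(congr1 (fun z => j h^-1 * z)%g); rewrite !mulgA -!gmulfM mulVg.
  by rewrite multiplicative1 mul1g => xE; exists (h^-1 * k)%g.
by move=> xE; exists (h * k)%g; rewrite gmulfM -mulgA -xE.
Qed.

(** G is a free left H-set, and [r x] is the H-coordinate of x relative to the representative of its
    coset. Composing with [r] turns functions on tuples of H into functions on tuples of G. *)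
Lemma equivariant_retraction :
  exists r : G -> H, forall h x, r (j h * x)%g = (h * r x)%g.
Proof.
have [r rP] := choice orbit_repP; exists r => h x.
apply: j_inj; apply: (mulIg (orbit_rep x)).
by rewrite -[in LHS](orbit_repM h x) -rP gmulfM -mulgA -rP.
Qed.

End EquivariantRetraction.

(** * Consequences of the universal property of an amalgam *)

Section Amalgam.
Variables (G0 G1 G2 G : groupType).
Variables (i1 : {multiplicative G0 -> G1}) (i2 : {multiplicative G0 -> G2}).
Variables (j1 : {multiplicative G1 -> G}) (j2 : {multiplicative G2 -> G}).
Hypothesis amalgam : amalgamated_product i1 i2 j1 j2.

(* Left multiplication on two copies of G, and its conjugate by the involution
   exchanging the copies over P, agree on G1 and G2, hence on G. *)
Lemma amalgam_generated (P : set G) :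
  (forall g, P (j1 g)) -> (forall g, P (j2 g)) ->
  (forall g h, P g -> P h -> P (g * h)%g) -> (forall g, P g -> P g^-1%g) ->
  forall g, P g.
Proof.
case: amalgam => _ _ ji univ P1 P2 PM PV.
pose act (g : G) (xb : G * bool) := ((g * xb.1)%g, xb.2).
have act1 : act 1%g =1 id by move=> [x b]; rewrite /act mul1g.
have actM g h xb : act (g * h)%g xb = act g (act h xb) by rewrite /act mulgA.
pose flip (xb : G * bool) := (xb.1, xb.2 (+) `[< P xb.1 >]).
have flipK : cancel flip flip by move=> [x b]; rewrite /flip /= addbK.
pose p := Sperm flipK flipK.
pose l := perm_rep act1 actM.
pose l' := conj_rep p act1 actM.
have ll' g : P g -> l g = l' g.
  move=> Pg; apply: spermP => -[x b]; rewrite /l /l' /= /conj_act /= /act /flip /=.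
  congr (_, _); have -> : `[< P (g * x)%g >] = `[< P x >].
    apply/asboolP/asboolP => [/(PM _ _ (PV _ Pg))|/(PM _ _ Pg) //].
    by rewrite mulKg.
  by rewrite addbK.
have [|f [_ _ f_uniq]] := univ _ (l \o j1) (l \o j2).
  by move=> g /=; move: (ji g) => /= ->.
have lE : l =1 f by apply: f_uniq.
have l'E : l' =1 f by apply: f_uniq => g /=; rewrite ll'.
(* At (1, false), [l g] keeps the bit, while [l' g] flips it once for P 1 and once if P g holds. As
   P 1 holds, equality forces P g. *)
move=> g; have /(congr1 (fun q : sperm _ => (q (1%g, false)).2)) : l g = l' g.
  by rewrite lE l'E.
rewrite /= /conj_act /= /act /flip /= mulg1.
have -> : `[< P 1%g >] = true.
  by apply/asboolP; rewrite -(multiplicative1 j1).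
by move=> /esym; rewrite addTb => /negbT; rewrite negbK => /asboolP.
Qed.

(** A transversal splits each G_i as G0 times a set. The involution [swap] of G1 x G2 exchanges the
    two G0-coordinates, so conjugating the action of G2 on the second factor by it makes G0 act on
    the first factor as it does through G1. Both actions stay faithful. *)
Lemma amalgam_embedding :
  exists (S : Type) (f1 : {multiplicative G1 -> sperm S})
    (f2 : {multiplicative G2 -> sperm S}),
  [/\ f1 \o i1 =1 f2 \o i2, injective f1 & injective f2].
Proof.
case: amalgam => i1_inj i2_inj _ _.
have [r1 r1M] := equivariant_retraction i1_inj.
have [r2 r2M] := equivariant_retraction i2_inj.
pose swap (xy : G1 * G2) : G1 * G2 :=
  ((i1 (r2 xy.2) * ((i1 (r1 xy.1))^-1 * xy.1))%g,
   (i2 (r1 xy.1) * ((i2 (r2 xy.2))^-1 * xy.2))%g).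
have r1s xy : r1 (swap xy).1 = r2 xy.2.
  by rewrite /= -multiplicativeV !r1M mulVg mulg1.
have r2s xy : r2 (swap xy).2 = r1 xy.1.
  by rewrite /= -multiplicativeV !r2M mulVg mulg1.
have swapK : cancel swap swap.
  by move=> [x y]; rewrite {1}/swap r1s r2s /= !mulKg !mulVKg.
pose p := Sperm swapK swapK.
pose act1 (g : G1) (xy : G1 * G2) := ((g * xy.1)%g, xy.2).
pose act2 (g : G2) (xy : G1 * G2) := (xy.1, (g * xy.2)%g).
have act11 : act1 1%g =1 id by move=> [x y]; rewrite /act1 mul1g.
have act1M g h xy : act1 (g * h)%g xy = act1 g (act1 h xy).
  by rewrite /act1 mulgA.
have act21 : act2 1%g =1 id by move=> [x y]; rewrite /act2 mul1g.
have act2M g h xy : act2 (g * h)%g xy = act2 g (act2 h xy).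
  by rewrite /act2 mulgA.
exists (G1 * G2)%type, (perm_rep act11 act1M),
  (conj_rep p act21 act2M); split.
- move=> g; apply: spermP => xy /=; rewrite /conj_act /= -[LHS]swapK; congr swap.
  rewrite /act2 /act1 /swap /= r1M gmulfM invgM gmulfM -!mulgA.
  by rewrite mulKg.
- move=> g h /(congr1 (fun q : sperm _ => (q (1%g, 1%g)).1)) /=.
  by rewrite !mulg1.
- move=> g h /(congr1 (fun q : sperm _ => q (swap (1%g, 1%g)))).
  rewrite -[LHS]/(swap (act2 g (swap (swap _)))).
  rewrite -[RHS]/(swap (act2 h (swap (swap _)))) swapK.
  by move=> /(can_inj swapK) []; rewrite !mulg1.
Qed.

Lemma amalgam_inj : injective j1 /\ injective j2.
Proof.
have [S [f1 [f2 [f12 f1_inj f2_inj]]]] := amalgam_embedding.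
case: amalgam => _ _ _ /(_ _ _ _ f12) [f [fj1 fj2 _]].
split=> x y /(congr1 f).
- by rewrite -![f _]/((f \o j1) _) !fj1 => /f1_inj.
- by rewrite -![f _]/((f \o j2) _) !fj2 => /f2_inj.
Qed.

Section Derivation.
Variables (W : zmodType) (act : G -> W -> W).
Hypotheses (act1 : act 1%g =1 id)
  (actM : forall g h x, act (g * h)%g x = act g (act h x))
  (actB : forall g, {morph act g : x y / x - y}).

Lemma act_zero g : act g 0 = 0.
Proof. by rewrite -{1}(subrr 0) actB subrr. Qed.

Lemma act_add g : {morph act g : x y / x + y}.
Proof.
by move=> x y; rewrite -{1}(opprK y) -(sub0r y) !actB act_zero sub0r opprK.
Qed.

(* G1 and the conjugate of G2 by the translation by e act on W x G by affine
   maps, and they agree on G0. *)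
Lemma amalgam_derivation (e : W) : (forall g, act (j1 (i1 g)) e = e) ->
  exists p : G -> W,
  [/\ forall g h, p (g * h)%g = p g + act g (p h),
      forall g, p (j1 g) = 0 & forall g, p (j2 g) = act (j2 g) e - e].
Proof.
case: amalgam => _ _ ji univ e_inv.
pose aff (g : G) (wx : W * G) := (act g wx.1, (g * wx.2)%g).
have aff1 : aff 1%g =1 id by move=> [w x]; rewrite /aff /= act1 mul1g.
have affM g h wx : aff (g * h)%g wx = aff g (aff h wx).
  by rewrite /aff /= actM mulgA.
pose tr (wx : W * G) := (wx.1 + e, wx.2).
pose tr' (wx : W * G) := (wx.1 - e, wx.2).
have trK : cancel tr tr' by move=> [w x]; rewrite /tr /tr' /= addrK.
have tr'K : cancel tr' tr by move=> [w x]; rewrite /tr /tr' /= subrK.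
pose p := Sperm trK tr'K.
pose l := perm_rep aff1 affM.
pose l' := conj_rep p aff1 affM.
have [|f [f1 f2 _]] := univ _ (l \o j1) (l' \o j2).
  move=> g; apply: spermP => -[w x]; move: (ji g) => /= <-.
  by rewrite /conj_act /= /tr' /aff /tr /= act_add e_inv addrK.
(* Each [f g] is affine with linear part [act g], which passes from the generators to G. Its
   translation part is the derivation, whose product rule is the composition of affine maps. *)
have fE g : exists c, forall wx, f g wx = (c + act g wx.1, (g * wx.2)%g).
  move: g; apply: amalgam_generated => [g|g|g h [c cE] [b bE]|g [c cE]].
  - by exists 0 => wx; move: (f1 g) => /= ->; rewrite add0r.
  - exists (act (j2 g) e - e) => -[w x]; move: (f2 g) => /= ->.
    rewrite /= /conj_act /= /tr' /aff /tr /=; congr (_, _).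
    by rewrite act_add [RHS]addrC addrA.
  - exists (c + act g b) => -[w x].
    by rewrite gmulfM /= bE cE /= act_add addrA actM mulgA.
  - exists (- act g^-1%g c) => -[w x].
    apply: (can_inj (@sp_funK _ (f g))).
    rewrite -[LHS]spermME -gmulfM mulgV multiplicative1 /= cE /=.
    rewrite act_add -actM mulgV act1 mulVKg; congr (_, _).
    have -> : act g (- act g^-1%g c) = - c.
      by rewrite -sub0r actB act_zero -actM mulgV act1 sub0r.
    by rewrite addrA subrr add0r.
have [c cE] := choice fE; exists c; split=> [g h|g|g].
- have /(congr1 fst) : f (g * h)%g (0, 1%g) = f g (f h (0, 1%g)).
    by rewrite gmulfM.
  rewrite !cE /=.
  by rewrite !act_zero !addr0.
- have /(congr1 (fun q : sperm _ => (q (0, 1%g)).1)) := f1 g.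
  by rewrite /= cE /= => /(canRL (addrK _)); rewrite subrr.
- have /(congr1 (fun q : sperm _ => (q (0, 1%g)).1)) := f2 g.
  rewrite /= cE /= /conj_act /= /tr' /aff /tr /= act_add.
  by rewrite !act_zero addr0 add0r.
Qed.

End Derivation.
End Amalgam.

(** * Reflection of equations in abelian groups *)

Section AbelianReflection.

Inductive zexpr := ZVar of nat | ZAdd of zexpr & zexpr | ZOpp of zexpr | ZZero.

Fixpoint zeval (V : zmodType) (env : seq V) e : V :=
  match e with
  | ZVar n => nth 0 env n
  | ZAdd e1 e2 => zeval env e1 + zeval env e2
  | ZOpp e1 => - zeval env e1
  | ZZero => 0
  end.

Fixpoint zcoef e i : int :=
  match e with
  | ZVar n => (n == i)%:Z
  | ZAdd e1 e2 => zcoef e1 i + zcoef e2 i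
  | ZOpp e1 => - zcoef e1 i
  | ZZero => 0
  end.

Lemma zeval_coef (V : zmodType) (env : seq V) e :
  zeval env e = \sum_(i <- iota 0 (size env)) nth 0 env i *~ zcoef e i.
Proof.
elim: e => [n|e1 IH1 e2 IH2|e1 IH1|] /=.
- have [n_lt|n_ge] := ltnP n (size env); last first.
    rewrite nth_default// big_seq big1// => i; rewrite mem_iota add0n => /andP[_ i_lt].
    by rewrite gtn_eqF ?mulr0z// (leq_trans i_lt).
  rewrite (bigD1_seq n) ?iota_uniq ?mem_iota//= eqxx mulr1z big1 ?addr0// => i.
  by rewrite eq_sym => /negbTE ->; rewrite mulr0z.
- by rewrite IH1 IH2 -big_split; apply: eq_bigr => i _; rewrite mulrzDr.
- by rewrite IH1 -sumrN; apply: eq_bigr => i _; rewrite mulrNz.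
- by rewrite big1// => i _; rewrite mulr0z.
Qed.

Lemma zexpr_eq (V : zmodType) (env : seq V) e1 e2 :
  all (fun i => zcoef e1 i == zcoef e2 i) (iota 0 (size env)) ->
  zeval env e1 = zeval env e2.
Proof.
move=> /allP e12; rewrite !zeval_coef big_seq [RHS]big_seq.
by apply: eq_bigr => i /e12 /eqP ->.
Qed.

End AbelianReflection.

Ltac zmod_index env t n :=
  lazymatch env with
  | ?x :: ?env' =>
      match constr:(tt) with
      | _ => let _ := match constr:(tt) with _ => constr_eq x t end in n
      | _ => zmod_index env' t (S n)
      end
  | _ => fail
  end.

Ltac zmod_atoms env e :=
  lazymatch e with
  | @GRing.add _ ?a ?b => let env' := zmod_atoms env a in zmod_atoms env' b
  | @GRing.opp _ ?a => zmod_atoms env a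
  | @GRing.zero _ => env
  | _ => match constr:(tt) with
         | _ => let _ := zmod_index env e O in env
         | _ => constr:(e :: env)
         end
  end.

Ltac zmod_reify env e :=
  lazymatch e with
  | @GRing.add _ ?a ?b =>
      let a' := zmod_reify env a in let b' := zmod_reify env b in
      constr:(ZAdd a' b')
  | @GRing.opp _ ?a => let a' := zmod_reify env a in constr:(ZOpp a')
  | @GRing.zero _ => constr:(ZZero)
  | _ => let n := zmod_index env e O in constr:(ZVar n)
  end.

(* Decides equalities that hold in every abelian group. *)
Ltac zmod :=
  lazymatch goal with
  | |- @eq ?T ?a ?b =>
      let env0 := zmod_atoms (@nil T) a in
      let env := zmod_atoms env0 b in
      let a' := zmod_reify env a in
      let b' := zmod_reify env b in
      refine (@zexpr_eq _ env a' b' _); reflexivity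
  end.

(** * Homogeneous bar chains *)

Section MalgLift.
Context (K : choiceType) (L V : zmodType).
Implicit Types (F : K -> L -> V) (b : malg K L).

Lemma malg_ind (P : malg K L -> Prop) : P 0 ->
  (forall b b', P b -> P b' -> P (b + b')) ->
  (forall k x, P (mkmalgU k x)) -> forall b, P b.
Proof.
move=> P0 PD PU b; rewrite [b]monalgE.
by apply: (big_ind P) => // k _; exact: PU.
Qed.

Definition malg_lift F b : V := \sum_(k <- msupp b) F k (mcoeff k b).

Variable F : K -> L -> V.
Hypothesis F_morph : forall k, {morph F k : x y / x - y}.

Lemma malg_lift_F0 k : F k 0 = 0.
Proof. by rewrite -(subrr 0) F_morph subrr. Qed.

Lemma malg_liftw (D : {fset K}) b : fsubset (msupp b) D ->
  malg_lift F b = \sum_(k <- D) F k (mcoeff k b).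
Proof.
move=> le; apply: big_fset_incl => // k _ /mcoeff_outdom ->.
exact: malg_lift_F0.
Qed.

Lemma malg_liftB : {morph malg_lift F : b b' / b - b'}.
Proof.
move=> b b'; pose D := fsetU (msupp b) (msupp b').
rewrite (@malg_liftw D) ?msuppB_le// !(@malg_liftw D) ?fsubsetUl ?fsubsetUr//.
by rewrite -sumrB; apply: eq_bigr => k _; rewrite mcoeffB F_morph.
Qed.

Lemma malg_liftU k x : malg_lift F (mkmalgU k x) = F k x.
Proof. by rewrite (malg_liftw msuppU_le) big_seq_fset1 mcoeffUU. Qed.

End MalgLift.

Lemma morphB0 (U V : zmodType) (f : U -> V) :
  {morph f : x y / x - y} -> f 0 = 0.
Proof. by move=> fB; rewrite -(subrr 0) fB subrr. Qed.

Lemma morphBD (U V : zmodType) (f : U -> V) :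
  {morph f : x y / x - y} -> {morph f : x y / x + y}.
Proof.
by move=> fB x y; rewrite -[y in LHS]opprK -(sub0r y) !fB (morphB0 fB) sub0r opprK.
Qed.

Lemma morphBN (U V : zmodType) (f : U -> V) :
  {morph f : x y / x - y} -> {morph f : x / - x}.
Proof. by move=> fB x; rewrite -sub0r fB (morphB0 fB) sub0r. Qed.

Section AlternatingSum.
Variable T : Type.

(* The alternating sum of phi over the faces of a tuple. *)
Fixpoint bd (V : zmodType) (phi : seq T -> V) (c : seq T) : V :=
  if c is x :: c' then phi c' - bd (fun c'' => phi (x :: c'')) c' else 0.

Variable V : zmodType.
Implicit Types (phi psi : seq T -> V) (c : seq T).

Lemma eq_bd_size phi psi c :
  (forall c', (size c').+1 = size c -> phi c' = psi c') -> bd phi c = bd psi c.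
Proof.
elim: c phi psi => //= x c IHc phi psi eq_phi; rewrite eq_phi//.
by congr (_ - _); apply: IHc => c' sc'; apply: eq_phi; rewrite /= sc'.
Qed.

Lemma bd_morph (W : zmodType) (f : V -> W) : {morph f : x y / x - y} ->
  forall phi c, f (bd phi c) = bd (f \o phi) c.
Proof.
move=> fB phi c; elim: c phi => [|x c IHc] phi /=; first exact: morphB0.
by rewrite fB IHc.
Qed.

Lemma bdB phi psi c : bd (fun c => phi c - psi c) c = bd phi c - bd psi c.
Proof.
elim: c phi psi => [|x c IHc] phi psi /=; first by rewrite subr0.
by rewrite (IHc (phi \o cons x) (psi \o cons x)) !opprD addrACA.
Qed.

Lemma bd0 c : bd (fun=> 0 : V) c = 0.
Proof. by elim: c => //= x c ->; rewrite subr0. Qed.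

Lemma bdN phi c : bd (fun c => - phi c) c = - bd phi c.
Proof. by rewrite (bd_morph (f := -%R))// => x y; rewrite opprD. Qed.

Lemma bdD phi psi c : bd (fun c => phi c + psi c) c = bd phi c + bd psi c.
Proof.
rewrite -[psi in RHS]/(fun c => psi c) -[bd psi c]opprK -bdN -bdB.
by apply: eq_bd_size => c' _; rewrite opprK.
Qed.

(** The two copies of [bd phi] on the tail cancel, leaving the same statement on the tail for [phi]
    with the head prepended; hence the induction is uniform in [phi]. *)
Lemma bd_bd phi c : bd (bd phi) c = 0.
Proof.
elim: c phi => //= x c IHc phi.
by rewrite bdB IHc subr0 subrr.
Qed.

End AlternatingSum.

Lemma bd_mapE (T U : Type) (V : zmodType) (f : T -> U) (phi : seq U -> V) c :
  bd phi (map f c) = bd (fun c => phi (map f c)) c.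
Proof. by elim: c phi => //= x c IHc phi; rewrite IHc. Qed.

Lemma cp_ind (G : groupType) (L : comNzRingType) (s : ring_action G L)
    (P : crossed_product s -> Prop) : P 0 ->
  (forall a b, P a -> P b -> P (a + b)) ->
  (forall g x, P (cp_term s g x)) -> forall a, P a.
Proof. exact: malg_ind. Qed.

Lemma cp_termM (G : groupType) (L : comNzRingType) (s : ring_action G L)
    g h x y :
  cp_term s g x * cp_term s h y = cp_term s (g * h)%g (x * s g y).
Proof. exact: cp_mulUU. Qed.

Lemma cp_term1 (G : groupType) (L : comNzRingType) (s : ring_action G L) :
  cp_term s 1%g 1 = 1.
Proof. by []. Qed.

Lemma cp_term_base (G : groupType) (L : comNzRingType) (s : ring_action G L)
    g x (y : base_module s) : cp_term s g x *: y = x * s g y :> L.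
Proof. exact: cp_scaleU. Qed.

(** The augmented homogeneous bar complex as one ungraded module: tuples of all lengths are allowed
    and the empty one spans degree -1, so that the augmentation is an instance of [bar_d]. *)
Definition bar (G : groupType) (L : comNzRingType) (s : ring_action G L) : Type :=
  malg (seq G) L.

HB.instance Definition _ G L (s : ring_action G L) :=
  GRing.Zmodule.copy (bar s) (malg (seq G) L).

Definition translate (G : groupType) (g : G) (c : seq G) : seq G :=
  [seq (g * x)%g | x <- c].

Notation "g ⋅ c" := (translate g c) (at level 40).

Lemma size_translate (G : groupType) (g : G) c : size (g ⋅ c) = size c.
Proof. exact: size_map. Qed.

Lemma bd_translate (G : groupType) (V : zmodType) (phi : seq G -> V) g c :
  bd phi (g ⋅ c) = bd (fun c => phi (g ⋅ c)) c.
Proof. exact: bd_mapE. Qed.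

Lemma tr1 (G : groupType) (c : seq G) : 1%g ⋅ c = c.
Proof. by rewrite /translate -[RHS]map_id; apply: eq_map => x; rewrite mul1g. Qed.

Lemma trM (G : groupType) g h (c : seq G) : (g * h)%g ⋅ c = g ⋅ (h ⋅ c).
Proof. by rewrite /translate -map_comp; apply: eq_map => x /=; rewrite mulgA. Qed.

Section Bar.
Context (G : groupType) (L : comNzRingType) (s : ring_action G L).
Implicit Types (a : crossed_product s) (b : bar s) (c : seq G) (g h : G).

Definition bar_term c (x : L) : bar s := mkmalgU c x.

Lemma bar_termB c : {morph bar_term c : x y / x - y}.
Proof. exact: (raddfB (mkmalgU c)). Qed.

Lemma bar_ind (P : bar s -> Prop) : P 0 ->
  (forall b b', P b -> P b' -> P (b + b')) ->
  (forall c x, P (bar_term c x)) -> forall b, P b.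
Proof. exact: malg_ind. Qed.

Definition bar_act g (x : L) : bar s -> bar s :=
  malg_lift (fun c y => bar_term (g ⋅ c) (x * s g y)).

Lemma bar_act_morph g x c :
  {morph (fun y => bar_term (g ⋅ c) (x * s g y)) : y z / y - z}.
Proof. by move=> y z; rewrite ractB mulrBr bar_termB. Qed.

Lemma bar_actU g x c y :
  bar_act g x (bar_term c y) = bar_term (g ⋅ c) (x * s g y).
Proof. exact: malg_liftU (bar_act_morph g x) _ _. Qed.

Lemma bar_actB g x : {morph bar_act g x : b b' / b - b'}.
Proof. exact: malg_liftB (bar_act_morph g x). Qed.

Lemma bar_act_coefB g b : {morph bar_act g ^~ b : x y / x - y}.
Proof.
move=> x y; elim/bar_ind: b => [|b b' IHb IHb'|c z].
- by rewrite !(morphB0 (@bar_actB _ _)) subrr.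
- by rewrite !(morphBD (@bar_actB _ _)) IHb IHb' opprD addrACA.
- by rewrite !bar_actU mulrBl bar_termB.
Qed.

Definition bar_scale a b : bar s := malg_lift (fun g x => bar_act g x b) a.

Lemma bar_scaleBl b : {morph bar_scale ^~ b : a a' / a - a'}.
Proof. exact: malg_liftB (fun g => bar_act_coefB g b). Qed.

Lemma bar_scaleU g x b : bar_scale (cp_term s g x) b = bar_act g x b.
Proof. exact: malg_liftU (fun g => bar_act_coefB g b) _ _. Qed.

Lemma bar_scaleBr a : {morph bar_scale a : b b' / b - b'}.
Proof.
move=> b b'; elim/cp_ind: a => [|a a' IHa IHa'|g x].
- by rewrite !(morphB0 (@bar_scaleBl _)) subrr.
- by rewrite !(morphBD (@bar_scaleBl _)) IHa IHa' opprD addrACA.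
- by rewrite !bar_scaleU bar_actB.
Qed.

Lemma bar_scaleA a a' b : bar_scale a (bar_scale a' b) = bar_scale (a * a') b.
Proof.
elim/cp_ind: a => [|a1 a2 IH1 IH2|g x].
- by rewrite mul0r !(morphB0 (@bar_scaleBl _)).
- by rewrite mulrDl !(morphBD (@bar_scaleBl _)) IH1 IH2.
elim/cp_ind: a' => [|a1 a2 IH1 IH2|h y].
- by rewrite mulr0 !(morphB0 (@bar_scaleBl _)) (morphB0 (@bar_scaleBr _)).
- by rewrite mulrDr !(morphBD (@bar_scaleBl _)) (morphBD (@bar_scaleBr _)) IH1 IH2.
elim/bar_ind: b => [|b1 b2 IH1 IH2|c z].
- by rewrite !(morphB0 (@bar_scaleBr _)).
- by rewrite !(morphBD (@bar_scaleBr _)) IH1 IH2.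
by rewrite cp_termM !bar_scaleU !bar_actU trM ract_mul ractM mulrA.
Qed.

Lemma bar_scale1 : left_id 1 bar_scale.
Proof.
elim/bar_ind => [|b1 b2 IH1 IH2|c z].
- by rewrite !(morphB0 (@bar_scaleBr _)).
- by rewrite !(morphBD (@bar_scaleBr _)) IH1 IH2.
by rewrite -cp_term1 bar_scaleU bar_actU tr1 ract1 mul1r.
Qed.

Lemma bar_scaleDr : right_distributive bar_scale +%R.
Proof. by move=> a; exact: morphBD (@bar_scaleBr a). Qed.

Lemma bar_scaleDl b : {morph bar_scale ^~ b : a a' / a + a'}.
Proof. exact: morphBD (@bar_scaleBl b). Qed.

HB.instance Definition _ :=
  GRing.Zmodule_isLmodule.Build (crossed_product s) (bar s)
    bar_scaleA bar_scale1 bar_scaleDr bar_scaleDl.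

Lemma bar_scaleE g x c y :
  cp_term s g x *: bar_term c y = bar_term (g ⋅ c) (x * s g y).
Proof. by rewrite [LHS]bar_scaleU bar_actU. Qed.

Definition bar_d : bar s -> bar s :=
  malg_lift (fun c y => bd (bar_term ^~ y) c).

Lemma bar_d_morph c : {morph (fun y => bd (bar_term ^~ y) c) : y z / y - z}.
Proof.
by move=> y z; rewrite -bdB; apply: eq_bd_size => c' _; rewrite bar_termB.
Qed.

Lemma bar_dU c y : bar_d (bar_term c y) = bd (bar_term ^~ y) c.
Proof. exact: malg_liftU bar_d_morph _ _. Qed.

Lemma bar_dB : {morph bar_d : b b' / b - b'}.
Proof. exact: malg_liftB bar_d_morph. Qed.

Lemma bar_dZ a b : bar_d (a *: b) = a *: bar_d b.
Proof.
elim/cp_ind: a => [|a1 a2 IH1 IH2|g x].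
- by rewrite !scale0r (morphB0 bar_dB).
- by rewrite !scalerDl (morphBD bar_dB) IH1 IH2.
elim/bar_ind: b => [|b1 b2 IH1 IH2|c z].
- by rewrite scaler0 !(morphB0 bar_dB) scaler0.
- by rewrite scalerDr !(morphBD bar_dB) scalerDr IH1 IH2.
rewrite bar_scaleE !bar_dU bd_translate (bd_morph (f := *:%R _)).
  by apply: eq_bd_size => c' _; rewrite /= bar_scaleE.
by move=> u v; rewrite scalerBr.
Qed.

Lemma bar_d_linear : linear bar_d.
Proof. by move=> a b b'; rewrite (morphBD bar_dB) bar_dZ. Qed.

HB.instance Definition _ :=
  GRing.isLinear.Build (crossed_product s) (bar s) (bar s) *:%R bar_d
    bar_d_linear.

Definition bar_cons (x : G) : bar s -> bar s :=
  malg_lift (fun c y => bar_term (x :: c) y).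

Lemma bar_consU x c y : bar_cons x (bar_term c y) = bar_term (x :: c) y.
Proof. exact: malg_liftU (fun c => bar_termB (x :: c)) _ _. Qed.

Lemma bar_consB x : {morph bar_cons x : b b' / b - b'}.
Proof. exact: malg_liftB (fun c => bar_termB (x :: c)). Qed.

HB.instance Definition _ x :=
  GRing.isZmodMorphism.Build (bar s) (bar s) (bar_cons x) (bar_consB x).

(** Prepending a vertex contracts the augmented complex, including degree -1: each cycle [b] is the
    boundary of [bar_cons x b]. *)
Lemma bar_d_cons x b : bar_d (bar_cons x b) = b - bar_cons x (bar_d b).
Proof.
elim/bar_ind: b => [|b1 b2 IH1 IH2|c z]; first by rewrite !raddf0 addr0.
  by rewrite !raddfD /= IH1 IH2 [LHS]addrACA.
rewrite bar_consU !bar_dU /= (bd_morph (bar_consB x)); congr (_ - _).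
by apply: eq_bd_size => c' _; rewrite /= bar_consU.
Qed.

(** The contraction at a fixed vertex is not equivariant; it becomes so when the vertex moves along
    with the chain. *)
Lemma bar_cons_act g x y b :
  bar_cons (g * x)%g (cp_term s g y *: b) = cp_term s g y *: bar_cons x b.
Proof.
elim/bar_ind: b => [|b1 b2 IH1 IH2|c z]; first by rewrite !(raddf0, scaler0).
  by rewrite !(raddfD, scalerDr) /= IH1 IH2.
by rewrite bar_consU !bar_scaleE bar_consU.
Qed.

End Bar.

Section BarEval.
Context (G0 G : groupType) (L0 L : comNzRingType).
Context (s0 : ring_action G0 L0) (s : ring_action G L).
Context (kappa : {additive L0 -> L}) (V : lmodType (crossed_product s)).
Implicit Types (phi : seq G0 -> V) (b : bar s0).

(** Serves two base changes: [kappa] is the inclusion of constants when group ring chains are mapped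
    to D, and the identity of the coefficients in the cone. *)
Definition bar_eval phi : bar s0 -> V :=
  malg_lift (fun c y => cp_term s 1%g (kappa y) *: phi c).

Lemma bar_eval_morph phi c :
  {morph (fun y => cp_term s 1%g (kappa y) *: phi c) : y z / y - z}.
Proof. by move=> y z; rewrite raddfB /= cp_termB scalerBl. Qed.

Lemma bar_evalU phi c y :
  bar_eval phi (bar_term s0 c y) = cp_term s 1%g (kappa y) *: phi c.
Proof. exact: malg_liftU (bar_eval_morph phi) _ _. Qed.

Lemma bar_evalB phi : {morph bar_eval phi : b b' / b - b'}.
Proof. exact: malg_liftB (bar_eval_morph phi). Qed.

HB.instance Definition _ phi :=
  GRing.isZmodMorphism.Build (bar s0) V (bar_eval phi) (bar_evalB phi).

Lemma bar_eval_d phi b : bar_eval phi (bar_d b) = bar_eval (bd phi) b.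
Proof.
elim/bar_ind: b => [|b1 b2 IH1 IH2|c z]; first by rewrite !raddf0.
  by rewrite !raddfD /= IH1 IH2.
rewrite bar_dU bar_evalU (bd_morph (bar_evalB phi)).
rewrite (bd_morph (f := *:%R (cp_term s 1%g (kappa z)))) => [|u v].
  by apply: eq_bd_size => c' _; rewrite /= bar_evalU.
by rewrite scalerBr.
Qed.

Lemma eq_bar_eval phi psi b : phi =1 psi -> bar_eval phi b = bar_eval psi b.
Proof. by move=> /funext ->. Qed.

Lemma bar_eval_act g0 g phi b x :
  (forall c, phi (g0 ⋅ c) = cp_term s g 1 *: phi c) ->
  (forall y, kappa (x * s0 g0 y) = kappa x * s g (kappa y)) ->
  bar_eval phi (cp_term s0 g0 x *: b) = cp_term s g (kappa x) *: bar_eval phi b.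
Proof.
move=> phi_g kappa_g.
elim/bar_ind: b => [|b1 b2 IH1 IH2|c z]; first by rewrite !(raddf0, scaler0).
  by rewrite !(raddfD, scalerDr) /= IH1 IH2.
rewrite bar_scaleE !bar_evalU phi_g !scalerA !cp_termM kappa_g.
by rewrite ract1 !mulr1 mul1g mulg1.
Qed.

End BarEval.

Arguments bar_eval {G0 G L0 L} s0 {s} kappa {V} phi _.

Lemma bar_eval_comp (G0 G : groupType) (L0 L : comNzRingType)
    (s0 : ring_action G0 L0) (s : ring_action G L) (kappa : {additive L0 -> L})
    (V W : lmodType (crossed_product s)) (f : {linear V -> W})
    (phi : seq G0 -> V) b :
  f (bar_eval s0 kappa phi b) = bar_eval s0 kappa (f \o phi) b.
Proof.
elim/bar_ind: b => [|b1 b2 IH1 IH2|c z]; first by rewrite !raddf0.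
  by rewrite !raddfD /= IH1 IH2.
by rewrite !bar_evalU linearZ.
Qed.

(** * Gluing chain maps along an amalgam *)

Section Transport.
Context (G : groupType) (L : comNzRingType) (s : ring_action G L).
Context (V : lmodType (crossed_product s)).
Implicit Types (phi : seq G -> V).

Definition gact g (x : V) : V := cp_term s g 1 *: x.

Lemma gact1 x : gact 1%g x = x.
Proof. by rewrite /gact cp_term1 scale1r. Qed.

Lemma gactM g h x : gact (g * h)%g x = gact g (gact h x).
Proof. by rewrite /gact scalerA cp_termM ract_one mulr1. Qed.

Lemma gactB g : {morph gact g : x y / x - y}.
Proof. by move=> x y; exact: scalerBr. Qed.

(** The conjugation action on functions of tuples, whose fixed points are the equivariant maps. It
    is the module to which [amalgam_derivation] is applied. *)
Definition transport g phi : seq G -> V := fun c => gact g (phi (g^-1%g ⋅ c)).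

Lemma transport1 : transport 1%g =1 id.
Proof. by move=> phi; apply/funext => c; rewrite /transport invg1 tr1 gact1. Qed.

Lemma transportM g h phi :
  transport (g * h)%g phi = transport g (transport h phi).
Proof. by apply/funext => c; rewrite /transport invgM trM gactM. Qed.

Lemma transportB g : {morph transport g : phi psi / phi - psi}.
Proof. by move=> phi psi; apply/funext => c; exact: gactB. Qed.

Lemma transport_invariant g phi :
  (forall c, phi (g ⋅ c) = gact g (phi c)) -> transport g phi = phi.
Proof.
by move=> phi_g; apply/funext => c; rewrite /transport -phi_g -trM mulgV tr1.
Qed.

Lemma bd_transport g phi c : bd (transport g phi) c = transport g (bd phi) c.
Proof. by rewrite /transport bd_translate (bd_morph (gactB g)). Qed.

End Transport.

Lemma transport_linear (G : groupType) (L : comNzRingType) (s : ring_action G L)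
    (V W : lmodType (crossed_product s)) (f : {linear V -> W}) g
    (phi : seq G -> V) c :
  f (transport g phi c) = transport g (f \o phi) c.
Proof. by rewrite /transport /gact linearZ. Qed.

Section Glue.
Context (G0 G1 G2 G : groupType).
Context (i1 : {multiplicative G0 -> G1}) (i2 : {multiplicative G0 -> G2}).
Context (j1 : {multiplicative G1 -> G}) (j2 : {multiplicative G2 -> G}).
Hypothesis amalgam : amalgamated_product i1 i2 j1 j2.
Context (L : comNzRingType) (s : ring_action G L).
Context (D : nat -> lmodType (crossed_product s)).
Context (dD : forall k, {linear D k.+1 -> D k}) (N : nat).
Context (V1 V2 E : forall k, seq G -> D k).
Hypotheses
  (V1_equiv : forall k g c, V1 k (j1 g ⋅ c) = gact (j1 g) (V1 k c))
  (V2_equiv : forall k g c, V2 k (j2 g ⋅ c) = gact (j2 g) (V2 k c))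
  (E_equiv : forall k g c, E k (j1 (i1 g) ⋅ c) = gact (j1 (i1 g)) (E k c))
  (E0 : forall c, E 0 c = 0)
  (dV1 : forall k c, (k < N)%N -> size c = k.+2 ->
    dD k (V1 k.+1 c) = bd (V1 k) c)
  (dE : forall k c, (k < N)%N -> size c = k.+1 ->
    dD k (E k.+1 c) + bd (E k) c = V1 k c - V2 k c).

(* p is the derivation sending g to the image under E of the path from v to gv
   in the Bass-Serre tree, v being the vertex G1. *)
Lemma glue_path : exists p : forall k, G -> seq G -> D k,
  [/\ forall c g, p 0 g c = 0,
      forall k g h, p k (g * h)%g = p k g + transport g (p k h) &
      forall k g c, (k < N)%N -> size c = k.+1 ->
        dD k (p k.+1 g c) + bd (p k g) c = transport g (V1 k) c - V1 k c].
Proof.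
have exp k : exists p : G -> seq G -> D k,
  [/\ forall g h, p (g * h)%g = p g + transport g (p h),
      forall g, p (j1 g) = 0 &
      forall g, p (j2 g) = transport (j2 g) (E k) - E k].
  apply: (amalgam_derivation amalgam (@transport1 _ _ _ _)
    (@transportM _ _ _ _) (@transportB _ _ _ _)) => g.
  exact: transport_invariant.
pose q k := projT1 (cid (exp k)); have qP k := projT2 (cid (exp k)).
(* In degree 0 the derivation is replaced by zero, which has the same properties because [E 0]
   vanishes. *)
pose p k := if k is k'.+1 then q k'.+1 else fun=> 0.
have pM k g h : p k (g * h)%g = p k g + transport g (p k h).
  case: k => [|k]; last by case: (qP k.+1) => + _ _; apply.
  by apply/funext => c; rewrite /= /transport [RHS]add0r (morphB0 (@gactB _ _ _ _ g)).
have p1 k g : p k (j1 g) = 0 by case: k => // k; case: (qP k.+1) => _ + _; apply.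
have p2 k g : p k (j2 g) = transport (j2 g) (E k) - E k.
  case: k => [|k]; last by case: (qP k.+1) => _ _; apply.
  apply/funext => c /=; rewrite [RHS](_ : _ = transport (j2 g) (E 0) c - E 0 c)//.
  by rewrite /transport !E0 (morphB0 (@gactB _ _ _ _ _)) subrr.
exists p; split=> // k g c kN; move: g c; apply: (amalgam_generated amalgam).
- move=> g c _; rewrite !p1 (transport_invariant (V1_equiv k g)) subrr.
  by rewrite bd0 addr0; exact: raddf0.
- move=> g c sc; rewrite !p2.
  rewrite [X in dD k X](_ : _ = transport (j2 g) (E k.+1) c - E k.+1 c)//.
  rewrite raddfB /= transport_linear bdB bd_transport addrACA -opprD dE//.
  have := dE kN (etrans (size_translate (j2 g)^-1%g c) sc).
  move=> /(congr1 (gact (j2 g))); rewrite (morphBD (@gactB _ _ _ _ _)).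
  rewrite [LHS](_ : _ = transport (j2 g) (dD k \o E k.+1) c +
    transport (j2 g) (bd (E k)) c)// => ->.
  rewrite gactB -[gact _ (V2 k _)]/(transport (j2 g) (V2 k) c).
  by rewrite (transport_invariant (V2_equiv k g)) opprB addrA subrK.
- move=> g h IHg IHh c sc; rewrite !pM.
  rewrite [X in dD k X](_ : _ = p k.+1 g c + transport g (p k.+1 h) c)//.
  rewrite raddfD /= transport_linear.
  rewrite (bdD (p k g) (transport g (p k h))) bd_transport addrACA IHg//.
  rewrite /transport -(morphBD (@gactB _ _ _ _ _)).
  rewrite IHh ?size_translate// gactB addrC.
  by rewrite -[gact g (V1 k _)]/(transport g (V1 k) c) addrA subrK -!/(transport _ _ _) transportM.
- move=> g IHg c sc.
  have pV m c' : p m g^-1%g c' = - transport g^-1%g (p m g) c'.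
    apply/eqP; rewrite -addr_eq0.
    rewrite -[X in X == _]/((p m g^-1%g + transport g^-1%g (p m g)) c').
    rewrite -pM mulVg -(multiplicative1 j1) p1.
    by [].
  rewrite pV raddfN /= transport_linear.
  rewrite (@eq_bd_size _ _ _ (fun c => - transport g^-1%g (p k g) c)) => [|c' _];
    last exact: pV.
  rewrite bdN bd_transport -opprD /transport -(morphBD (@gactB _ _ _ _ _)).
  rewrite IHg ?size_translate// gactB opprB.
  rewrite -[gact _ (transport _ _ _)]/(transport g^-1%g (transport g (V1 k)) c).
  by rewrite -transportM mulVg transport1.
Qed.

(** A tuple starting with x is mapped by the translate of V1 at the vertex xG1 of the tree. The face
    omitting x uses the translate at yG1 instead, y being the next entry; by [glue_path], the term
    [p y - p x] on the shortened tuple has exactly this discrepancy as its boundary defect. *)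
Lemma glue : exists Psi : forall k, seq G -> D k,
  [/\ forall k g c, Psi k (g ⋅ c) = gact g (Psi k c),
      forall k c, (k < N)%N -> size c = k.+2 ->
        dD k (Psi k.+1 c) = bd (Psi k) c &
      forall x, Psi 0 [:: x] = gact x (V1 0 [:: 1%g])].
Proof.
have [p [p0 pM dp]] := glue_path.
pose path k (x : G) (c : seq G) : D k :=
  if c is y :: _ then p k y c - p k x c else 0.
pose Psi k (c : seq G) : D k :=
  if c is x :: c' then transport x (V1 k) c + path k x c' else 0.
exists Psi; split=> [k g [|x c]|k [|x [|y c]] kN // [sc]|x].
- by rewrite /= (morphB0 (@gactB _ _ _ _ _)).
- rewrite [g ⋅ _]/= /Psi (morphBD (@gactB _ _ _ _ _)); congr (_ + _).
    rewrite -[_ :: _]/(g ⋅ (x :: c)) transportM.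
    by rewrite {1}/transport -trM mulVg tr1.
  case: c => [|y c]; first by rewrite /= (morphB0 (@gactB _ _ _ _ _)).
  rewrite [g ⋅ _]/= /path -[_ :: _]/(g ⋅ (y :: c)) !pM gactB.
  rewrite -[LHS]/(p k g _ + transport g (p k y) (g ⋅ (y :: c)) -
    (p k g _ + transport g (p k x) (g ⋅ (y :: c)))).
  rewrite [- (_ + _)]opprD addrACA subrr add0r.
  by rewrite /transport -!trM mulVg !tr1.
- have dPsi z : dD k (p k.+1 z (y :: c)) =
      transport z (V1 k) (y :: c) - V1 k (y :: c) - p k z c
      + bd (fun c' => p k z (y :: c')) c.
    by rewrite -(dp k z (y :: c) kN (congr1 S sc)) /=; zmod.
  (* For nonempty c the term at the head of c cancels. For empty c one has k = 0, where [p]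
     vanishes. *)
  have pathB : path k y c = path k x c + (p k x c - p k y c).
    have pnil m g : 0%N = m -> p m g [::] = 0 by move=> <-.
    by case: (c) sc => [|z c'] /= sck; rewrite ?pnil//; zmod.
  have dV1x : dD k (transport x (V1 k.+1) [:: x, y & c]) =
      bd (transport x (V1 k)) [:: x, y & c].
    by rewrite transport_linear bd_transport /transport /= dV1 ?size_translate//= size_translate sc.
  rewrite -[Psi k.+1 _]/(transport x (V1 k.+1) [:: x, y & c] +
    (p k.+1 y (y :: c) - p k.+1 x (y :: c))) [LHS]raddfD /= dV1x
    [dD k (_ - _)]raddfB /= !dPsi pathB.
  rewrite (bdD (fun c' => transport x (V1 k) [:: x, y & c'])
    (fun c' => p k y (y :: c') - p k x (y :: c'))).
  rewrite (bdB (fun c' => p k y (y :: c')) (fun c' => p k x (y :: c'))).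
  zmod.
- by rewrite /= addr0 /transport /= mulVg.
Qed.

End Glue.

(** * Embeddings in terms of bar chains *)

(** The coordinate at the empty tuple. Its boundary is the augmentation of the bar complex, equal to
    1 on single vertices. *)
Definition bar_unit (G : groupType) (L : comNzRingType) (s : ring_action G L)
  (c : seq G) : base_module s := if c is [::] then (1 : L) else 0.

Lemma bd_bar_unit (G : groupType) (L : comNzRingType) (s : ring_action G L) c :
  bd (bar_unit s) c = if c is [:: _] then (1 : L) else 0.
Proof.
case: c => [|x [|y c]] //=; first by rewrite subr0.
by rewrite (@eq_bd_size _ _ _ (fun=> 0)) ?bd0 ?subrr// => -[].
Qed.

Section FreeModules.
Context (A : nzRingType) (M V : lmodType A).

Lemma free_module_lift (P : M -> V -> Prop) : free_module M ->
  (forall x, exists v, P x v) -> P 0 0 ->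
  (forall a x y v w, P x v -> P y w -> P (a *: x + y) (a *: v + w)) ->
  exists h : {linear M -> V}, forall x, P x (h x).
Proof.
move=> [I [b b_basis]] Pex P0 PD.
have [v vP] := choice (fun i => Pex (b i)).
have [cf cfP] := choice b_basis.
pose h x : V := \sum_(i <- finsupp (cf x)) cf x i *: v i.
have widen (W : lmodType A) (w : I -> W) (c : {fsfun I -> A with 0}) (S : {fset I}) :
    fsubset (finsupp c) S ->
    \sum_(i <- finsupp c) c i *: w i = \sum_(i <- S) c i *: w i.
  move=> le; apply: big_fset_incl => // i _; rewrite memNfinsupp => /eqP ->.
  exact: scale0r.
have h_linear : linear h.
  move=> a x y; pose S := fsetU (finsupp (cf x)) (finsupp (cf y)).
  pose c : {fsfun I -> A with 0} := [fsfun i in S => a * cf x i + cf y i].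
  have cE i : c i = a * cf x i + cf y i.
    rewrite fsfun_fun; case: ifPn => //; rewrite inE negb_or !memNfinsupp.
    by move=> /andP[/eqP -> /eqP ->]; rewrite mulr0 addr0.
  have cS : fsubset (finsupp c) S.
    apply/fsubsetP => i; rewrite mem_finsupp fsfun_fun; case: ifPn => //.
    by rewrite eqxx.
  have sumc (W : lmodType A) (w : I -> W) : \sum_(i <- finsupp c) c i *: w i =
      a *: (\sum_(i <- finsupp (cf x)) cf x i *: w i)
      + \sum_(i <- finsupp (cf y)) cf y i *: w i.
    rewrite (widen _ w _ _ cS) (widen _ w _ S) ?fsubsetUl//.
    rewrite (widen _ w (cf y) S) ?fsubsetUr// scaler_sumr -big_split.
    by apply: eq_bigr => i _; rewrite cE scalerDl scalerA.
  have -> : h (a *: x + y) = \sum_(i <- finsupp c) c i *: v i.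
    rewrite /h; have [_ uniq_c] := cfP (a *: x + y).
    rewrite (uniq_c c)// sumc.
    by case: (cfP x) => <- _; case: (cfP y) => <- _.
  exact: sumc.
pose hl : {linear M -> V} := HB.pack h (GRing.isLinear.Build A M V *:%R h h_linear).
exists hl => x; rewrite /= /h; have [xE _] := cfP x; rewrite [X in P X _]xE.
elim: (enum_fset (finsupp (cf x))) => [|i r IHr]; first by rewrite !big_nil.
by rewrite !big_cons; exact: PD.
Qed.

End FreeModules.

Section BarResolution.
Context (L : comNzRingType) (G : groupType).
Notation tr := (trivial_action G L).

Section FromBar.
Variable C : resolution L G.

Lemma res_dd k x : res_d C k (res_d C k.+1 x) = 0.
Proof. by apply/res_exact; exists x. Qed.

Lemma res_augd x : res_aug C (res_d C 0 x) = 0.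
Proof. by apply/res_exact0; exists x. Qed.

Definition res_cycle k : C k -> Prop :=
  if k is k'.+1 then fun x => res_d C k' x = 0 else fun x => res_aug C x = 0.

Lemma res_cycleP k (x : C k) : res_cycle x -> exists y, res_d C k y = x.
Proof. by case: k x => [|k] x; [move/res_exact0|move/res_exact]. Qed.

(** The cycle condition travels with the map, because it is what makes the next step of the
    recursion solvable. *)
Let stage k := {phi : seq G -> C k |
  (forall g c, phi (g ⋅ c) = gact g (phi c)) /\ forall c, res_cycle (bd phi c)}.

Lemma bar_to_resolution_step k (phi : stage k) :
  exists psi : stage k.+1, forall c, res_d C k (sval psi c) = bd (sval phi) c.
Proof.
case: phi => phi [phi_equiv phi_cyc] /=.
have [Y dY] := choice (fun c => res_cycleP (phi_cyc c)).
(* Fillings are used only for tuples with first entry 1, which form a basis over the group ring, and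
   are then translated; this forces equivariance. *)
pose psi c := if c is x :: _ then gact x (Y (x^-1%g ⋅ c)) else 0.
have dpsi c : res_d C k (psi c) = bd phi c.
  case: c => [|x c]; first exact: raddf0.
  rewrite /psi /gact linearZZ dY bd_translate.
  rewrite (bd_morph (f := *:%R _)) => [|u v]; last exact: scalerBr.
  apply: eq_bd_size => c' _ /=.
  by rewrite -/(gact x _) -phi_equiv -trM mulgV tr1.
have psiP : (forall g c, psi (g ⋅ c) = gact g (psi c)) /\
    forall c, res_cycle (bd psi c).
  split=> [g [|x c]|c].
  - by rewrite /= (morphB0 (@gactB _ _ _ _ _)).
  - rewrite -[LHS]/(gact (g * x)%g (Y ((g * x)^-1%g ⋅ (g ⋅ (x :: c))))).
    by rewrite -trM invgM mulgVK gactM.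
  - rewrite /= (bd_morph (raddfB (res_d C k))) -[RHS](bd_bd phi c).
    by apply: eq_bd_size => c' _; exact: dpsi.
by exists (exist _ psi psiP).
Qed.

Lemma bar_to_resolution : exists b : forall k, seq G -> C k,
  [/\ forall k g c, b k (g ⋅ c) = gact g (b k c),
      forall k c, res_d C k (b k.+1 c) = bd (b k) c &
      forall x, res_aug C (b 0 [:: x]) = (1 : L)].
Proof.
have [e e1] := res_aug_surj C (1 : L).
pose b0 (c : seq G) : C 0 := if c is [:: x] then gact x e else 0.
have b0_aug x : res_aug C (b0 [:: x]) = (1 : L).
  by rewrite /= /gact linearZ /= e1 [LHS]cp_term_base mul1r.
have b0P : (forall g c, b0 (g ⋅ c) = gact g (b0 c)) /\ forall c, @res_cycle 0 (bd b0 c).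
  split=> [g [|x [|y c]]|c] /=; rewrite ?(morphB0 (@gactB _ _ _ _ _)) ?gactM//.
  rewrite (bd_morph (raddfB (res_aug C))).
  rewrite (@eq_bd_size _ _ _ (bd (bar_unit tr))) ?bd_bd// => c' _ /=.
  rewrite bd_bar_unit; case: c' => [|x [|y c']]; rewrite ?b0_aug//=; exact: raddf0.
pose next k (phi : stage k) := cid (bar_to_resolution_step phi).
pose b := nat_rect stage (exist _ b0 b0P) (fun k phi => projT1 (next k phi)).
exists (fun k => sval (b k)); split=> [k|k|//].
- by case: (b k) => phi [].
- exact: (projT2 (next k (b k))).
Qed.

End FromBar.

Variable C : free_resolution L G.

(** The converse comparison: now C is free and the bar complex is contractible, the filling of a
    cycle being [bar_cons 1]. *)
Lemma resolution_to_bar : exists f : forall k, {linear C k -> bar tr},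
  (forall k x, bar_d (f k.+1 x) = f k (res_d C k x)) /\
  forall x, bar_d (f 0 x) = bar_term tr [::] (res_aug C x).
Proof.
have lift k (q : {linear C k -> bar tr}) : (forall x, bar_d (q x) = 0) ->
    exists f : {linear C k -> bar tr}, forall x, bar_d (f x) = q x.
  move=> dq.
  apply: (free_module_lift (P := fun x v => bar_d v = q x) (fres_free C k)).
  - by move=> x; exists (bar_cons 1%g (q x)); rewrite bar_d_cons dq raddf0 subr0.
  - by rewrite !raddf0.
  - by move=> a x y v w vx wy; rewrite !linearP /= vx wy.
pose stage k := {f : {linear C k -> bar tr} |
  forall x, bar_d (f (res_d C k x)) = 0}.
have step k (f : stage k) : exists f' : stage k.+1,
    forall x, bar_d (sval f' x) = sval f (res_d C k x).
  case: f => f df /=.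
  have [|f' df'] := lift k.+1 (f \o res_d C k); first exact: df.
  have f'P x : bar_d (f' (res_d C k.+1 x)) = 0 by rewrite df' /= res_dd raddf0.
  by exists (exist _ f' f'P).
have aug_linear : linear (fun x => bar_term tr [::] (res_aug C x)).
  move=> a x y; rewrite linearP /=.
  have UD := morphBD (@bar_termB _ _ tr [::]); rewrite UD; congr (_ + _).
  elim/cp_ind: a => [|a a' IHa IHa'|g z].
  - by rewrite !scale0r (morphB0 (@bar_termB _ _ tr [::])).
  - by rewrite !scalerDl UD IHa IHa'.
  - by rewrite [RHS]bar_scaleE cp_term_base.
pose q0 : {linear C 0 -> bar tr} := HB.pack
  (fun x => bar_term tr [::] (res_aug C x))
  (GRing.isLinear.Build _ _ _ *:%R _ aug_linear).
have [|f0 df0] := lift 0 q0; first by move=> x; rewrite bar_dU.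
have f0P x : bar_d (f0 (res_d C 0 x)) = 0.
  by rewrite df0 /= res_augd (morphB0 (@bar_termB _ _ tr [::])).
pose next k (f : stage k) := cid (step k f).
pose f := nat_rect stage (exist _ f0 f0P) (fun k f => projT1 (next k f)).
exists (fun k => sval (f k)); split=> [k x|//].
exact: (projT2 (next k (f k))).
Qed.

End BarResolution.

Section Constants.
Context d (X : measurableType d) (R : realType) (mu : probability X R).
Context (Z : normed_ring R).

Lemma linf_pred_const (z : Z) : (fun=> z) \in linf_pred mu Z.
Proof.
apply/linf_predP; split=> [B|]; last by exists (nr_norm z); exact: aeW.
by rewrite preimage_cst; case: ifP.
Qed.

Lemma linf_constB : {morph @linf_const _ _ _ mu Z : y z / y - z}.
Proof. by move=> y z; rewrite -linf_classB ?linf_pred_const. Qed.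

HB.instance Definition _ :=
  GRing.isZmodMorphism.Build Z (Linf mu Z) (@linf_const _ _ _ mu Z) linf_constB.

Lemma linf_constM : {morph @linf_const _ _ _ mu Z : y z / y * z}.
Proof. by move=> y z; rewrite -linf_classM ?linf_pred_const. Qed.

Lemma linf_const1 : linf_const mu (1 : Z) = 1.
Proof. exact: linf_class1. Qed.

Lemma linf_translate_const (G : groupType) (a : pmp_action mu G) g (z : Z) :
  linf_action a Z g (linf_const mu z) = linf_const mu z.
Proof. by rewrite /= linf_translate_class ?linf_pred_const. Qed.

End Constants.

Section BarMaps.
Context d (X : measurableType d) (R : realType) (mu : probability X R).
Context (G : groupType) (a : pmp_action mu G) (Z : normed_ring R).
Implicit Types (D : marked_complex a Z).

(** Embeddings in a form that does not mention C: equivariant functions on tuples that are a chain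
    map up to degree N. As they vanish off the length k + 1, the boundary identities hold for tuples
    of all lengths. *)
Definition bar_map D (N : nat) (phi : forall k, seq G -> D k) : Prop :=
  [/\ forall k c, size c != k.+1 -> phi k c = 0,
      forall k g c, phi k (g ⋅ c) = gact g (phi k c),
      forall k c, (k < N)%N -> mc_d D k (phi k.+1 c) = bd (phi k) c &
      forall x, mc_aug D (phi 0 [:: x]) = (1 : Linf mu Z)].

Lemma bar_map_truncate D N (phi : forall k, seq G -> D k) :
  (forall k g c, phi k (g ⋅ c) = gact g (phi k c)) ->
  (forall k c, (k < N)%N -> size c = k.+2 ->
     mc_d D k (phi k.+1 c) = bd (phi k) c) ->
  (forall x, mc_aug D (phi 0 [:: x]) = (1 : Linf mu Z)) ->
  bar_map N (fun k c => if size c == k.+1 then phi k c else 0).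
Proof.
move=> phi_equiv dphi phi_aug; split=> [k c /negbTE -> //|k g c|k c kN|//].
  rewrite size_translate; case: ifP => _; first exact: phi_equiv.
  by rewrite (morphB0 (@gactB _ _ _ _ _)).
case: ifP => [/eqP sc|sc].
  rewrite dphi//; apply: eq_bd_size => c' sc'.
  by move: sc'; rewrite sc => -[->]; rewrite eqxx.
rewrite raddf0 -[LHS](bd0 (D k : zmodType) c); apply: eq_bd_size => c' sc'.
by case: ifP => // /eqP sc''; rewrite -sc' sc'' eqxx in sc.
Qed.

Lemma bar_map_aug D N phi : @bar_map D N phi ->
  mc_aug D \o phi 0 =1 bd (bar_unit (linf_action a Z)).
Proof.
move=> [phi0 _ _ phi_aug] c; rewrite bd_bar_unit /=.
by case: c => [|x [|y c]]; rewrite ?phi_aug// phi0// raddf0.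
Qed.

Lemma group_ring_inclB : {morph group_ring_incl a (Z := Z) : r r' / r - r'}.
Proof.
have termB g : {morph (fun z => cp_term (linf_action a Z) g (linf_const mu z)) :
    y z / y - z} by move=> y z; rewrite raddfB /= cp_termB.
move=> r r'; have := malg_liftB termB r r'; exact.
Qed.

Lemma group_ring_incl_term g z : group_ring_incl a (Z := Z) (cp_term _ g z) =
  cp_term _ g (linf_const mu z).
Proof.
rewrite -[LHS]/(malg_lift (fun g z => cp_term _ g (linf_const mu z)) _).
by rewrite [LHS]malg_liftU// => h y y'; rewrite raddfB /= cp_termB.
Qed.

Lemma embeds_bar_map (C : free_resolution Z G) n D : embeds C n D ->
  exists phi, @bar_map D n.+1 phi.
Proof.
move=> [f [f_lin f_aug f_d]].
have [b [b_equiv b_d b_aug]] := bar_to_resolution C.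
have fB k : (k <= n.+1)%N -> {morph f k : x y / x - y}.
  move=> kn x y; have := f_lin k kn (- 1) y x.
  rewrite /= (morphBN group_ring_inclB) -cp_term1 group_ring_incl_term.
  by rewrite linf_const1 cp_term1 !scaleN1r ![- _ + _]addrC.
have f_gact k g x : (k <= n.+1)%N -> f k (gact g x) = gact g (f k x).
  move=> kn; have := f_lin k kn (cp_term _ g 1) x 0.
  by rewrite addr0 (morphB0 (fB k kn)) addr0 /= group_ring_incl_term linf_const1.
(* Above degree n + 1 the maps [f k] are unconstrained, whereas [bar_map] asks for equivariance in
   all degrees; hence the cut-off. *)
pose phi k c := if (k <= n.+1)%N then f k (b k c) else 0.
exists (fun k c => if size c == k.+1 then phi k c else 0).
apply: bar_map_truncate => [k g c|k c kn _|x].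
- rewrite /phi; case: ifP => [kn|_]; first by rewrite b_equiv f_gact.
  by rewrite (morphB0 (@gactB _ _ _ _ _)).
- rewrite /phi kn (ltnW kn) f_d// b_d.
  exact: (bd_morph (fB k (ltnW kn))).
- by rewrite /phi /= f_aug b_aug linf_const1.
Qed.

(** The inclusion of constants is compatible with the actions since translation fixes constant
    functions; the chain map is then C -> bar -> D. *)
Lemma bar_map_embeds (C : free_resolution Z G) n D phi :
  @bar_map D n.+1 phi -> embeds C n D.
Proof.
move=> phiP; have [phi0 phi_equiv dphi phi_aug] := phiP.
have [c [dc c_aug]] := resolution_to_bar C.
pose kappa : {additive Z -> Linf mu Z} := @linf_const _ _ _ mu Z.
exists (fun k x => bar_eval (trivial_action G Z) kappa (phi k) (c k x)).
split=> [k _ r x y|x|k kn x].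
- rewrite linearP raddfD /=; congr (_ + _).
  elim/cp_ind: r => [|r r' IHr IHr'|g z].
  + by rewrite (morphB0 group_ring_inclB) !scale0r raddf0.
  + by rewrite (morphBD group_ring_inclB) !scalerDl raddfD /= IHr IHr'.
  + rewrite group_ring_incl_term.
    apply: bar_eval_act => [c'|y']; first exact: phi_equiv.
    rewrite -[kappa y']/(linf_const mu y') linf_translate_const.
    exact: linf_constM.
- rewrite bar_eval_comp (eq_bar_eval _ _ (bar_map_aug phiP)) -bar_eval_d c_aug.
  by rewrite bar_evalU [LHS]cp_term_base ract1 mulr1.
- rewrite bar_eval_comp -dc bar_eval_d; apply: eq_bar_eval => c'.
  exact: dphi.
Qed.

End BarMaps.

(** * Marked modules *)

Section Indicators.
Context d (X : measurableType d) (R : realType) (mu : probability X R).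
Context (Z : normed_ring R).
Implicit Types (A B : set X).
Notation "1_ A" := (linf_indic mu Z A) (at level 10).

Definition set_ind A (x : X) : Z := if x \in A then 1 else 0.

Lemma linf_pred_indic A : measurable A -> set_ind A \in linf_pred mu Z.
Proof.
have mP (P : Prop) : measurable [set _ : X | P].
  have [p|p] := pselect P.
    by have -> : [set _ : X | P] = setT by apply/seteqP; split.
  by have -> : [set _ : X | P] = set0 by apply/seteqP; split.
move=> mA; apply/linf_predP; split=> [B|].
  rewrite (_ : _ @^-1` B = (A `&` [set _ | B 1]) `|` (~` A `&` [set _ | B 0])).
    by apply: measurableU; apply: measurableI => //; exact: measurableC.
  apply/seteqP; split=> x; rewrite /set_ind /=.
    by case: ifPn => [/set_mem xA|/negP xA] Bx; [left|right; split => // /mem_set].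
  by case=> -[xA Bx]; [rewrite mem_set|rewrite memNset].
exists (nr_norm (1 : Z) + nr_norm (0 : Z)); apply: aeW => x; rewrite /set_ind.
by case: ifP => _; rewrite ?lerDl ?lerDr nr_norm_ge0.
Qed.

Lemma indicM A B : measurable A -> measurable B -> 1_ A * 1_ B = 1_ (A `&` B).
Proof.
move=> mA mB; rewrite -linf_classM ?linf_pred_indic//.
congr linf_class; apply/funext => x; rewrite in_setI.
by case: (x \in A); case: (x \in B); rewrite ?mulr1 ?mulr0.
Qed.

Lemma indicT : 1_ [set: X] = 1.
Proof.
rewrite -linf_class1; congr linf_class; apply/funext => x.
by rewrite mem_set.
Qed.

Lemma indic0 : 1_ (set0 : set X) = 0.
Proof.
rewrite -[RHS](raddf0 (linf_const mu)); congr linf_class.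
by apply/funext => x; rewrite memNset.
Qed.

Lemma indic_idem A : measurable A -> 1_ A * 1_ A = 1_ A.
Proof. by move=> mA; rewrite indicM// setIid. Qed.

Lemma indicC A : measurable A -> 1_ (~` A) = 1 - 1_ A.
Proof.
move=> mA; rewrite -linf_class1 -linf_classB ?linf_pred_const ?linf_pred_indic//.
congr linf_class; apply/funext => x; rewrite in_setC.
by case: (x \in A); rewrite /= ?subrr ?subr0.
Qed.

Lemma indic_eq A B : measurable A -> measurable B ->
  (\forall x \ae mu, A x <-> B x) -> 1_ A = 1_ B.
Proof.
move=> mA mB AB; apply/linf_class_eqP; rewrite ?linf_pred_indic//.
apply: filterS AB => x AB; congr (if _ then _ else _).
by apply/idP/idP => /set_mem xAB; rewrite mem_set//; apply/AB.
Qed.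

Lemma indic_translate (G : groupType) (a : pmp_action mu G) g A : measurable A ->
  linf_action a Z g (1_ A) = 1_ (a g^-1%g @^-1` A).
Proof.
by move=> mA; rewrite /= linf_translate_class ?linf_pred_indic.
Qed.

End Indicators.

Section Induction.
Context (H G : groupType) (j : {multiplicative H -> G}) (L : comNzRingType).
Context (sH : ring_action H L) (s : ring_action G L).
Hypothesis compat : forall h x, sH h x = s (j h) x.

Definition cp_map : crossed_product sH -> crossed_product s :=
  malg_lift (fun h x => cp_term s (j h) x).

Lemma cp_mapB : {morph cp_map : r r' / r - r'}.
Proof. exact: malg_liftB (fun h => @cp_termB _ _ s (j h)). Qed.

Lemma cp_map_term h x : cp_map (cp_term sH h x) = cp_term s (j h) x.
Proof. exact: malg_liftU (fun h => @cp_termB _ _ s (j h)) _ _. Qed.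

Lemma cp_mapM : {morph cp_map : r r' / r * r'}.
Proof.
move=> r r'; elim/cp_ind: r => [|r1 r2 IH1 IH2|h x].
- by rewrite mul0r !(morphB0 cp_mapB) mul0r.
- by rewrite mulrDl !(morphBD cp_mapB) mulrDl IH1 IH2.
elim/cp_ind: r' => [|r1 r2 IH1 IH2|h' x'].
- by rewrite mulr0 !(morphB0 cp_mapB) mulr0.
- by rewrite mulrDr !(morphBD cp_mapB) mulrDr IH1 IH2.
by rewrite cp_termM !cp_map_term cp_termM gmulfM compat.
Qed.

End Induction.

Section Restriction.
Context d (X : measurableType d) (R : realType) (mu : probability X R).
Context (H G : groupType) (j : {multiplicative H -> G}) (a : pmp_action mu G).
Context (Z : normed_ring R).

Lemma restrict_compat h x :
  linf_action (restrict_action j a) Z h x = linf_action a Z (j h) x.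
Proof. by rewrite /= /linf_translate /= multiplicativeV. Qed.

End Restriction.

Section Marked.
Context d (X : measurableType d) (R : realType) (mu : probability X R).
Context (G : groupType) (a : pmp_action mu G) (Z : normed_ring R).
Notation LZ := (linf_action a Z).
Notation RZ := (crossed_product LZ).

Definition idem (A : set X) : RZ := cp_term LZ 1%g (linf_indic mu Z A).

Lemma idem_idem A : measurable A -> idem A * idem A = idem A.
Proof. by move=> mA; rewrite cp_termM mulg1 ract1 indic_idem. Qed.

Lemma ideal_ofP A (r : RZ) : measurable A ->
  ideal_of (a := a) (Z := Z) A r <-> r * idem A = r.
Proof.
move=> mA; split=> [[r' _ <-]|rA]; last by exists r.
by rewrite -mulrA idem_idem.
Qed.

Lemma ideal_of_idem A (r : RZ) : ideal_of (a := a) (Z := Z) A (r * idem A).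
Proof. by exists r. Qed.

Lemma ideal_of0 A : ideal_of (a := a) (Z := Z) A (0 : RZ).
Proof. by exists 0; [exact: I|exact: mul0r]. Qed.

Lemma ideal_ofD A (r r' : RZ) :
  ideal_of (a := a) (Z := Z) A r -> ideal_of (a := a) (Z := Z) A r' ->
  ideal_of (a := a) (Z := Z) A (r + r').
Proof. by move=> [q _ <-] [q' _ <-]; exists (q + q'); [exact: I|exact: mulrDl]. Qed.

Lemma ideal_ofZ A (q r : RZ) :
  ideal_of (a := a) (Z := Z) A r -> ideal_of (a := a) (Z := Z) A (q * r).
Proof. by move=> [r' _ <-]; exists (q * r'); [exact: I|exact/esym/mulrA]. Qed.

Section Generators.
Variable M : marked_module a Z.

Lemma mm_coordP (x : M) i : ideal_of (a := a) (Z := Z) (mm_set i) (mm_iso M x i).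
Proof.
have : range (mm_iso M) (mm_iso M x) by exists x.
by rewrite mm_iso_range; apply.
Qed.

Lemma mm_coord_idem (x : M) i :
  mm_iso M x i * idem (mm_set i) = mm_iso M x i.
Proof. by apply/ideal_ofP; [exact: mm_measurable|exact: mm_coordP]. Qed.

Lemma mgen_subproof (i : mm_idx M) : exists e : M,
  mm_iso M e = [ffun k => if k == i then idem (mm_set i) else 0].
Proof.
suff : range (mm_iso M) [ffun k => if k == i then idem (mm_set i) else 0].
  by move=> [e _ <-]; exists e.
rewrite mm_iso_range => k /=; rewrite ffunE; case: eqP => [->|_].
  by rewrite -[idem _]mul1r; exact: ideal_of_idem.
exact: ideal_of0.
Qed.

Definition mgen i : M := projT1 (cid (mgen_subproof i)).

Lemma mm_iso_mgen i k :
  mm_iso M (mgen i) k = if k == i then idem (mm_set i) else 0.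
Proof. by rewrite /mgen; case: cid => e /= ->; rewrite ffunE. Qed.

Lemma mgen_sum (x : M) : x = \sum_i (mm_iso M x i : RZ) *: mgen i.
Proof.
apply: (@mm_iso_inj _ _ _ _ _ _ _ M); rewrite raddf_sum; apply/ffunP => k.
rewrite sum_ffunE (bigD1 k)//= big1 ?addr0 => [|i ik].
  by rewrite linearZ /= ffunE mm_iso_mgen eqxx; apply/esym/mm_coord_idem.
by rewrite linearZ /= ffunE mm_iso_mgen eq_sym (negbTE ik) scaler0.
Qed.

Lemma idem_mgen i : idem (mm_set i) *: mgen i = mgen i.
Proof.
apply: (@mm_iso_inj _ _ _ _ _ _ _ M); rewrite linearZ /=; apply/ffunP => k.
rewrite ffunE mm_iso_mgen; case: eqP => _; last exact: scaler0.
by apply: idem_idem; exact: mm_measurable.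
Qed.

End Generators.

Section Standard.
Variables (I : finType) (A : I -> set X).

Definition std_pred : {pred {ffun I -> RZ^o}} :=
  fun z => `[< forall i, ideal_of (a := a) (Z := Z) (A i) (z i) >].

Lemma std_predP (z : {ffun I -> RZ^o}) :
  reflect (forall i, ideal_of (a := a) (Z := Z) (A i) (z i)) (z \in std_pred).
Proof. exact: asboolP. Qed.

Lemma std_submod : submod_closed std_pred.
Proof.
split=> [|r x y /std_predP xP /std_predP yP]; apply/std_predP => i; rewrite !ffunE.
  exact: ideal_of0.
by apply: ideal_ofD => //; exact: ideal_ofZ.
Qed.

HB.instance Definition _ :=
  GRing.isSubmodClosed.Build RZ {ffun I -> RZ^o} std_pred std_submod.

Record std := Std { std_val : {ffun I -> RZ^o}; std_valP : std_val \in std_pred }.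

HB.instance Definition _ := [isSub for std_val].
HB.instance Definition _ := [Choice of std by <:].
HB.instance Definition _ := [SubChoice_isSubLmodule of std by <:].

Lemma std_val_linear : linear std_val.
Proof. by move=> r x y; rewrite -[std_val]/(val : std -> _) linearP. Qed.

HB.instance Definition _ :=
  GRing.isLinear.Build RZ std {ffun I -> RZ^o} *:%R std_val std_val_linear.

Lemma std_range :
  range std_val = [set z | forall i, ideal_of (a := a) (Z := Z) (A i) (z i)].
Proof.
apply/seteqP; split=> [_ [x _ <-]|z zP] /=; first exact/std_predP/std_valP.
by have /std_predP zA := zP; exists (Std zA).
Qed.

Definition std_marked (mA : forall i, measurable (A i)) : marked_module a Z :=
  @MarkedModule _ _ _ _ _ a Z std I A mA std_val val_inj std_range.

End Standard.

Section Extension.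
Variables (M : marked_module a Z) (V : lmodType RZ) (v : mm_idx M -> V).

(** The values [v i] may be arbitrary: coordinates in <A_i> absorb the idempotent, so the generator
    goes to the part of [v i] cut out by A_i. *)
Definition mext (x : M) : V := \sum_i (mm_iso M x i : RZ) *: v i.

Lemma mext_linear : linear mext.
Proof.
move=> r x y; rewrite /mext scaler_sumr -big_split; apply: eq_bigr => i _ /=.
by rewrite linearP !ffunE scalerDl scalerA.
Qed.

HB.instance Definition _ := GRing.isLinear.Build RZ M V *:%R mext mext_linear.

Lemma mext_mgen i : mext (mgen i) = idem (mm_set i) *: v i.
Proof.
rewrite /mext (bigD1 i)//= big1 ?addr0 => [|k /negbTE ki].
  by rewrite mm_iso_mgen eqxx.
by rewrite mm_iso_mgen ki scale0r.
Qed.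

End Extension.

Lemma eq_mgen (M : marked_module a Z) (V : lmodType RZ) (f g : {linear M -> V}) :
  (forall i, f (mgen i) = g (mgen i)) -> f =1 g.
Proof.
move=> fg x; rewrite (mgen_sum x) !raddf_sum; apply: eq_bigr => i _ /=.
by rewrite !linearZZ fg.
Qed.

End Marked.

Section Induced.
Context d (X : measurableType d) (R : realType) (mu : probability X R).
Context (H G : groupType) (j : {multiplicative H -> G}) (a : pmp_action mu G).
Context (Z : normed_ring R).
Notation LH := (linf_action (restrict_action j a) Z).
Notation LG := (linf_action a Z).
Notation pushf := (@cp_map H G j _ LH LG).

(** Maps out of M along the inclusion of crossed products, that is, linear maps out of the induced
    module without constructing it. *)
Definition semilinear (M : lmodType (crossed_product LH))
    (V : lmodType (crossed_product LG)) (f : M -> V) : Prop :=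
  {morph f : x y / x - y} /\ forall r x, f (r *: x) = pushf r *: f x.

Lemma semilinear_gact (M : lmodType (crossed_product LH))
    (V : lmodType (crossed_product LG)) (f : M -> V) g x :
  semilinear f -> f (gact g x) = gact (j g) (f x).
Proof. by move=> [_ fZ]; rewrite /gact fZ cp_map_term. Qed.

Lemma semilinear_sum (M : lmodType (crossed_product LH))
    (V : lmodType (crossed_product LG)) (f : M -> V) :
  semilinear f -> forall (K : Type) (r : seq K) (F : K -> M),
  f (\sum_(k <- r) F k) = \sum_(k <- r) f (F k).
Proof.
move=> [fB _] K r F.
by apply: (big_morph f); [exact: morphBD|exact: morphB0].
Qed.

Lemma cp_map_idem A : pushf (idem (restrict_action j a) Z A) = idem a Z A.
Proof. by rewrite cp_map_term multiplicative1. Qed.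

Section SemilinearExtension.
Variables (M : marked_module (restrict_action j a) Z).
Variables (V : lmodType (crossed_product LG)).

Definition sext (v : mm_idx M -> V) (x : M) : V :=
  \sum_i pushf (mm_iso M x i) *: v i.

Lemma sext_semilinear v : semilinear (sext v).
Proof.
split=> [x y|r x]; rewrite /sext.
  rewrite -sumrB; apply: eq_bigr => i _.
  by rewrite raddfB /= !ffunE cp_mapB scalerBl.
rewrite scaler_sumr; apply: eq_bigr => i _.
by rewrite linearZ /= ffunE (cp_mapM (@restrict_compat _ _ _ _ _ _ j a Z)) scalerA.
Qed.

Lemma sext_mgen v i : sext v (mgen i) = idem a Z (mm_set i) *: v i.
Proof.
rewrite /sext (bigD1 i)//= big1 ?addr0 => [|k /negbTE ki].
  by rewrite mm_iso_mgen eqxx cp_map_idem.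
by rewrite mm_iso_mgen ki (morphB0 (@cp_mapB _ _ _ _ _ _)) scale0r.
Qed.

Lemma eq_semilinear (f f' : M -> V) : semilinear f -> semilinear f' ->
  (forall i, f (mgen i) = f' (mgen i)) -> f =1 f'.
Proof.
move=> f_semi f'_semi ff' x; rewrite [x]mgen_sum !semilinear_sum//.
by apply: eq_bigr => i _; case: f_semi f'_semi => [_ ->] [_ ->]; rewrite ff'.
Qed.

Lemma idem_semilinear (f : M -> V) i : semilinear f ->
  idem a Z (mm_set i) *: f (mgen i) = f (mgen i).
Proof. by move=> [_ fZ]; rewrite -cp_map_idem -fZ idem_mgen. Qed.

End SemilinearExtension.

Lemma semilinear_comp (M M' : lmodType (crossed_product LH))
    (V : lmodType (crossed_product LG)) (f : M' -> V) (g : {linear M -> M'}) :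
  semilinear f -> semilinear (f \o g).
Proof. by move=> [fB fZ]; split=> [x y|r x] /=; rewrite ?raddfB ?fB// linearZ fZ. Qed.

Lemma linear_semilinear (M : lmodType (crossed_product LH))
    (V W : lmodType (crossed_product LG)) (f : M -> V) (g : {linear V -> W}) :
  semilinear f -> semilinear (g \o f).
Proof. by move=> [fB fZ]; split=> [x y|r x] /=; rewrite ?fB ?raddfB// fZ linearZ. Qed.

Lemma semilinearB (M : lmodType (crossed_product LH))
    (V : lmodType (crossed_product LG)) (f g : M -> V) :
  semilinear f -> semilinear g -> semilinear (fun x => f x - g x).
Proof.
move=> [fB fZ] [gB gZ]; split=> [x y|r x]; first by rewrite fB gB; zmod.
by rewrite fZ gZ scalerBr.
Qed.

Lemma semilinear0 (M : lmodType (crossed_product LH))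
    (V : lmodType (crossed_product LG)) : semilinear (fun _ : M => 0 : V).
Proof. by split=> [x y|r x]; rewrite ?subr0// scaler0. Qed.

Variables (M : marked_module (restrict_action j a) Z) (N : marked_module a Z).
Variables (u : mm_idx M -> mm_idx N).

(** When [u] is injective and preserves the marking sets, the summand of N that it selects is the
    module induced from M, and this is the canonical map to it. *)
Definition induce : M -> N := sext (mgen (M := N) \o u).

Lemma induce_semilinear : semilinear induce.
Proof. exact: sext_semilinear. Qed.

Hypothesis uE : forall i, mm_set (u i) = mm_set i.

Lemma induce_mgen i : induce (mgen i) = mgen (u i).
Proof. by rewrite /induce sext_mgen -uE /= idem_mgen. Qed.

Lemma mext_induce (V : lmodType (crossed_product LG)) (f : M -> V)
    (v : mm_idx N -> V) : semilinear f ->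
  (forall i, v (u i) = f (mgen i)) -> forall x, mext v (induce x) = f x.
Proof.
move=> f_semi vf; apply: eq_semilinear => // [|i].
  exact: (linear_semilinear (mext v) induce_semilinear).
by rewrite induce_mgen mext_mgen uE vf idem_semilinear.
Qed.

End Induced.

(** * The mapping cone of an amalgam *)

Section LiftToBar.
Context d (X : measurableType d) (R : realType) (mu : probability X R).
Context (H G : groupType) (j : {multiplicative H -> G}) (a : pmp_action mu G).
Context (Z : normed_ring R).
Notation aH := (restrict_action j a).
Notation LG := (linf_action a Z).

(* A chain map, over the identity of the coefficients, to the L^oo-linear bar
   resolution of G. *)
Definition bar_lift (D : marked_complex aH Z) (psi : forall k, D k -> bar LG) :
  Prop :=
  [/\ forall k, semilinear (V := bar LG) (psi k),
      forall k x, bar_d (psi k.+1 x) = psi k (mc_d D k x) &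
      forall x, bar_d (psi 0 x) = bar_term LG [::] (mc_aug D x)].

(** A marked module behaves as a projective one: the cycles [q (mgen i)] are filled by the
    contraction, and the idempotent that cuts off the filling fixes [q (mgen i)]. *)
Lemma semilinear_lift (M : marked_module aH Z) (q : M -> bar LG) :
  semilinear q -> (forall x, bar_d (q x) = 0) ->
  exists psi : M -> bar LG, semilinear psi /\ forall x, bar_d (psi x) = q x.
Proof.
move=> q_semi dq; pose v i := bar_cons 1%g (q (mgen i)).
exists (sext v); split; first exact: sext_semilinear.
pose d' : {linear bar LG -> bar LG} := @bar_d _ _ LG.
have dv_semi : semilinear (d' \o sext v).
  exact: (linear_semilinear d' (sext_semilinear v)).
apply: (eq_semilinear dv_semi q_semi) => i.
rewrite /= sext_mgen linearZZ /= bar_d_cons dq raddf0 subr0.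
exact: idem_semilinear.
Qed.

(** L^oo is the same abelian group over both crossed products; only the acting ring changes, so one
    augmentation can serve both. *)
Lemma base_semilinear r (x : Linf mu Z) :
  r *: (x : base_module (linf_action aH Z)) =
  @cp_map _ _ j _ _ LG r *: (x : base_module LG) :> Linf mu Z.
Proof.
elim/cp_ind: r => [|r r' IHr IHr'|h y].
- by rewrite (morphB0 (@cp_mapB _ _ _ _ _ _)) !scale0r.
- by rewrite (morphBD (@cp_mapB _ _ _ _ _ _)) !scalerDl IHr IHr'.
- by rewrite cp_map_term !cp_term_base restrict_compat.
Qed.

Lemma bar_aug_semilinear (D : marked_complex aH Z) :
  semilinear (V := bar LG) (fun x : D 0%N => bar_term LG [::] (mc_aug D x)).
Proof.
split=> [x y|r x]; first by rewrite raddfB /= bar_termB.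
rewrite linearZZ base_semilinear; move: (mc_aug D x : Linf mu Z) => {}x.
elim/cp_ind: (@cp_map _ _ _ _ _ _ r) => [|r1 r2 IH1 IH2|g y].
- by rewrite !scale0r (morphB0 (@bar_termB _ _ LG [::])).
- by rewrite !scalerDl (morphBD (@bar_termB _ _ LG [::])) IH1 IH2.
- by rewrite cp_term_base bar_scaleE.
Qed.

Lemma exists_bar_lift (D : marked_complex aH Z) : exists psi, @bar_lift D psi.
Proof.
pose stage k := {psi : D k -> bar LG |
  semilinear psi /\ forall x, bar_d (psi (mc_d D k x)) = 0}.
have step k (psi : stage k) : exists psi' : stage k.+1,
    forall x, bar_d (sval psi' x) = sval psi (mc_d D k x).
  case: psi => psi [psi_semi dpsi] /=.
  have [|psi' [psi'_semi dpsi']] :=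
    semilinear_lift (semilinear_comp (mc_d D k) psi_semi); first exact: dpsi.
  have psi'P : semilinear psi' /\ forall x, bar_d (psi' (mc_d D k.+1 x)) = 0.
    by split=> // x; rewrite dpsi' /= mc_dd; case: psi_semi => /morphB0.
  by exists (exist _ psi' psi'P).
have [|psi0 [psi0_semi dpsi0]] := semilinear_lift (bar_aug_semilinear D).
  by move=> x; rewrite bar_dU.
have psi0P : semilinear psi0 /\ forall x, bar_d (psi0 (mc_d D 0 x)) = 0.
  split=> // x; rewrite dpsi0 /= mc_augd; exact: morphB0 (@bar_termB _ _ LG [::]).
pose next k (psi : stage k) := cid (step k psi).
pose psi := nat_rect stage (exist _ psi0 psi0P) (fun k p => projT1 (next k p)).
exists (fun k => sval (psi k)); split=> [k|k x|//].
- by case: (psi k) => p [].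
- exact: (projT2 (next k (psi k))).
Qed.

End LiftToBar.

Section Cone.
Context d (X : measurableType d) (R : realType) (mu : probability X R).
Context (G0 G1 G2 G : groupType).
Context (i1 : {multiplicative G0 -> G1}) (i2 : {multiplicative G0 -> G2}).
Context (j1 : {multiplicative G1 -> G}) (j2 : {multiplicative G2 -> G}).
Hypothesis amalgam : amalgamated_product i1 i2 j1 j2.
Context (alpha : pmp_action mu G) (Z : normed_ring R).
Notation alpha0 := (restrict_action (j1 \o i1) alpha).
Notation alpha1 := (restrict_action j1 alpha).
Notation alpha2 := (restrict_action j2 alpha).
Notation LG := (linf_action alpha Z).
Notation RG := (crossed_product LG).

Context (n : nat).
Context (D1 : marked_complex alpha1 Z) (phi1 : forall k, seq G1 -> D1 k).
Context (D2 : marked_complex alpha2 Z) (phi2 : forall k, seq G2 -> D2 k).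
Context (D0 : marked_complex alpha0 Z) (phi0 : forall k, seq G0 -> D0 k).
Context (psi : forall k, D0 k -> bar LG).
Hypotheses (phi1P : bar_map n.+1 phi1) (phi2P : bar_map n.+1 phi2)
  (phi0P : bar_map n phi0) (psiP : bar_lift psi).
Context (r0 : G -> G0) (r1 : G -> G1) (r2 : G -> G2).
Hypotheses (r0M : forall h x, r0 ((j1 \o i1) h * x)%g = (h * r0 x)%g)
  (r1M : forall h x, r1 (j1 h * x)%g = (h * r1 x)%g)
  (r2M : forall h x, r2 (j2 h * x)%g = (h * r2 x)%g).

Lemma void_measurable (i : void) : measurable (set0 : set X).
Proof. by case: i. Qed.

(** The shift D0[1]; in degree 0 it is the zero module, marked by an empty family. *)
Definition shifted (k : nat) : marked_module alpha0 Z :=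
  if k is k'.+1 then D0 k' else std_marked alpha0 Z void_measurable.

Definition cone_idx k : finType :=
  (mm_idx (D1 k) + mm_idx (D2 k) + mm_idx (shifted k))%type.

Definition cone_set k (i : cone_idx k) : set X :=
  match i with
  | inl (inl i) => mm_set i
  | inl (inr i) => mm_set i
  | inr i => mm_set i
  end.

Lemma cone_measurable k (i : cone_idx k) : measurable (cone_set i).
Proof. by case: i => [[i|i]|i]; exact: mm_measurable. Qed.

Definition cone_mod k : marked_module alpha Z :=
  std_marked alpha Z (@cone_measurable k).

Definition in1 k (i : mm_idx (D1 k)) : mm_idx (cone_mod k) := inl (inl i).
Definition in2 k (i : mm_idx (D2 k)) : mm_idx (cone_mod k) := inl (inr i).
Definition in0 k (i : mm_idx (shifted k)) : mm_idx (cone_mod k) := inr i.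

Definition iota1 k : D1 k -> cone_mod k := induce (@in1 k).
Definition iota2 k : D2 k -> cone_mod k := induce (@in2 k).
Definition iota0 k : shifted k -> cone_mod k := induce (@in0 k).

Lemma iota1_semi k : semilinear (@iota1 k). Proof. exact: induce_semilinear. Qed.
Lemma iota2_semi k : semilinear (@iota2 k). Proof. exact: induce_semilinear. Qed.
Lemma iota0_semi k : semilinear (@iota0 k). Proof. exact: induce_semilinear. Qed.

Lemma iota1_mgen k i : iota1 (mgen i) = mgen (in1 i) :> cone_mod k.
Proof. exact: induce_mgen. Qed.
Lemma iota2_mgen k i : iota2 (mgen i) = mgen (in2 i) :> cone_mod k.
Proof. exact: induce_mgen. Qed.
Lemma iota0_mgen k i : iota0 (mgen i) = mgen (in0 i) :> cone_mod k.
Proof. exact: induce_mgen. Qed.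

Definition bar1 k (c : seq G) : cone_mod k := iota1 (phi1 k (map r1 c)).
Definition bar2 k (c : seq G) : cone_mod k := iota2 (phi2 k (map r2 c)).

Lemma map_retract (K : groupType) (j : {multiplicative K -> G}) (r : G -> K) h c :
  (forall h x, r (j h * x)%g = (h * r x)%g) -> map r (j h ⋅ c) = h ⋅ map r c.
Proof.
by move=> rM; rewrite /translate -!map_comp; apply: eq_map => x /=; rewrite rM.
Qed.

Lemma bar1_equiv k g c : bar1 k (j1 g ⋅ c) = gact (j1 g) (bar1 k c).
Proof.
case: phi1P => _ phi_equiv _ _.
rewrite /bar1 map_retract// phi_equiv; apply: semilinear_gact.
exact: iota1_semi.
Qed.

Lemma bar2_equiv k g c : bar2 k (j2 g ⋅ c) = gact (j2 g) (bar2 k c).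
Proof.
case: phi2P => _ phi_equiv _ _.
rewrite /bar2 map_retract// phi_equiv; apply: semilinear_gact.
exact: iota2_semi.
Qed.

Lemma amalgam_base g : j1 (i1 g) = j2 (i2 g).
Proof. by case: amalgam => _ _ /(_ g). Qed.

Notation idL := (idfun : {additive Linf mu Z -> Linf mu Z}).

Definition ev1 k : bar LG -> cone_mod k := bar_eval LG idL (@bar1 k).
Definition ev2 k : bar LG -> cone_mod k := bar_eval LG idL (@bar2 k).

Lemma ev_semi k (phi : seq G -> cone_mod k) r b :
  (forall g c, phi ((j1 \o i1) g ⋅ c) = gact ((j1 \o i1) g) (phi c)) ->
  bar_eval LG idL phi (@cp_map _ _ (j1 \o i1) _ (linf_action alpha0 Z) LG r *: b) =
  @cp_map _ _ (j1 \o i1) _ _ LG r *: bar_eval LG idL phi b.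
Proof.
move=> phi_equiv; elim/cp_ind: r => [|r r' IHr IHr'|h y].
- by rewrite (morphB0 (@cp_mapB _ _ _ _ _ _)) !scale0r raddf0.
- rewrite (morphBD (@cp_mapB _ _ _ _ _ _)) !scalerDl.
  rewrite (morphBD (@bar_evalB _ _ _ _ _ _ idL _ phi)).
  exact: (f_equal2 +%R IHr IHr').
- rewrite cp_map_term.
  exact: (bar_eval_act (kappa := idL) (x := y) b (phi_equiv h) (fun=> erefl)).
Qed.

Lemma ev_psi_semi m k (phi : seq G -> cone_mod k) :
  (forall g c, phi ((j1 \o i1) g ⋅ c) = gact ((j1 \o i1) g) (phi c)) ->
  semilinear (fun x : D0 m => bar_eval LG idL phi (psi x)).
Proof.
move=> phi_equiv; case: psiP => psi_semi _ _; case: (psi_semi m) => psiB psiZ.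
split=> [x y|r x]; first by rewrite psiB raddfB.
by rewrite psiZ ev_semi.
Qed.

Lemma bar1_equiv0 k g c :
  bar1 k ((j1 \o i1) g ⋅ c) = gact ((j1 \o i1) g) (bar1 k c).
Proof. exact: bar1_equiv. Qed.

Lemma bar2_equiv0 k g c :
  bar2 k ((j1 \o i1) g ⋅ c) = gact ((j1 \o i1) g) (bar2 k c).
Proof. by rewrite /= amalgam_base bar2_equiv. Qed.

Definition shifted_d k : D0 k -> shifted k :=
  if k is k'.+1 return D0 k -> shifted k then mc_d D0 k' else fun=> 0.

(** The minus sign before the differential of D0 is that of a shifted complex. It makes the boundary
    of the twist vanish, because [ev1] and [ev2] composed with [psi] are chain maps in the range
    considered. *)
Definition twist k (x : D0 k) : cone_mod k :=
  ev1 k (psi x) - ev2 k (psi x) - iota0 (shifted_d x).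

Lemma twist_semi k : semilinear (@twist k).
Proof.
apply: semilinearB.
  by apply: semilinearB; apply: ev_psi_semi; [exact: bar1_equiv0|exact: bar2_equiv0].
case: k => [|k].
  split=> [x y|r x]; first by rewrite (morphB0 (iota0_semi 0).1) subr0.
  by rewrite (morphB0 (iota0_semi 0).1) scaler0.
exact: (semilinear_comp (mc_d D0 k) (iota0_semi k.+1)).
Qed.

(* The differential is cut off above degree n, beyond which phi1 and phi2 need
   not be chain maps. *)
Definition cone_dgen k (i : mm_idx (cone_mod k.+1)) : cone_mod k :=
  if (k <= n)%N then
    match i with
    | inl (inl i) => iota1 (mc_d D1 k (mgen i))
    | inl (inr i) => iota2 (mc_d D2 k (mgen i))
    | inr i => twist (mgen i)
    end
  else 0.

Definition cone_d k : {linear cone_mod k.+1 -> cone_mod k} := mext (@cone_dgen k).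

Lemma cone_d1 k (x : D1 k.+1) : (k <= n)%N ->
  cone_d k (iota1 x) = iota1 (mc_d D1 k x).
Proof.
move=> kn; apply: (mext_induce (u := @in1 k.+1) (fun=> erefl) (f := @iota1 k \o mc_d D1 k)) => // [|i].
  by apply: semilinear_comp; exact: iota1_semi.
by rewrite /cone_dgen kn.
Qed.

Lemma cone_d2 k (x : D2 k.+1) : (k <= n)%N ->
  cone_d k (iota2 x) = iota2 (mc_d D2 k x).
Proof.
move=> kn; apply: (mext_induce (u := @in2 k.+1) (fun=> erefl) (f := @iota2 k \o mc_d D2 k)) => // [|i].
  by apply: semilinear_comp; exact: iota2_semi.
by rewrite /cone_dgen kn.
Qed.

Lemma cone_d0 k (x : D0 k) : (k <= n)%N ->
  cone_d k (iota0 (k := k.+1) x) = twist x.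
Proof.
move=> kn; apply: (mext_induce (u := @in0 k.+1) (fun=> erefl) (f := @twist k)) => // [|i].
  exact: twist_semi.
by rewrite /cone_dgen kn.
Qed.

Definition cone_auggen (i : mm_idx (cone_mod 0)) : base_module LG :=
  match i with
  | inl (inl i) => mc_aug D1 (mgen i)
  | inl (inr i) => mc_aug D2 (mgen i)
  | inr i => 0
  end.

Definition cone_aug : {linear cone_mod 0 -> base_module LG} := mext cone_auggen.

Lemma aug_semi (K : groupType) (j : {multiplicative K -> G})
    (D : marked_complex (restrict_action j alpha) Z) :
  semilinear (V := base_module LG) (mc_aug D : D 0 -> base_module LG).
Proof.
split=> [x y|r x]; first exact: raddfB.
by rewrite linearZZ; exact: base_semilinear.
Qed.

Lemma cone_aug1 (x : D1 0) : cone_aug (iota1 x) = mc_aug D1 x.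
Proof. by apply: (mext_induce (u := @in1 0) (fun=> erefl)
  (V := base_module LG) (f := mc_aug D1)) => //; exact: aug_semi. Qed.

Lemma cone_aug2 (x : D2 0) : cone_aug (iota2 x) = mc_aug D2 x.
Proof. by apply: (mext_induce (u := @in2 0) (fun=> erefl)
  (V := base_module LG) (f := mc_aug D2)) => //; exact: aug_semi. Qed.

Lemma cone_aug0 (x : shifted 0) : cone_aug (iota0 x) = 0.
Proof.
apply: (mext_induce (u := @in0 0) (fun=> erefl)
  (V := base_module LG) (f := fun=> 0)) => //; exact: semilinear0.
Qed.

Lemma retract_bd (V : zmodType) (K : Type) (r : G -> K) (phi : seq K -> V) c :
  bd (fun c => phi (map r c)) c = bd phi (map r c).
Proof. by rewrite bd_mapE. Qed.

Lemma cone_d_bar1 k c : (k <= n)%N -> cone_d k (bar1 k.+1 c) = bd (bar1 k) c.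
Proof.
case: phi1P => _ _ dphi _ kn; rewrite /bar1 cone_d1// dphi//.
by rewrite -retract_bd (bd_morph (iota1_semi k).1).
Qed.

Lemma cone_d_bar2 k c : (k <= n)%N -> cone_d k (bar2 k.+1 c) = bd (bar2 k) c.
Proof.
case: phi2P => _ _ dphi _ kn; rewrite /bar2 cone_d2// dphi//.
by rewrite -retract_bd (bd_morph (iota2_semi k).1).
Qed.

Lemma cone_d_ev1 k b : (k <= n)%N -> cone_d k (ev1 k.+1 b) = ev1 k (bar_d b).
Proof.
move=> kn; rewrite /ev1 bar_eval_comp bar_eval_d; apply: eq_bar_eval => c.
exact: cone_d_bar1.
Qed.

Lemma cone_d_ev2 k b : (k <= n)%N -> cone_d k (ev2 k.+1 b) = ev2 k (bar_d b).
Proof.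
move=> kn; rewrite /ev2 bar_eval_comp bar_eval_d; apply: eq_bar_eval => c.
exact: cone_d_bar2.
Qed.

Lemma cone_dd k x : cone_d k (cone_d k.+1 x) = 0.
Proof.
pose f : {linear cone_mod k.+2 -> cone_mod k} := cone_d k \o cone_d k.+1.
pose z : {linear cone_mod k.+2 -> cone_mod k} := \0.
apply: (eq_mgen (f := f) (g := z)) => i; rewrite /f /z /=.
(* Beyond the cut-off the upper differential is zero; otherwise both differentials are the actual
   ones. *)
have [kn|kn] := leqP k.+1 n; last first.
  rewrite mext_mgen /cone_dgen (leqNgt k.+1) kn /= scaler0; exact: raddf0.
have kn' := ltnW kn; case: i => [[i|i]|i].
- rewrite -[mgen _]/(mgen (in1 i)) -iota1_mgen cone_d1// cone_d1// mc_dd.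
  exact: morphB0 (iota1_semi _).1.
- rewrite -[mgen _]/(mgen (in2 i)) -iota2_mgen cone_d2// cone_d2// mc_dd.
  exact: morphB0 (iota2_semi _).1.
rewrite -[mgen _]/(mgen (in0 (k := k.+2) i)) -iota0_mgen.
rewrite (cone_d0 (k := k.+1) (mgen i))// /twist !raddfB /=.
rewrite cone_d_ev1// cone_d_ev2// (cone_d0 (mc_d D0 k (mgen i)))//.
have shift0 : iota0 (shifted_d (mc_d D0 k (mgen (M := D0 k.+1) i))) = 0.
  have -> : shifted_d (mc_d D0 k (mgen (M := D0 k.+1) i)) = 0.
    by case: (k) i => [|k'] i //=; exact: mc_dd.
  exact: morphB0 (iota0_semi _).1.
have cancel (u v : cone_mod k) : u - v - (u - v - 0) = 0 by zmod.
by case: psiP => _ dpsi _; rewrite /twist shift0 dpsi; exact: cancel.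
Qed.

Lemma cone_aug_eval (phi : seq G -> cone_mod 0) b :
  (forall c, cone_aug (phi c) = bd (bar_unit LG) c) ->
  cone_aug (bar_eval LG idL phi b) = bar_eval LG idL (bd (bar_unit LG)) b.
Proof. by move=> phiE; rewrite bar_eval_comp; exact: eq_bar_eval. Qed.

Lemma cone_aug_bar1 c : cone_aug (bar1 0 c) = bd (bar_unit LG) c.
Proof.
rewrite /bar1 cone_aug1; have := bar_map_aug phi1P (map r1 c) => /= ->.
by rewrite !bd_bar_unit; case: c => [|x []].
Qed.

Lemma cone_aug_bar2 c : cone_aug (bar2 0 c) = bd (bar_unit LG) c.
Proof.
rewrite /bar2 cone_aug2; have := bar_map_aug phi2P (map r2 c) => /= ->.
by rewrite !bd_bar_unit; case: c => [|x []].
Qed.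

Lemma cone_augd x : cone_aug (cone_d 0 x) = 0.
Proof.
pose f : {linear cone_mod 1 -> base_module LG} := cone_aug \o cone_d 0.
pose z : {linear cone_mod 1 -> base_module LG} := \0.
apply: (eq_mgen (f := f) (g := z)) => i; rewrite /f /z /=.
case: i => [[i|i]|i].
- rewrite -[mgen _]/(mgen (in1 i)) -iota1_mgen cone_d1// cone_aug1.
  exact: mc_augd.
- rewrite -[mgen _]/(mgen (in2 i)) -iota2_mgen cone_d2// cone_aug2.
  exact: mc_augd.
rewrite -[mgen _]/(mgen (in0 (k := 1) i)) -iota0_mgen.
rewrite (cone_d0 (k := 0) (mgen i))// /twist !raddfB /= cone_aug0 subr0.
rewrite /ev1 /ev2 (cone_aug_eval _ cone_aug_bar1).
by rewrite (cone_aug_eval _ cone_aug_bar2) subrr.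
Qed.

Lemma cone_aug_surj z : exists x, cone_aug x = z.
Proof.
by have [x <-] := mc_aug_surj D1 z; exists (iota1 x); rewrite cone_aug1.
Qed.

Definition cone : marked_complex alpha Z :=
  MarkedComplex cone_dd cone_aug_surj cone_augd.

Notation j0 := (j1 \o i1).

Let m k (c : seq G) : bar LG := psi (phi0 k (map r0 c)).

(* Prepending the first vertex contracts the difference of the two chain maps
   seq G -> bar LG, compatibly with G0. *)
Fixpoint homotopy k (c : seq G) : bar LG :=
  if k is k'.+1 then
    if c is x :: _ then
      bar_cons x (m k' c - bar_term LG c 1 - bd (homotopy k') c)
    else 0
  else 0.

Lemma m_equiv k g c : m k (j0 g ⋅ c) = gact (j0 g) (m k c).
Proof.
case: phi0P => _ phi_equiv _ _; case: psiP => psi_semi _ _.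
by rewrite /m map_retract// phi_equiv (semilinear_gact _ _ (psi_semi k)).
Qed.

Lemma bar_term_equiv g c :
  bar_term LG (g ⋅ c) 1 = gact (V := bar LG) g (bar_term LG c 1).
Proof. by rewrite /gact bar_scaleE ract_one mulr1. Qed.

Lemma homotopy_equiv k g c : homotopy k (j0 g ⋅ c) = gact (j0 g) (homotopy k c).
Proof.
elim: k c => [|k IHk] c; first by rewrite /= (morphB0 (@gactB _ _ _ _ _)).
case: c => [|x c]; first by rewrite /= (morphB0 (@gactB _ _ _ _ _)).
rewrite -[LHS]/(bar_cons (j0 g * x)%g (m k (j0 g ⋅ (x :: c)) -
  bar_term LG (j0 g ⋅ (x :: c)) 1 - bd (homotopy k) (j0 g ⋅ (x :: c)))).
rewrite m_equiv bar_term_equiv bd_translate.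
rewrite (eq_bd_size (psi := fun c => gact (V := bar LG) (j0 g) (homotopy k c))) //.
rewrite -[bd (fun _ => _) _](bd_morph (@gactB _ _ _ _ _)) -!gactB.
exact: bar_cons_act.
Qed.

Lemma d_m0 x : bar_d (m 0 [:: x]) = bar_term LG [::] 1.
Proof.
case: psiP => _ _ psi_aug; case: phi0P => _ _ _ phi_aug.
by rewrite /m psi_aug /= phi_aug.
Qed.

Lemma d_m k c : (k < n)%N -> bar_d (m k.+1 c) = bd (m k) c.
Proof.
move=> kn; case: psiP => psi_semi dpsi _; case: phi0P => _ _ dphi _.
rewrite /m dpsi dphi// -retract_bd.
exact: (bd_morph (psi_semi k).1).
Qed.

Lemma homotopyP k c : (k <= n)%N -> size c = k.+1 ->
  bar_d (homotopy k.+1 c) + bd (homotopy k) c = m k c - bar_term LG c 1.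
Proof.
elim: k c => [|k IHk] [//|x c] kn sc.
  move: sc => [/size0nil ->] /=.
  by rewrite !subr0 bar_d_cons raddfB /= d_m0 bar_dU /= !subr0 subrr raddf0 subr0 addr0.
pose w := m k.+1 (x :: c) - bar_term LG (x :: c) 1 - bd (homotopy k.+1) (x :: c).
rewrite -[homotopy k.+2 _]/(bar_cons x w) bar_d_cons.
(* For a cycle w the contraction [bar_cons x] returns a filling, and w is the required
   difference. *)
suff -> : bar_d w = 0 by rewrite raddf0 /w; zmod.
rewrite /w !bar_dB d_m// bar_dU (bd_morph (@bar_dB _ _ _)).
rewrite (eq_bd_size (psi := fun c' => bar_d (homotopy k.+1 c') +
    bd (homotopy k) c' + bar_term LG c' 1)) => [|c' sc']; last first.
  rewrite IHk ?subrK//; first exact: ltnW.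
  by move: sc'; rewrite sc => -[].
rewrite (bdD (fun c' => bar_d (homotopy k.+1 c') + bd (homotopy k) c')
  (fun c' => bar_term LG c' 1)).
rewrite (bdD (fun c' => bar_d (homotopy k.+1 c')) (bd (homotopy k))) bd_bd.
have cancel (u v : bar LG) : u + 0 + v - v - u = 0 by zmod.
exact: cancel.
Qed.

(** The twist of the D0-term contributes [ev1 - ev2] on [m c]; the two terms with [homotopy] replace
    [m c] by the tuple c itself, so that [bar1 c - bar2 c] remains. This is the homotopy [E] fed to
    [glue]. *)
Definition cone_htpy k (c : seq G) : cone_mod k :=
  if k is k'.+1 return cone_mod k then
    iota0 (k := k'.+1) (phi0 k' (map r0 c)) - ev1 k'.+1 (homotopy k'.+1 c)
    + ev2 k'.+1 (homotopy k'.+1 c)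
  else 0.

Lemma ev_equiv k g b (phi : seq G -> cone_mod k) :
  (forall c, phi (g ⋅ c) = gact g (phi c)) ->
  bar_eval LG idL phi (gact (V := bar LG) g b) = gact g (bar_eval LG idL phi b).
Proof.
move=> phi_equiv.
exact: (bar_eval_act (kappa := idL) (x := 1) b phi_equiv (fun=> erefl)).
Qed.

Lemma cone_htpy_equiv k g c :
  cone_htpy k (j1 (i1 g) ⋅ c) = gact (j1 (i1 g)) (cone_htpy k c).
Proof.
case: k => [|k]; first exact/esym/(morphB0 (@gactB _ _ _ _ _)).
have e0 : iota0 (k := k.+1) (phi0 k (map r0 (j0 g ⋅ c))) =
    gact (j0 g) (iota0 (k := k.+1) (phi0 k (map r0 c))).
  case: phi0P => _ phi_equiv _ _; rewrite (map_retract (j := j0))// phi_equiv.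
  exact: (semilinear_gact _ _ (iota0_semi k.+1)).
have e1 : ev1 k.+1 (homotopy k.+1 (j0 g ⋅ c)) =
    gact (j0 g) (ev1 k.+1 (homotopy k.+1 c)).
  by rewrite (homotopy_equiv k.+1); apply: ev_equiv => c'; exact: bar1_equiv0.
have e2 : ev2 k.+1 (homotopy k.+1 (j0 g ⋅ c)) =
    gact (j0 g) (ev2 k.+1 (homotopy k.+1 c)).
  by rewrite (homotopy_equiv k.+1); apply: ev_equiv => c'; exact: bar2_equiv0.
rewrite [RHS](morphBD (@gactB _ _ _ _ _)).
exact: (f_equal2 +%R (etrans (f_equal2 (fun x y => x - y) e0 e1)
  (esym (gactB _ _ _))) e2).
Qed.

Lemma ev1_term k c : ev1 k (bar_term LG c 1) = bar1 k c.
Proof. by rewrite /ev1 bar_evalU cp_term1 scale1r. Qed.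

Lemma ev2_term k c : ev2 k (bar_term LG c 1) = bar2 k c.
Proof. by rewrite /ev2 bar_evalU cp_term1 scale1r. Qed.

Lemma ev1B k : {morph ev1 k : b b' / b - b'}. Proof. exact: bar_evalB. Qed.

Lemma ev2B k : {morph ev2 k : b b' / b - b'}. Proof. exact: bar_evalB. Qed.

Lemma cone_htpyP k c : (k < n.+1)%N -> size c = k.+1 ->
  cone_d k (cone_htpy k.+1 c) + bd (cone_htpy k) c = bar1 k c - bar2 k c.
Proof.
move=> kn sc; rewrite /cone_htpy raddfD /= raddfB /=.
rewrite cone_d_ev1// cone_d_ev2// cone_d0//.
have hE : bar_d (homotopy k.+1 c) =
    m k c - bar_term LG c 1 - bd (homotopy k) c.
  by rewrite -homotopyP//; zmod.
have ev1E : ev1 k (bar_d (homotopy k.+1 c)) =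
    ev1 k (m k c) - bar1 k c - bd (ev1 k \o homotopy k) c.
  by rewrite hE !ev1B ev1_term (bd_morph (@ev1B k)).
have ev2E : ev2 k (bar_d (homotopy k.+1 c)) =
    ev2 k (m k c) - bar2 k c - bd (ev2 k \o homotopy k) c.
  by rewrite hE !ev2B ev2_term (bd_morph (@ev2B k)).
rewrite ev1E ev2E /twist -!/(m k c).
suff -> : bd (cone_htpy k) c = iota0 (shifted_d (phi0 k (map r0 c)))
    - bd (ev1 k \o homotopy k) c + bd (ev2 k \o homotopy k) c by zmod.
case: k kn sc {hE ev1E ev2E} => [|k] kn sc.
  case: c sc => [//|x [|//]] _ /=.
  rewrite (morphB0 (iota0_semi 0).1) (morphB0 (@ev1B 0)) (morphB0 (@ev2B 0)); zmod.
case: phi0P => _ _ dphi _.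
pose F c := iota0 (k := k.+1) (phi0 k (map r0 c)).
have -> : iota0 (shifted_d (phi0 k.+1 (map r0 c))) = bd F c.
  by rewrite /= dphi// -retract_bd (bd_morph (iota0_semi k.+1).1).
rewrite -(bdB F (ev1 k.+1 \o homotopy k.+1)).
rewrite -(bdD (fun c => F c - (ev1 k.+1 \o homotopy k.+1) c)
  (ev2 k.+1 \o homotopy k.+1)).
by apply: eq_bd_size.
Qed.

Lemma cone_bar_map : exists Psi, @bar_map _ _ _ _ _ _ _ cone n.+1 Psi.
Proof.
have [Psi [Psi_equiv dPsi Psi0]] := glue amalgam (D := cone_mod) (dD := cone_d) (N := n.+1)
  bar1_equiv bar2_equiv cone_htpy_equiv (fun=> erefl)
  (fun k c kn _ => @cone_d_bar1 k c kn) cone_htpyP.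
exists (fun k c => if size c == k.+1 then Psi k c else 0).
apply: (@bar_map_truncate _ _ _ _ _ _ _ cone n.+1 Psi) => // x.
rewrite Psi0 /gact linearZZ [mc_aug _ _]cone_aug_bar1 bd_bar_unit.
rewrite [LHS]cp_term_base ract_one; exact: mulr1.
Qed.

End Cone.

(** * Two-term complexes and the dimension of the cone *)

Section TwoTermComplex.
Context d (X : measurableType d) (R : realType) (mu : probability X R).
Context (G : groupType) (a : pmp_action mu G) (Z : normed_ring R).
Notation LG := (linf_action a Z).
Notation RG := (crossed_product LG).
Context (A0 A1 : set X) (mA0 : measurable A0) (mA1 : measurable A1).
Context (rho delta : RG).
Hypotheses
  (rho_aug : rho *: (linf_indic mu Z A0 : base_module LG) = (1 : Linf mu Z))
  (delta_aug : delta *: (linf_indic mu Z A0 : base_module LG) = 0).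

Definition tt_set (k : nat) (_ : unit) : set X :=
  match k with 0 => A0 | 1 => A1 | _ => set0 end.

Lemma tt_measurable k i : measurable (tt_set k i).
Proof. by case: k => [|[|k]] /=. Qed.

Definition tt_mod k : marked_module a Z := std_marked a Z (@tt_measurable k).

Definition tt_gen k : tt_mod k := mgen (M := tt_mod k) tt.

Definition tt_d k : {linear tt_mod k.+1 -> tt_mod k} :=
  mext (fun _ => if k is 0 then delta *: tt_gen k else 0).

Definition tt_aug : {linear tt_mod 0 -> base_module LG} :=
  mext (V := base_module LG) (fun _ => (1 : Linf mu Z)).

Lemma tt_aug_gen : tt_aug (tt_gen 0) = linf_indic mu Z A0.
Proof. by rewrite [LHS]mext_mgen [LHS]cp_term_base ract1 mulr1. Qed.

Lemma tt_d_gen0 : tt_d 0 (tt_gen 1) = idem a Z A1 *: (delta *: tt_gen 0).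
Proof. exact: mext_mgen. Qed.

Lemma tt_d_eq0 k x : tt_d k.+1 x = 0.
Proof. by rewrite /= /mext big1// => i _; rewrite scaler0. Qed.

Lemma tt_dd k x : tt_d k (tt_d k.+1 x) = 0.
Proof. by rewrite tt_d_eq0 raddf0. Qed.

Lemma tt_aug_surj z : exists x, tt_aug x = z.
Proof.
exists (cp_term LG 1%g z *: (rho *: tt_gen 0)).
rewrite !linearZZ tt_aug_gen rho_aug [LHS]cp_term_base ract1; exact: mulr1.
Qed.

Lemma tt_augd x : tt_aug (tt_d 0 x) = 0.
Proof.
pose f : {linear tt_mod 1 -> base_module LG} := tt_aug \o tt_d 0.
pose z : {linear tt_mod 1 -> base_module LG} := \0.
apply: (eq_mgen (f := f) (g := z)) => -[]; rewrite /f /z /=.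
by rewrite [tt_d 0 _]tt_d_gen0 !linearZZ tt_aug_gen delta_aug scaler0.
Qed.

Definition two_term : marked_complex a Z :=
  MarkedComplex tt_dd tt_aug_surj tt_augd.

Lemma mdim_two_term k : mdim (two_term k) = fine (mu (tt_set k tt)).
Proof. by rewrite /mdim /measure_sum (bigD1 tt)//= big1 ?addr0// => -[]. Qed.

End TwoTermComplex.

Section ConeDimension.
Context d (X : measurableType d) (R : realType) (mu : probability X R).
Context (G0 G1 G2 G : groupType).
Context (i1 : {multiplicative G0 -> G1}) (i2 : {multiplicative G0 -> G2}).
Context (j1 : {multiplicative G1 -> G}) (j2 : {multiplicative G2 -> G}).
Hypothesis amalgam : amalgamated_product i1 i2 j1 j2.
Context (alpha : pmp_action mu G) (Z : normed_ring R).
Notation alpha0 := (restrict_action (j1 \o i1) alpha).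
Notation alpha1 := (restrict_action j1 alpha).
Notation alpha2 := (restrict_action j2 alpha).

Lemma amalgam_retractions :
  exists (r0 : G -> G0) (r1 : G -> G1) (r2 : G -> G2),
  [/\ forall h x, r0 ((j1 \o i1) h * x)%g = (h * r0 x)%g,
      forall h x, r1 (j1 h * x)%g = (h * r1 x)%g &
      forall h x, r2 (j2 h * x)%g = (h * r2 x)%g].
Proof.
have [j1_inj j2_inj] := amalgam_inj amalgam.
have i1_inj : injective i1 by case: amalgam.
have j0_inj : injective (j1 \o i1) by exact: inj_comp.
have [r0 r0M] := equivariant_retraction j0_inj.
have [r1 r1M] := equivariant_retraction j1_inj.
have [r2 r2M] := equivariant_retraction j2_inj.
by exists r0, r1, r2.
Qed.

Lemma mdim_ge0 (K : groupType) (a : pmp_action mu K) (M : marked_module a Z) :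
  0 <= mdim M.
Proof. by apply: sumr_ge0 => i _; exact: fine_ge0. Qed.

Lemma medim_ge0 (K : groupType) (a : pmp_action mu K) (C : free_resolution Z K) n :
  (0 <= medim a C n)%E.
Proof. by apply: le_ereal_inf_tmp => _ [D [_ ->]]; rewrite lee_fin mdim_ge0. Qed.

Lemma mdim_shifted n (D0 : marked_complex alpha0 Z) :
  mdim (shifted D0 n) = if n is m.+1 then mdim (D0 m) else 0.
Proof.
by case: n => //; rewrite /mdim /measure_sum big_pred0.
Qed.

Lemma mdim_cone n (D1 : marked_complex alpha1 Z) (phi1 : forall k, seq G1 -> D1 k)
    (D2 : marked_complex alpha2 Z) (phi2 : forall k, seq G2 -> D2 k)
    (D0 : marked_complex alpha0 Z) (psi : forall k, D0 k -> bar (linf_action alpha Z))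
    (phi1P : bar_map n.+1 phi1) (phi2P : bar_map n.+1 phi2) (psiP : bar_lift psi)
    (r1 : G -> G1) (r2 : G -> G2)
    (r1M : forall h x, r1 (j1 h * x)%g = (h * r1 x)%g)
    (r2M : forall h x, r2 (j2 h * x)%g = (h * r2 x)%g) :
  mdim (cone amalgam phi1P phi2P psiP r1M r2M n) =
  mdim (D1 n) + mdim (D2 n) + mdim (shifted D0 n).
Proof. by rewrite /mdim /measure_sum /= !big_sumType. Qed.

(** Infima over empty classes are +oo; the sign conditions exclude the undefined sum of +oo and
    -oo. *)
Lemma le_addl_ereal_inf (S : set (\bar R)) (z s : \bar R) : (0 <= s)%E ->
  (forall x, S x -> 0 <= x)%E -> (forall x, S x -> z <= s + x)%E ->
  (z <= s + ereal_inf S)%E.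
Proof.
move=> s0 S0 zS.
have iS0 : (0 <= ereal_inf S)%E by exact: le_ereal_inf_tmp.
have [iSfin|] := boolP (ereal_inf S \is a fin_num); last first.
  rewrite ge0_fin_numE// -leNgt leye_eq => /eqP ->.
  by rewrite addey ?leey// gt_eqF// (lt_le_trans _ s0).
apply/lee_addgt0Pr => e e0.
have [x Sx xS] := lb_ereal_inf_adherent e0 iSfin.
by apply: (le_trans (zS _ Sx)); rewrite -addeA leeD2l// ltW.
Qed.

Lemma trivial_aug (K : groupType) (a : pmp_action mu K) :
  (1 : crossed_product (linf_action a Z)) *:
    (linf_indic mu Z setT : base_module (linf_action a Z)) = (1 : Linf mu Z).
Proof. by rewrite scale1r indicT. Qed.

Lemma trivial_delta (K : groupType) (a : pmp_action mu K) :
  (0 : crossed_product (linf_action a Z)) *: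
    (linf_indic mu Z setT : base_module (linf_action a Z)) = 0.
Proof. exact: scale0r. Qed.

Definition trivial_complex0 : marked_complex alpha0 Z :=
  two_term measurableT measurable0 (trivial_aug alpha0) (trivial_delta alpha0).

(** The complex is <X> in degree 0 only. Its map to bar tuples must satisfy x - y = 0 in degree 1,
    which is vacuous for n = 0 and true if G0 is trivial. *)
Lemma trivial_bar_map n : n = 0%N \/ (forall g : G0, g = 1%g) ->
  exists phi, @bar_map _ _ _ _ _ _ _ trivial_complex0 n phi.
Proof.
move=> n_triv.
pose phi k (c : seq G0) : trivial_complex0 k :=
  if k is k'.+1 return trivial_complex0 k then 0
  else if c is x :: _ then gact x (tt_gen alpha0 Z measurableT measurable0 0)
  else 0.
exists (fun k c => if size c == k.+1 then phi k c else 0).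
apply: bar_map_truncate => [k g c|k c kn sc|x].
- case: k => [|k]; last exact/esym/(morphB0 (@gactB _ _ _ _ _)).
  case: c => [|x c]; first exact/esym/(morphB0 (@gactB _ _ _ _ _)).
  by rewrite -gactM.
- case: n_triv => [n0|triv]; first by rewrite n0 in kn.
  rewrite /phi raddf0; case: k sc {kn} => [|k] sc; last by rewrite bd0.
  case: c sc => [//|x [//|y [|//]]] _ /=.
  by rewrite (triv x) (triv y) subr0 subrr.
- rewrite /phi /gact linearZZ [mc_aug _ _]tt_aug_gen [LHS]cp_term_base.
  by rewrite indicT ract_one mulr1.
Qed.

Lemma medim_amalgam (C : free_resolution Z G) (C0 : free_resolution Z G0)
    (C1 : free_resolution Z G1) (C2 : free_resolution Z G2) n :
  (medim alpha C n <=
    medim alpha1 C1 n + medim alpha2 C2 n + medim_pred alpha0 C0 n)%E.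
Proof.
have [r0 [r1 [r2 [r0M r1M r2M]]]] := amalgam_retractions.
have le_cone (D0 : marked_complex alpha0 Z) phi0 (D1 : marked_complex alpha1 Z)
    (D2 : marked_complex alpha2 Z) :
    @bar_map _ _ _ _ _ _ _ D0 n phi0 -> embeds C1 n D1 -> embeds C2 n D2 ->
    (medim alpha C n <=
      (mdim (D1 n))%:E + (mdim (D2 n))%:E + (mdim (shifted D0 n))%:E)%E.
  move=> phi0P /embeds_bar_map[phi1 phi1P] /embeds_bar_map[phi2 phi2P].
  have [psi psiP] := exists_bar_lift D0.
  have [Psi PsiP] :=
    cone_bar_map amalgam phi1P phi2P phi0P psiP r0M r1M r2M.
  apply: ereal_inf_lbound; eexists; split; first exact: bar_map_embeds PsiP.
  by rewrite mdim_cone.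
have le0 (K : groupType) (a : pmp_action mu K) (C' : free_resolution Z K) m x :
    [set r | exists D : marked_complex a Z, embeds C' m D /\ r = (mdim (D m))%:E] x ->
    (0 <= x)%E.
  by move=> [D [_ ->]]; rewrite lee_fin mdim_ge0.
suff le_D0 (D0 : marked_complex alpha0 Z) phi0 :
    @bar_map _ _ _ _ _ _ _ D0 n phi0 ->
    (medim alpha C n <= medim alpha1 C1 n + medim alpha2 C2 n
      + (mdim (shifted D0 n))%:E)%E.
  case: n {le_cone} le_D0 => [|n] le_D0 /=.
    (* For n = 0 the shifted D0 contributes nothing in degree 0, in line with the convention in
       degree -1, so any D0 will do. *)
    have [phi0 phi0P] := trivial_bar_map (or_introl (erefl 0%N)).
    by have := le_D0 _ _ phi0P; rewrite mdim_shifted.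
  apply: le_addl_ereal_inf => [|x /le0//|_ [D0 [/embeds_bar_map[phi0 phi0P] ->]]].
    by rewrite adde_ge0 ?medim_ge0.
  by have := le_D0 _ _ phi0P; rewrite mdim_shifted.
move=> phi0P; rewrite addeAC; apply: le_addl_ereal_inf => [|x /le0//|].
  by rewrite adde_ge0 ?medim_ge0// lee_fin mdim_ge0.
move=> _ [D2 [D2P ->]]; rewrite -addeA addeC.
apply: le_addl_ereal_inf => [|x /le0//|].
  by rewrite adde_ge0// lee_fin mdim_ge0.
move=> _ [D1 [D1P ->]]; rewrite addeC addeAC (addeC (mdim (D2 n))%:E).
exact: le_cone phi0P D1P D2P.
Qed.

End ConeDimension.

(** * Norms and the logarithmic norm of the cone *)

Section CoefficientNorm.
Context d (X : measurableType d) (R : realType) (mu : probability X R).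
Context (Z : normed_ring R).
Notation L := (Linf mu Z).
Implicit Types (f g h : X -> Z) (l m : L).

Definition eint f : \bar R := (\int[mu]_x (nr_norm (f x))%:E)%E.

Lemma eint_measurable f : f \in linf_pred mu Z ->
  measurable_fun setT (fun x => (nr_norm (f x))%:E).
Proof.
move=> /linf_predP[mf _]; apply/measurable_EFinP => _ Y mY; rewrite setTI.
exact: (mf (@nr_norm _ Z @^-1` Y)).
Qed.

Lemma eint_ge0 f : (0 <= eint f)%E.
Proof. by apply: integral_ge0 => x _; rewrite lee_fin nr_norm_ge0. Qed.

Lemma eint_ae_le f g : f \in linf_pred mu Z -> g \in linf_pred mu Z ->
  (\forall x \ae mu, nr_norm (f x) <= nr_norm (g x)) -> (eint f <= eint g)%E.
Proof.
move=> fP gP fg; apply: ae_ge0_le_integral => //; try exact: eint_measurable.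
- by move=> x _; rewrite lee_fin nr_norm_ge0.
- by move=> x _; rewrite lee_fin nr_norm_ge0.
- by apply: filterS fg => x + _; rewrite lee_fin.
Qed.

Lemma eint_ae_eq f g : f \in linf_pred mu Z -> g \in linf_pred mu Z ->
  (\forall x \ae mu, f x = g x) -> eint f = eint g.
Proof.
move=> fP gP fg; apply/eqP; rewrite eq_le !eint_ae_le//;
  by apply: filterS fg => x ->.
Qed.

Lemma eint_aeM f g (k : R) : 0 <= k ->
  f \in linf_pred mu Z -> g \in linf_pred mu Z ->
  (\forall x \ae mu, nr_norm (f x) <= k * nr_norm (g x)) ->
  (eint f <= k%:E * eint g)%E.
Proof.
move=> k0 fP gP fg; rewrite /eint -ge0_integralZl//; last 2 first.
- exact: eint_measurable.
- by move=> x _; rewrite lee_fin nr_norm_ge0.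
apply: ae_ge0_le_integral => //; try exact: eint_measurable.
- by move=> x _; rewrite lee_fin nr_norm_ge0.
- by move=> x _; rewrite -EFinM lee_fin mulr_ge0// nr_norm_ge0.
- by apply: measurable_funeM; exact: eint_measurable.
- by apply: filterS fg => x + _; rewrite -EFinM lee_fin.
Qed.

Lemma eint_aeD f g h : f \in linf_pred mu Z -> g \in linf_pred mu Z ->
  h \in linf_pred mu Z ->
  (\forall x \ae mu, nr_norm (f x) <= nr_norm (g x) + nr_norm (h x)) ->
  (eint f <= eint g + eint h)%E.
Proof.
move=> fP gP hP fgh; rewrite /eint -ge0_integralD//; last 4 first.
- by move=> x _; rewrite lee_fin nr_norm_ge0.
- exact: eint_measurable.
- by move=> x _; rewrite lee_fin nr_norm_ge0.
- exact: eint_measurable.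
apply: ae_ge0_le_integral => //; try exact: eint_measurable.
- by move=> x _; rewrite lee_fin nr_norm_ge0.
- by move=> x _; rewrite -EFinD lee_fin addr_ge0// nr_norm_ge0.
- by apply: emeasurable_funD; exact: eint_measurable.
- by apply: filterS fgh => x + _; rewrite -EFinD lee_fin.
Qed.

Lemma eint_fin f : f \in linf_pred mu Z -> eint f \is a fin_num.
Proof.
move=> fP; have /linf_predP[_ [M fM]] := fP.
rewrite ge0_fin_numE ?eint_ge0//.
have M0 : 0 <= `|M| by [].
apply: (@le_lt_trans _ _ (\int[mu]_x cst (`|M|)%:E x)%E).
  apply: ae_ge0_le_integral => //; first by move=> x _; rewrite lee_fin nr_norm_ge0.
    exact: eint_measurable.
  by apply: filterS fM => x fxM _; rewrite lee_fin (le_trans fxM)// ler_norm.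
by rewrite integral_cst//= probability_setT mule1 ltry.
Qed.

Lemma eint_comp (G : groupType) (a : pmp_action mu G) (g : G) f :
  f \in linf_pred mu Z -> eint (f \o a g) = eint f.
Proof.
move=> fP; have nn : {in setT, forall y, (0 <= (nr_norm (f y))%:E)%E}.
  by move=> y _; rewrite lee_fin nr_norm_ge0.
have := ge0_integral_pushforward (pact_measurable a g) mu measurableT
  (eint_measurable fP) nn.
rewrite preimage_setT /eint => <-.
apply: eq_measure_integral => [|? A mA _]; first exact: pact_measurable.
exact: pact_preserving.
Qed.

Definition nl l : R := fine (eint (linf_repr l)).

Lemma nl_class f : f \in linf_pred mu Z -> nl (linf_class mu f) = fine (eint f).
Proof.
move=> fP; congr fine; apply: eint_ae_eq => //; first exact: linf_reprP.
exact: linf_classK.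
Qed.

Lemma nl_ge0 l : 0 <= nl l.
Proof. by rewrite fine_ge0// eint_ge0. Qed.

Lemma eint_repr_fin l : eint (linf_repr l) \is a fin_num.
Proof. exact/eint_fin/linf_reprP. Qed.

Lemma nlB l m : nl (l - m) <= nl l + nl m.
Proof.
rewrite -[l in nl (l - m)]linf_reprK -[m in nl (_ - m)]linf_reprK.
have lmP := rpredB (linf_reprP l) (linf_reprP m).
rewrite -linf_classB ?linf_reprP// nl_class//.
rewrite -fineD ?eint_repr_fin// fine_le ?eint_fin//.
  by rewrite fin_numD !eint_repr_fin.
apply: eint_aeD; rewrite ?linf_reprP//; apply: aeW => t.
by rewrite (le_trans (nr_normD _ _))// nr_normN.
Qed.

Lemma nlM l m (k : R) : 0 <= k ->
  (\forall t \ae mu, nr_norm (linf_repr l t) <= k) -> nl (m * l) <= k * nl m.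
Proof.
move=> k0 lk; rewrite -[l in nl (_ * l)]linf_reprK -[m in nl (m * _)]linf_reprK.
have lmP := rpredM (linf_reprP m) (linf_reprP l).
rewrite -linf_classM ?linf_reprP// nl_class//.
have -> : k * nl m = fine (k%:E * eint (linf_repr m)).
  by rewrite fineM ?eint_repr_fin.
rewrite fine_le ?eint_fin//; first by rewrite fin_numM ?eint_repr_fin.
apply: eint_aeM; rewrite ?linf_reprP//; apply: filterS lk => t lkt.
by rewrite (le_trans (nr_normM _ _))// mulrC ler_wpM2r ?nr_norm_ge0.
Qed.

Lemma nl_bounded l : exists2 k : R, 0 <= k &
  \forall t \ae mu, nr_norm (linf_repr l t) <= k.
Proof.
have /linf_predP[_ [M lM]] := linf_reprP l; exists `|M| => //.
by apply: filterS lM => t lkt; rewrite (le_trans lkt)// ler_norm.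
Qed.

Lemma nl_translate (G : groupType) (a : pmp_action mu G) (g : G) l :
  nl (linf_action a Z g l) = nl l.
Proof.
rewrite /= /linf_translate nl_class; last exact/linf_pred_comp/linf_reprP.
by congr fine; apply: eint_comp; exact: linf_reprP.
Qed.

Hypotheses (Z0 : nr_norm (0 : Z) = 0) (Z1 : nr_norm (1 : Z) <= 1).

Lemma nl0 : nl 0 = 0.
Proof.
have -> : nl 0 = nl (linf_const mu (0 : Z)) by rewrite raddf0.
rewrite nl_class ?linf_pred_const//.
rewrite /eint; under eq_integral do rewrite Z0.
by rewrite integral0.
Qed.

Lemma nlN l : nl (- l) = nl l.
Proof.
have leN m : nl (- m) <= nl m.
  by rewrite -[- m]sub0r (le_trans (nlB _ _))// nl0 add0r.
by apply/eqP; rewrite eq_le leN -{1}(opprK l) leN.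
Qed.

Lemma nlD l m : nl (l + m) <= nl l + nl m.
Proof. by rewrite -[m in leLHS]opprK (le_trans (nlB _ _))// nlN. Qed.

Lemma nl_indic_le l A : measurable A -> nl (l * linf_indic mu Z A) <= nl l.
Proof.
move=> mA; rewrite -[leRHS]mul1r; apply: nlM => //.
apply: filterS (linf_classK (linf_pred_indic mu Z mA)) => t ->.
by rewrite /set_ind; case: ifP; rewrite ?Z0.
Qed.

End CoefficientNorm.

Section ModuleNorm.
Context d (X : measurableType d) (R : realType) (mu : probability X R).
Context (G : groupType) (a : pmp_action mu G) (Z : normed_ring R).
Hypotheses (Z0 : nr_norm (0 : Z) = 0) (Z1 : nr_norm (1 : Z) <= 1).
Notation LG := (linf_action a Z).
Notation RG := (crossed_product LG).

Lemma norm1w (D : {fset G}) (r : RG) : fsubset (msupp r) D ->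
  norm1 r = \sum_(g <- D) nl (mcoeff g r).
Proof.
move=> le; rewrite /norm1.
rewrite (@big_fset_incl _ _ _ _ _ _ (fun g => nl (mcoeff g r)) le)//.
by move=> g _ /mcoeff_outdom ->; rewrite nl0.
Qed.

Lemma norm1_0 : norm1 (0 : RG) = 0.
Proof. by rewrite /norm1 msupp0 big_seq_fset0. Qed.

Lemma norm1D (r r' : RG) : norm1 (r + r') <= norm1 r + norm1 r'.
Proof.
pose D := fsetU (msupp r) (msupp r').
rewrite (@norm1w D) ?msuppD_le// !(@norm1w D) ?fsubsetUl ?fsubsetUr//.
by rewrite -big_split ler_sum// => g _; rewrite mcoeffD nlD.
Qed.

Lemma norm1_term g (l : Linf mu Z) : norm1 (cp_term LG g l) = nl l.
Proof. by rewrite (norm1w msuppU_le) big_seq_fset1 mcoeffUU. Qed.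

Lemma norm1_sum (I : Type) (r : seq I) (F : I -> RG) :
  norm1 (\sum_(i <- r) F i) <= \sum_(i <- r) norm1 (F i).
Proof.
elim: r => [|i r IHr]; first by rewrite !big_nil norm1_0.
by rewrite !big_cons (le_trans (norm1D _ _))// lerD2l.
Qed.

Lemma norm1_gact_le g (r : RG) : norm1 (cp_term LG g 1 * r) <= norm1 r.
Proof.
rewrite [r in leLHS]cp_sum mulr_sumr (le_trans (norm1_sum _ _))//.
rewrite (norm1w (fsubset_refl _)) ler_sum// => h _.
by rewrite cp_termM norm1_term mul1r nl_translate.
Qed.

Lemma norm1_gact g (r : RG) : norm1 (cp_term LG g 1 * r) = norm1 r.
Proof.
apply/eqP; rewrite eq_le norm1_gact_le/=.
have := norm1_gact_le g^-1%g (cp_term LG g 1 * r).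
by rewrite mulrA cp_termM mulVg ract_one mulr1 cp_term1 mul1r.
Qed.

Section MarkedNorm.
Variable M : marked_module a Z.
Implicit Types x y : M.

Lemma mnorm0 : mnorm (0 : M) = 0.
Proof. by rewrite /mnorm big1// => i _; rewrite raddf0 ffunE norm1_0. Qed.

Lemma mnormD x y : mnorm (x + y) <= mnorm x + mnorm y.
Proof.
rewrite /mnorm -big_split ler_sum// => i _.
by rewrite raddfD /= ffunE norm1D.
Qed.

Lemma mnorm_sum (I : Type) (r : seq I) (F : I -> M) :
  mnorm (\sum_(i <- r) F i) <= \sum_(i <- r) mnorm (F i).
Proof.
elim: r => [|i r IHr]; first by rewrite !big_nil mnorm0.
by rewrite !big_cons (le_trans (mnormD _ _))// lerD2l.
Qed.

Lemma mnorm_gact g x : mnorm (gact g x) = mnorm x.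
Proof.
apply: eq_bigr => i _; rewrite /gact linearZ /= ffunE; exact: norm1_gact.
Qed.

Lemma mnormN x : mnorm (- x) = mnorm x.
Proof.
apply: eq_bigr => i _; rewrite raddfN /= ffunE.
rewrite /norm1 msuppN; apply: eq_bigr => g _; rewrite mcoeffN; exact: nlN.
Qed.

Lemma mnorm_term g (l : Linf mu Z) i :
  mnorm (cp_term LG g l *: mgen (M := M) i) <= nl l.
Proof.
rewrite /mnorm (bigD1 i)//= big1 => [|k /negbTE ki]; last first.
  by rewrite linearZ /= ffunE mm_iso_mgen ki scaler0 norm1_0.
rewrite addr0 linearZ /= ffunE mm_iso_mgen eqxx.
rewrite [_ *: _](_ : _ = cp_term LG g (l * LG g (linf_indic mu Z (mm_set i)))).
  rewrite norm1_term -[l in leLHS](ract1 LG) -(mulgV g) ractM -ract_mul nl_translate.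
  rewrite (le_trans (nl_indic_le Z0 Z1 _ (mm_measurable i)))//.
  by rewrite nl_translate.
by rewrite [LHS]cp_termM mulg1.
Qed.

Lemma mgen_sum_terms x : x =
  \sum_i \sum_(g <- msupp (mm_iso M x i)) cp_term LG g (mcoeff g (mm_iso M x i)) *: mgen i.
Proof.
rewrite [LHS]mgen_sum; apply: eq_bigr => i _.
rewrite [X in X *: _](cp_sum (s := LG)) scaler_suml; apply: eq_bigr => g _.
by [].
Qed.

Lemma mnorm_terms x : mnorm x =
  \sum_i \sum_(g <- msupp (mm_iso M x i)) nl (mcoeff g (mm_iso M x i)).
Proof. by []. Qed.

End MarkedNorm.

Lemma mcoeff_idem (r : RG) A g :
  mcoeff g (r * idem a Z A) = mcoeff g r * LG g (linf_indic mu Z A).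
Proof.
elim/cp_ind: r => [|r r' IHr IHr'|k x].
- by rewrite mul0r !mcoeff0 mul0r.
- by rewrite mulrDl !mcoeffD IHr IHr' mulrDl.
- rewrite cp_termM mulg1 !mcoeffU.
  by case: eqP => [->|_] //; rewrite mul0r.
Qed.

Section OperatorBound.
Variables (M N : marked_module a Z) (f : {linear M -> N}).
Variables (B : mm_idx M -> set X) (mB : forall i, measurable (B i)).

(* The l^1-norm is additive over the terms (l, g) of an element, so that the
   norm of f can be tested on single terms. *)
Lemma opnorm_terms (c : R) :
  (forall i (l : Linf mu Z), l * linf_indic mu Z (B i) = l ->
    mnorm (f (cp_term LG 1%g l *: mgen i)) <= c * nl l) ->
  forall z, msub B z -> mnorm (f z) <= c * mnorm z.
Proof.
move=> fB z zB; rewrite [z in leLHS]mgen_sum_terms mnorm_terms mulr_sumr.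
rewrite raddf_sum (le_trans (mnorm_sum _ _))// ler_sum// => i _.
rewrite raddf_sum (le_trans (mnorm_sum _ _))// mulr_sumr ler_sum// => g _ /=.
set l := mcoeff g _.
have lB : l * LG g (linf_indic mu Z (B i)) = l.
  have /ideal_ofP -/(_ (mB i)) zBi := zB i.
  by rewrite /l -mcoeff_idem zBi.
have -> : cp_term LG g l *: mgen (M := M) i =
    gact g (cp_term LG 1%g (LG g^-1%g l) *: mgen i).
  by rewrite /gact scalerA cp_termM mulg1 mul1r -ractM mulgV ract1.
rewrite /gact linearZZ -/(gact g _) mnorm_gact.
apply: le_trans (fB _ _ _) _; last by rewrite nl_translate.
by rewrite -[in RHS]lB ract_mul -ractM mulVg ract1.
Qed.

Lemma opnorm_le (c : R) : 0 <= c ->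
  (forall z, msub B z -> mnorm (f z) <= c * mnorm z) -> opnorm f B <= c.
Proof.
move=> c0 fB; apply: ge_inf; last by split.
by exists 0 => y [].
Qed.

Lemma opnorm_ge0 : 0 <= opnorm f B.
Proof.
rewrite /opnorm; set S := [set c | _].
have [->|/set0P S0] := eqVneq S set0; first by rewrite inf0.
by apply: lb_le_inf => // x [].
Qed.

End OperatorBound.

(** A bound on the operator norm of the map R -> N with 1 sent to y, tested on coefficients at the
    unit only; G acts by isometries and the l^1-norm is additive over terms. *)
Definition term_bound (N : marked_module a Z) (y : N) (K : R) : Prop :=
  forall l : Linf mu Z, mnorm (cp_term LG 1%g l *: y) <= K * nl l.

Section TermBound.
Variable N : marked_module a Z.
Implicit Types y : N.

Lemma term_bound0 : term_bound (0 : N) 0.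
Proof. by move=> l; rewrite scaler0 mnorm0 mul0r. Qed.

Lemma term_boundD y y' K K' : term_bound y K -> term_bound y' K' ->
  term_bound (y + y') (K + K').
Proof.
by move=> yK y'K l; rewrite scalerDr (le_trans (mnormD _ _))// mulrDl lerD.
Qed.

Lemma term_boundN y K : term_bound y K -> term_bound (- y) K.
Proof. by move=> yK l; rewrite scalerN mnormN. Qed.

Lemma term_boundB y y' K K' : term_bound y K -> term_bound y' K' ->
  term_bound (y - y') (K + K').
Proof. by move=> yK /term_boundN; exact: term_boundD. Qed.

Lemma term_bound_term g (m : Linf mu Z) (k K : R) y : 0 <= k -> 0 <= K ->
  (\forall t \ae mu, nr_norm (linf_repr m t) <= k) -> term_bound y K ->
  term_bound (cp_term LG g m *: y) (k * K).
Proof.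
move=> k0 K0 mk yK l.
rewrite scalerA cp_termM mul1g ract1.
have -> : cp_term LG g (l * m) = cp_term LG g 1 * cp_term LG 1%g (LG g^-1%g (l * m)).
  by rewrite cp_termM mulg1 mul1r -ractM mulgV ract1.
rewrite -scalerA mnorm_gact (le_trans (yK _))// nl_translate.
by rewrite [k * K]mulrC -mulrA ler_wpM2l// nlM.
Qed.

Lemma term_bound_le y K K' : K <= K' -> term_bound y K -> term_bound y K'.
Proof. by move=> KK' yK l; rewrite (le_trans (yK l))// ler_wpM2r ?nl_ge0. Qed.

Lemma term_bound_gen i : term_bound (mgen (M := N) i) 1.
Proof. by move=> l; rewrite mul1r mnorm_term. Qed.

(** An element has finitely many terms, each with an essentially bounded coefficient. *)
Lemma term_bound_exists y : exists2 K, 0 <= K & term_bound y K.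
Proof.
rewrite [y]mgen_sum_terms.
apply: (big_ind (fun y => exists2 K, 0 <= K & term_bound y K)).
- by exists 0 => //; exact: term_bound0.
- move=> u v [K K0 uK] [K' K'0 vK']; exists (K + K'); first exact: addr_ge0.
  exact: term_boundD.
move=> i _; apply: (big_ind (fun y => exists2 K, 0 <= K & term_bound y K)).
- by exists 0 => //; exact: term_bound0.
- move=> u v [K K0 uK] [K' K'0 vK']; exists (K + K'); first exact: addr_ge0.
  exact: term_boundD.
move=> g _; have [k k0 mk] := nl_bounded (mcoeff g (mm_iso N y i)).
exists (k * 1); first by rewrite mulr1.
by apply: term_bound_term => //; exact: term_bound_gen.
Qed.

End TermBound.

(** The finiteness of operator norms. An empty set of bounds would give the infimum 0 by convention,
    and [lb_le_inf] could not be applied. *)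
Lemma opnorm_set_nonempty (M N : marked_module a Z) (f : {linear M -> N})
    (B : mm_idx M -> set X) : (forall i, measurable (B i)) ->
  exists2 c, 0 <= c & forall z, msub B z -> mnorm (f z) <= c * mnorm z.
Proof.
move=> mB.
have [K KP] := choice (fun i => let: ex_intro2 K K0 KP :=
  term_bound_exists (f (mgen i)) in ex_intro _ K (conj K0 KP)).
exists (\sum_i K i); first by apply: sumr_ge0 => i _; case: (KP i).
apply: opnorm_terms => // i l _; rewrite linearZZ.
case: (KP i) => _ /(_ l) /le_trans; apply.
rewrite ler_wpM2r ?nl_ge0// (bigD1 i)//= lerDl sumr_ge0// => k _.
by case: (KP k).
Qed.

End ModuleNorm.

Section LogPlus.
Variable R : realType.

Lemma log_plus_ge0 (t : R) : 0 <= log_plus t.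
Proof. by rewrite le_max lexx orbT. Qed.

Lemma log_plus_le (s t : R) : 0 <= s -> s <= t -> log_plus s <= log_plus t.
Proof.
move=> s0 st; rewrite /log_plus ge_max !le_max lexx !orbT andbT.
move: s0; rewrite le_eqVlt => /predU1P[<-|s_gt0]; first by rewrite ln0// lexx orbT.
by rewrite ler_ln ?st// posrE// (lt_le_trans s_gt0).
Qed.

End LogPlus.

Section LognormBasics.
Context d (X : measurableType d) (R : realType) (mu : probability X R).
Context (G : groupType) (a : pmp_action mu G) (Z : normed_ring R).
Hypotheses (Z0 : nr_norm (0 : Z) = 0) (Z1 : nr_norm (1 : Z) <= 1).
Variables (M N : marked_module a Z) (f : {linear M -> N}).

Lemma measure_sum_ge0 (I : finType) (B : I -> set X) : 0 <= measure_sum mu B.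
Proof. by apply: sumr_ge0 => i _; rewrite fine_ge0. Qed.

Lemma marked_rank_ge0 (B : mm_idx M -> set X) : 0 <= marked_rank f B.
Proof.
rewrite /marked_rank; set S := [set _ | _ in _].
have [->|/set0P S0] := eqVneq S set0; first by rewrite inf0.
by apply: lb_le_inf => // _ [B' _ <-]; exact: measure_sum_ge0.
Qed.

Lemma lognorm'_ge0 (B : mm_idx M -> set X) : 0 <= lognorm' f B.
Proof.
by rewrite le_min !mulr_ge0 ?log_plus_ge0 ?measure_sum_ge0 ?marked_rank_ge0.
Qed.

(** Decompositions are indexed by ordinals, but the pieces of the cone come indexed by a sum
    type. *)
Lemma lognorm_le_fin (T : finType) (B : T -> mm_idx M -> set X) :
  (forall i, [/\ forall t, measurable (B t i),
     mm_set i = \bigcup_(t in [set: T]) B t i &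
     trivIset [set: T] (fun t => B t i)]) ->
  lognorm f <= \sum_t lognorm' f (B t).
Proof.
move=> BP; apply: ge_inf.
  exists 0 => _ [m [B' [_ ->]]]; apply: sumr_ge0 => k _; exact: lognorm'_ge0.
exists #|T|, (fun k => B (enum_val k)); split=> [i|]; last first.
  rewrite [LHS](reindex (@enum_val T [in T])); last first.
    by exists enum_rank => t _; rewrite ?enum_rankK ?enum_valK.
  by apply: eq_bigl => k.
have [mB BU Btriv] := BP i; split=> [//||k l _ _ kl].
- rewrite BU; apply/seteqP; split=> x [t _ tx].
    by exists (enum_rank t) => //=; rewrite enum_rankK.
  by exists (enum_val t).
- by apply: enum_val_inj; exact: Btriv kl.
Qed.

Lemma lognorm_set_nonempty : exists r, (exists (m : nat) (B : 'I_m -> mm_idx M -> set X),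
    marked_decomposition B /\ r = \sum_k lognorm' f (B k)).
Proof.
exists (\sum_(k < 1) lognorm' f (@mm_set _ _ _ _ _ _ _ M)), 1%N.
exists (fun _ => @mm_set _ _ _ _ _ _ _ M); split=> // i; split=> //.
- by move=> _; exact: mm_measurable.
- apply/seteqP; split=> x; first by exists ord0.
  by case.
- by move=> k l _ _ _; rewrite !ord1.
Qed.

End LognormBasics.

Section PushFamily.
Context d (X : measurableType d) (R : realType) (mu : probability X R).
Variables (I J : finType) (u : I -> J).
Hypothesis u_inj : injective u.

Definition push_family (B : I -> set X) (k : J) : set X :=
  [set x | exists2 i, u i = k & B i x].

Lemma push_familyE B i : push_family B (u i) = B i.
Proof.
apply/seteqP; split=> x; last by exists i.
by move=> [i' /u_inj ->].
Qed.

Lemma push_family0 B k : (forall i, u i <> k) -> push_family B k = set0.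
Proof. by move=> uk; apply/seteqP; split=> // x [i /uk]. Qed.

Lemma push_family_measurable B : (forall i, measurable (B i)) ->
  forall k, measurable (push_family B k).
Proof.
move=> mB k; have [[i <-]|uk] := pselect (exists i, u i = k).
  by rewrite push_familyE.
by rewrite push_family0// => i ik; apply: uk; exists i.
Qed.

Lemma measure_sum_push B : measure_sum mu (push_family B) = measure_sum mu B.
Proof.
rewrite /measure_sum (bigID (fun k => k \in codom u))/= addrC big1 => [|k /negP uk].
  rewrite add0r; pose F k := fine (mu (push_family B k)).
  have -> : \sum_(k | k \in codom u) F k = \sum_(k <- codom u) F k.
    by rewrite big_uniq// /codom /image_mem map_inj_uniq ?enum_uniq.
  rewrite /codom /image_mem big_map big_enum /=.
  by apply: eq_bigr => i _; rewrite /F push_familyE.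
rewrite push_family0 ?measure0// => i ik.
by apply: uk; rewrite -ik codom_f.
Qed.

End PushFamily.

Section InducedMap.
Context d (X : measurableType d) (R : realType) (mu : probability X R).
Context (H G : groupType) (j : {multiplicative H -> G}) (a : pmp_action mu G).
Context (Z : normed_ring R).
Hypotheses (Z0 : nr_norm (0 : Z) = 0) (Z1 : nr_norm (1 : Z) <= 1).
Notation aH := (restrict_action j a).
Notation LH := (linf_action aH Z).
Notation LG := (linf_action a Z).
Notation pushf := (@cp_map H G j _ LH LG).

Lemma mnorm_induce (M : marked_module aH Z) (N : marked_module a Z)
    (u : mm_idx M -> mm_idx N) (x : M) : mnorm (induce u x) <= mnorm x.
Proof.
rewrite mnorm_terms /induce /sext (le_trans (mnorm_sum Z0 _ _))// ler_sum// => i _.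
rewrite [X in pushf X](cp_sum (s := LH)).
have -> (r : seq H) (F : H -> crossed_product LH) :
    pushf (\sum_(h <- r) F h) = \sum_(h <- r) pushf (F h).
  by apply: big_morph; [exact: morphBD (@cp_mapB _ _ _ _ _ _)
    |exact: morphB0 (@cp_mapB _ _ _ _ _ _)].
rewrite scaler_suml (le_trans (mnorm_sum Z0 _ _))// ler_sum// => h _.
by rewrite cp_map_term mnorm_term.
Qed.

Lemma idem_comm (K : groupType) (b : pmp_action mu K) A B :
  idem b Z A * idem b Z B = idem b Z B * idem b Z A.
Proof. by rewrite !cp_termM !mulg1 !ract1 mulrC. Qed.

Lemma ideal_of_mulidem (K : groupType) (b : pmp_action mu K) A B
    (r : crossed_product (linf_action b Z)) : measurable A ->
  ideal_of (a := b) (Z := Z) A r -> ideal_of (a := b) (Z := Z) A (r * idem b Z B).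
Proof.
move=> mA /(ideal_ofP _ mA) rA; apply/(ideal_ofP _ mA).
by rewrite -mulrA idem_comm mulrA rA.
Qed.

Lemma msub_gen (K : groupType) (b : pmp_action mu K) (M : marked_module b Z)
    (B : mm_idx M -> set X) i (l : Linf mu Z) : (forall i, measurable (B i)) ->
  l * linf_indic mu Z (B i) = l ->
  msub B (cp_term (linf_action b Z) 1%g l *: mgen i).
Proof.
move=> mB lB k; rewrite linearZ /= ffunE mm_iso_mgen.
case: eqP => [->|_]; last by rewrite scaler0; exact: ideal_of0.
apply: ideal_of_mulidem => //; apply/ideal_ofP => //.
by rewrite cp_termM mulg1 ract1 lB.
Qed.

Section Pieces.
Variables (M1 N1 : marked_module aH Z) (f1 : {linear M1 -> N1}).
Variables (M N : marked_module a Z) (f : {linear M -> N}).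
Variables (u : mm_idx M1 -> mm_idx M) (v : mm_idx N1 -> mm_idx N).
Hypotheses (u_inj : injective u) (v_inj : injective v).
Hypotheses (uE : forall i, mm_set (u i) = mm_set i)
  (vE : forall i, mm_set (v i) = mm_set i).
Hypothesis f_induce : forall x, f (induce u x) = induce v (f1 x).
Variables (B : mm_idx M1 -> set X).
Hypothesis mB : forall i, measurable (B i).

Lemma induce_term (l : Linf mu Z) i :
  cp_term LG 1%g l *: mgen (u i) = induce u (cp_term LH 1%g l *: mgen i).
Proof.
have [_ ->] := induce_semilinear u.
by rewrite induce_mgen// cp_map_term multiplicative1.
Qed.

(** Terms at the unit on an induced generator already come from M1, where the bound for [f1]
    applies, and [induce] does not increase norms. *)
Lemma opnorm_push : opnorm f (push_family u B) <= opnorm f1 B.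
Proof.
rewrite {2}/opnorm; apply: lb_le_inf.
  have [c c0 cP] := opnorm_set_nonempty Z0 Z1 f1 mB; by exists c.
move=> c [c0 cP]; apply: opnorm_le => //.
apply: opnorm_terms => //; first exact: push_family_measurable.
move=> k l lB; have [[i ik]|uk] := pselect (exists i, u i = k); last first.
  move: lB; rewrite push_family0 => [|i ik]; last by apply: uk; exists i.
  rewrite indic0 mulr0 => <-; rewrite (raddf0 (cp_term LG 1%g)) scale0r raddf0.
  by rewrite mnorm0// mulr_ge0// nl_ge0.
move: lB; rewrite -ik push_familyE// => lB.
rewrite induce_term f_induce (le_trans (mnorm_induce _ _))//.
rewrite (le_trans (cP _ (msub_gen mB lB)))// ler_wpM2l//.
exact: mnorm_term.
Qed.

Lemma msub_sum (K : groupType) (b : pmp_action mu K) (N' : marked_module b Z)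
    (B' : mm_idx N' -> set X) (T : Type) (r : seq T) (F : T -> N') :
  (forall t, msub B' (F t)) -> msub B' (\sum_(t <- r) F t).
Proof.
move=> FB; apply: (big_ind (msub B')) => // [k|x y xB yB k].
  by rewrite raddf0 ffunE; exact: ideal_of0.
by rewrite raddfD /= ffunE; exact: ideal_ofD.
Qed.

Lemma msubZ (K : groupType) (b : pmp_action mu K) (N' : marked_module b Z)
    (B' : mm_idx N' -> set X) q (x : N') : msub B' x -> msub B' (q *: x).
Proof. by move=> xB k; rewrite linearZ /= ffunE; exact: ideal_ofZ. Qed.

Lemma msub_induce (B' : mm_idx N1 -> set X) y :
  (forall i, measurable (B' i)) -> msub B' y ->
  msub (push_family v B') (induce v y).
Proof.
move=> mB' yB; apply: msub_sum => i k.
rewrite linearZ /= ffunE mm_iso_mgen.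
case: eqP => [->|_]; last by rewrite scaler0; exact: ideal_of0.
rewrite push_familyE//; apply: ideal_of_mulidem => //.
have /(ideal_ofP _ (mB' i)) <- := yB i.
rewrite (cp_mapM (@restrict_compat _ _ _ _ _ _ j a Z)) cp_map_idem.
exact: ideal_of_idem.
Qed.

(** Pushing forward a summand of N1 that contains the image of [f1] keeps its dimension and yields a
    summand containing the image of [f]. *)
Lemma marked_rank_push : marked_rank f (push_family u B) <= marked_rank f1 B.
Proof.
rewrite {2}/marked_rank; apply: lb_le_inf.
  exists (measure_sum mu (@mm_set _ _ _ _ _ _ _ N1)), (@mm_set _ _ _ _ _ _ _ N1) => //.
  split; first by move=> i; split=> //; exact: mm_measurable.
  by move=> _ [x _ <-] i; exact: mm_coordP.
move=> _ [B' [B'sub fB'] <-]; rewrite -(measure_sum_push mu v_inj B').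
apply: ge_inf.
  by exists 0 => _ [B'' _ <-]; exact: measure_sum_ge0.
have mB' i : measurable (B' i) by case: (B'sub i).
exists (push_family v B') => //; split=> [k|_ [z zB <-]].
  split; first exact: push_family_measurable.
  by move=> x [i <- xB]; rewrite vE; case: (B'sub i) => _; apply.
rewrite [z]mgen_sum_terms raddf_sum; apply: msub_sum => k.
rewrite raddf_sum; apply: msub_sum => g /=.
set l := mcoeff g _.
have lB : l * LG g (linf_indic mu Z (push_family u B k)) = l.
  have /(ideal_ofP _ (push_family_measurable u_inj mB k)) zBk := zB k.
  by rewrite /l -mcoeff_idem zBk.
have -> : cp_term LG g l *: mgen k =
    gact g (cp_term LG 1%g (LG g^-1%g l) *: mgen k).
  by rewrite /gact scalerA cp_termM mulg1 mul1r -ractM mulgV ract1.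
rewrite /gact linearZZ; apply: msubZ.
have {}lB : LG g^-1%g l * linf_indic mu Z (push_family u B k) = LG g^-1%g l.
  by rewrite -[in RHS]lB ract_mul -ractM mulVg ract1.
move: lB; have [[i <-]|uk] := pselect (exists i, u i = k); last first.
  rewrite push_family0 => [|i ik]; last by apply: uk; exists i.
  rewrite indic0 mulr0 => <-; rewrite (raddf0 (cp_term LG 1%g)) scale0r raddf0.
  by move=> m; rewrite raddf0 ffunE; exact: ideal_of0.
rewrite push_familyE// => lB; rewrite induce_term f_induce.
apply: msub_induce => //; apply: fB'; exists (cp_term LH 1%g (LG g^-1%g l) *: mgen i) => //.
exact: msub_gen.
Qed.

Lemma lognorm'_push : lognorm' f (push_family u B) <= lognorm' f1 B.
Proof.
have log_le : log_plus (opnorm f (push_family u B)) <= log_plus (opnorm f1 B).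
  by apply: log_plus_le; [exact: opnorm_ge0|exact: opnorm_push].
rewrite /lognorm' measure_sum_push// le_min !ge_min; apply/andP; split.
  by rewrite ler_wpM2l ?measure_sum_ge0.
by apply/orP; right; rewrite ler_pM ?marked_rank_ge0 ?log_plus_ge0// marked_rank_push.
Qed.

End Pieces.
End InducedMap.

Section ConeLognorm.
Context d (X : measurableType d) (R : realType) (mu : probability X R).
Context (G0 G1 G2 G : groupType).
Context (i1 : {multiplicative G0 -> G1}) (i2 : {multiplicative G0 -> G2}).
Context (j1 : {multiplicative G1 -> G}) (j2 : {multiplicative G2 -> G}).
Hypothesis amalgam : amalgamated_product i1 i2 j1 j2.
Context (alpha : pmp_action mu G) (Z : normed_ring R).
Hypotheses (Z0 : nr_norm (0 : Z) = 0) (Z1 : nr_norm (1 : Z) <= 1).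
Notation alpha0 := (restrict_action (j1 \o i1) alpha).
Notation alpha1 := (restrict_action j1 alpha).
Notation alpha2 := (restrict_action j2 alpha).
Notation LG := (linf_action alpha Z).

Context (n : nat).
Context (D1 : marked_complex alpha1 Z) (phi1 : forall k, seq G1 -> D1 k).
Context (D2 : marked_complex alpha2 Z) (phi2 : forall k, seq G2 -> D2 k).
Context (D0 : marked_complex alpha0 Z) (psi : forall k, D0 k -> bar LG).
Hypotheses (phi1P : bar_map n.+1 phi1) (phi2P : bar_map n.+1 phi2)
  (psiP : bar_lift psi).
Context (r1 : G -> G1) (r2 : G -> G2).
Hypotheses (r1M : forall h x, r1 (j1 h * x)%g = (h * r1 x)%g)
  (r2M : forall h x, r2 (j2 h * x)%g = (h * r2 x)%g).

Notation D := (cone amalgam phi1P phi2P psiP r1M r2M).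
Notation emb1 := (@in1 _ _ _ _ _ _ _ _ _ _ _ _ _ D1 D2 D0 n.+1).
Notation emb2 := (@in2 _ _ _ _ _ _ _ _ _ _ _ _ _ D1 D2 D0 n.+1).
Notation emb0 := (@in0 _ _ _ _ _ _ _ _ _ _ _ _ _ D1 D2 D0 n.+1).

Lemma in1_inj k : injective (@in1 _ _ _ _ _ _ _ _ _ _ _ _ _ D1 D2 D0 k).
Proof. by move=> x y []. Qed.

Lemma in2_inj k : injective (@in2 _ _ _ _ _ _ _ _ _ _ _ _ _ D1 D2 D0 k).
Proof. by move=> x y []. Qed.

Lemma in0_inj k : injective (@in0 _ _ _ _ _ _ _ _ _ _ _ _ _ D1 D2 D0 k).
Proof. by move=> x y []. Qed.

(** Given decompositions of D1 and D2 are kept, and the whole D0-part is one further piece. *)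
Definition cone_piece (T1 T2 : finType) (B1 : T1 -> mm_idx (D1 n.+1) -> set X)
    (B2 : T2 -> mm_idx (D2 n.+1) -> set X) (t : T1 + T2 + unit) :
    mm_idx (D n.+1) -> set X :=
  match t with
  | inl (inl t) => push_family emb1 (B1 t)
  | inl (inr t) => push_family emb2 (B2 t)
  | inr _ => push_family emb0 (@mm_set _ _ _ _ _ _ _ (shifted D0 n.+1))
  end.

Lemma cone_piece_decomposition (m1 m2 : nat)
    (B1 : 'I_m1 -> mm_idx (D1 n.+1) -> set X)
    (B2 : 'I_m2 -> mm_idx (D2 n.+1) -> set X) :
  marked_decomposition B1 -> marked_decomposition B2 ->
  forall i, [/\ forall t, measurable (cone_piece B1 B2 t i),
     mm_set i = \bigcup_(t in [set: 'I_m1 + 'I_m2 + unit]) cone_piece B1 B2 t i &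
     trivIset [set: 'I_m1 + 'I_m2 + unit] (fun t => cone_piece B1 B2 t i)].
Proof.
move=> B1P B2P i; split.
- case=> [[t|t]|t]; apply: push_family_measurable.
  + exact: in1_inj.
  + by move=> k; case: (B1P k).
  + exact: in2_inj.
  + by move=> k; case: (B2P k).
  + exact: in0_inj.
  + by move=> k; exact: mm_measurable.
- case: i => [[i|i]|i].
  + have [_ BU _] := B1P i.
    rewrite [LHS]BU; apply/seteqP; split=> [x [t _ tx]|x [[[t|t]|t] _] [i' []]//].
      by exists (inl (inl t)) => //; exists i.
    by move=> -> tx; exists t.
  + have [_ BU _] := B2P i.
    rewrite [LHS]BU; apply/seteqP; split=> [x [t _ tx]|x [[[t|t]|t] _] [i' []]//].
      by exists (inl (inr t)) => //; exists i.
    by move=> -> tx; exists t.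
  + apply/seteqP; split=> [x ix|x [[[t|t]|t] _] [i' []]//].
      by exists (inr tt) => //; exists i.
    by move=> ->.
- move=> t t' _ _ [x [tx t'x]].
  case: i tx t'x => [[i|i]|i].
  + have [_ _ B1triv] := B1P i.
    case: t => [[t|t]|t] [k []//] -> tx; case: t' => [[t'|t']|t'] [k' []//] -> t'x.
    by congr (inl (inl _)); apply: B1triv => //; exists x.
  + have [_ _ B2triv] := B2P i.
    case: t => [[t|t]|t] [k []//] -> tx; case: t' => [[t'|t']|t'] [k' []//] -> t'x.
    by congr (inl (inr _)); apply: B2triv => //; exists x.
  + case: t => [[t|t]|[]] [k []//] _ _; case: t' => [[t'|t']|[]] [k' []//] _ _.
Qed.

Variable K : R.
Hypothesis K0 : 0 <= K.
Hypothesis twist_bound : forall i : mm_idx (D0 n),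
  term_bound (twist phi1 phi2 psi r1 r2 (mgen i)) K.

(** Of the two terms in the minimum the one with the dimension is taken: the source is small, while
    the image of the twist may have large rank. *)
Lemma lognorm'_base : lognorm' (mc_d D n)
    (push_family emb0 (@mm_set _ _ _ _ _ _ _ (shifted D0 n.+1))) <=
  mdim (D0 n) * log_plus K.
Proof.
rewrite /lognorm' ge_min; apply/orP; left.
rewrite measure_sum_push; last exact: in0_inj.
rewrite ler_wpM2l ?measure_sum_ge0// log_plus_le ?opnorm_ge0//.
have mB : forall k, measurable (push_family emb0 (@mm_set _ _ _ _ _ _ _ (shifted D0 n.+1)) k).
  by apply: push_family_measurable; [exact: in0_inj|move=> k; exact: mm_measurable].
apply: opnorm_le => //; apply: opnorm_terms => // k l lB.
have [[i ik]|uk] := pselect (exists i, emb0 i = k); last first.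
  move: lB; rewrite push_family0 => [|i ik]; last by apply: uk; exists i.
  rewrite indic0 mulr0 => <-; rewrite (raddf0 (cp_term LG 1%g)) scale0r raddf0.
  by rewrite mnorm0// mulr_ge0// nl_ge0.
rewrite linearZZ -ik.
have -> : mc_d D n (mgen (emb0 i)) = twist phi1 phi2 psi r1 r2 (mgen (M := D0 n) i).
  rewrite -iota0_mgen.
  exact: (cone_d0 amalgam phi1P phi2P psiP r1M r2M (mgen (M := D0 n) i) (leqnn n)).
exact: twist_bound.
Qed.

Lemma lognorm_cone : lognorm (mc_d D n) <=
  lognorm (mc_d D1 n) + lognorm (mc_d D2 n) + mdim (D0 n) * log_plus K.
Proof.
(* Each infimum on the right is isolated in turn, so that decompositions of D1 and D2 can be
   fixed. *)
rewrite -addrA -lerBlDr [X in _ <= X]/lognorm; apply: lb_le_inf.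
  exact: lognorm_set_nonempty.
move=> _ [m1 [B1 [B1P ->]]]; rewrite lerBlDr addrCA -lerBlDr [X in _ <= X]/lognorm.
apply: lb_le_inf; first exact: lognorm_set_nonempty.
move=> _ [m2 [B2 [B2P ->]]]; rewrite lerBlDr.
apply: le_trans (lognorm_le_fin _ (cone_piece_decomposition B1P B2P)) _.
rewrite !big_sumType/= [leRHS]addrCA [leRHS]addrA lerD//; last first.
  by rewrite (bigD1 tt)//= big1 ?addr0; [exact: lognorm'_base|case].
rewrite lerD// ler_sum// => t _.
- apply: (@lognorm'_push _ _ _ _ _ _ j1 alpha Z Z0 Z1 _ _ (mc_d D1 n) _ _ _ _
    (@in1 _ _ _ _ _ _ _ _ _ _ _ _ _ D1 D2 D0 n)) => //.
  + exact: in1_inj.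
  + exact: in1_inj.
  + by move=> x; exact: (cone_d1 phi1 phi2 psi r1 r2 x (leqnn n)).
  + by move=> i; case: (B1P i).
- apply: (@lognorm'_push _ _ _ _ _ _ j2 alpha Z Z0 Z1 _ _ (mc_d D2 n) _ _ _ _
    (@in2 _ _ _ _ _ _ _ _ _ _ _ _ _ D1 D2 D0 n)) => //.
  + exact: in2_inj.
  + exact: in2_inj.
  + by move=> x; exact: (cone_d2 phi1 phi2 psi r1 r2 x (leqnn n)).
  + by move=> i; case: (B2P i).
Qed.

End ConeLognorm.

(** * Bounds on [mevol] from a choice of D0 *)

Section MevolAmalgam.
Context d (X : measurableType d) (R : realType) (mu : probability X R).
Context (G0 G1 G2 G : groupType).
Context (i1 : {multiplicative G0 -> G1}) (i2 : {multiplicative G0 -> G2}).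
Context (j1 : {multiplicative G1 -> G}) (j2 : {multiplicative G2 -> G}).
Hypothesis amalgam : amalgamated_product i1 i2 j1 j2.
Context (alpha : pmp_action mu G).
Notation Z := (normed_int R).
Notation alpha0 := (restrict_action (j1 \o i1) alpha).
Notation alpha1 := (restrict_action j1 alpha).
Notation alpha2 := (restrict_action j2 alpha).
Notation LG := (linf_action alpha Z).

Lemma int_norm0 : nr_norm (0 : Z) = 0.
Proof. by rewrite /= /int_norm normr0. Qed.

Lemma int_norm1 : nr_norm (1 : Z) <= 1.
Proof. by rewrite /= /int_norm normr1. Qed.

(** The hypothesis chooses D0 last, after D1, D2, their maps and the tolerance e: the bound K
    depends on all of these, and only the product of dim D0 and log_+ K has to be small. *)
Lemma mevol_amalgam (C : free_resolution Z G) (C1 : free_resolution Z G1)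
    (C2 : free_resolution Z G2) n :
  (forall (D1 : marked_complex alpha1 Z) (phi1 : forall k, seq G1 -> D1 k)
     (D2 : marked_complex alpha2 Z) (phi2 : forall k, seq G2 -> D2 k)
     (r1 : G -> G1) (r2 : G -> G2) (e : R),
     bar_map n.+1 phi1 -> bar_map n.+1 phi2 ->
     (forall h x, r1 (j1 h * x)%g = (h * r1 x)%g) ->
     (forall h x, r2 (j2 h * x)%g = (h * r2 x)%g) -> 0 < e ->
     exists (D0 : marked_complex alpha0 Z) (phi0 : forall k, seq G0 -> D0 k)
       (psi : forall k, D0 k -> bar LG) (K : R),
     [/\ bar_map n phi0, bar_lift psi, 0 <= K,
       forall i : mm_idx (D0 n),
         term_bound (twist phi1 phi2 psi r1 r2 (mgen i)) K &
       mdim (D0 n) * log_plus K <= e]) ->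
  (mevol alpha C n <= mevol alpha1 C1 n + mevol alpha2 C2 n)%E.
Proof.
move=> exD0.
have lognorm_ge0 (K : groupType) (a : pmp_action mu K) (M N : marked_module a Z)
    (f : {linear M -> N}) : 0 <= lognorm f.
  apply: lb_le_inf; first exact: lognorm_set_nonempty.
  by move=> _ [m [B [_ ->]]]; apply: sumr_ge0 => k _; exact: lognorm'_ge0.
have ge0 (K : groupType) (a : pmp_action mu K) (C' : free_resolution Z K) x :
    [set r | exists D : marked_complex a Z,
      embeds C' n D /\ r = (lognorm (mc_d D n))%:E] x -> (0 <= x)%E.
  by move=> [D [_ ->]]; rewrite lee_fin.
have [r0 [r1 [r2 [r0M r1M r2M]]]] := amalgam_retractions amalgam.
apply: le_addl_ereal_inf => [|x /ge0//|].
  by apply: le_ereal_inf_tmp => x /ge0.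
move=> _ [D2 [D2P ->]]; rewrite addeC.
apply: le_addl_ereal_inf => [|x /ge0//|]; first by rewrite lee_fin.
move=> _ [D1 [D1P ->]].
have [phi1 phi1P] := embeds_bar_map D1P; have [phi2 phi2P] := embeds_bar_map D2P.
apply/lee_addgt0Pr => e e0.
have [D0 [phi0 [psi [K [phi0P psiP K0 KP Ke]]]]] :=
  exD0 D1 phi1 D2 phi2 r1 r2 e phi1P phi2P r1M r2M e0.
have [Psi PsiP] := cone_bar_map amalgam phi1P phi2P phi0P psiP r0M r1M r2M.
apply: (@le_trans _ _ (lognorm (mc_d (cone amalgam phi1P phi2P psiP r1M r2M) n))%:E).
  by apply: ereal_inf_lbound; eexists; split; first exact: bar_map_embeds PsiP.
rewrite -!EFinD lee_fin [lognorm _ + lognorm _]addrC.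
apply: le_trans (lognorm_cone amalgam int_norm0 int_norm1 phi1P phi2P psiP r1M r2M K0 KP) _.
by rewrite lerD2l.
Qed.

(** For n >= 1 the module D0 n is zero, so any bound on the twist gives excess 0. In degree 0 it
    would be <X>, of dimension 1. *)
Lemma mevol_free (C : free_resolution Z G) (C1 : free_resolution Z G1)
    (C2 : free_resolution Z G2) n :
  (forall g : G0, g = 1%g) -> (1 <= n)%N ->
  (mevol alpha C n <= mevol alpha1 C1 n + mevol alpha2 C2 n)%E.
Proof.
move=> triv n1; apply: mevol_amalgam => D1 phi1 D2 phi2 r1 r2 e _ _ _ _ e0.
pose D0 := trivial_complex0 i1 j1 alpha Z.
have [phi0 phi0P] := @trivial_bar_map _ _ _ mu _ _ _ i1 j1 alpha Z n (or_intror triv).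
have [psi psiP] := exists_bar_lift D0.
have [K K0 KP] := term_bound_exists int_norm0 int_norm1
  (twist phi1 phi2 psi r1 r2 (mgen (M := D0 n) tt)).
exists D0, phi0, psi, K.
split; [exact: phi0P|exact: psiP|exact: K0|by case; exact: KP|].
have tt0 m : (1 <= m)%N -> tt_set setT set0 m tt = set0 :> set X.
  by case: m => [|[|m]].
by rewrite mdim_two_term tt0// measure0 mul0r ltW.
Qed.

End MevolAmalgam.

(** * Markers for free actions of the integers *)

(** A countable base of the Hausdorff topology pulls back to a countable separating family of
    measurable sets. *)
Lemma standard_borel_separated d (X : measurableType d) (R : realType) :
  standard_borel X R -> exists2 U : nat -> set X,
    forall i, measurable (U i) &
    forall x y, x <> y -> exists i, U i x /\ ~ U i y.
Proof.
move=> [Y [f [hY [B /countable_injP[c c_inj] basisB] [g fK gK] mX]]].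
have fg (A : set Y) : f @` (f @^-1` A) = A.
  apply/seteqP; split=> [_ [x Ax <-]//|y Ay]; exists (g y); rewrite /= ?gK//.
have Usep x y : x <> y -> exists2 A, B A & A (f x) /\ ~ A (f y).
  move=> xy; have fxy : f x != f y by apply/eqP => /(can_inj fK).
  have [A [oA /set_mem Afx /set_mem Afy]] := hausdorff_accessible hY fxy.
  have [V [BV Vfx] VA] := basisB.2 (f x) _ (open_nbhs_nbhs (conj oA Afx)).
  by exists V => //; split => // /VA.
have mf A : B A -> measurable (f @^-1` A).
  move=> BA; apply/mX; rewrite fg; apply: sub_sigma_algebra.
  exact: (basisB.1 A BA).
pose e i := xget set0 [set A | B A /\ c A = i].
exists (fun i => f @^-1` e i) => [i|x y /Usep[A BA [Ax Ay]]].
  rewrite /e; case: xgetP => [A _ [BA _]|_]; first exact: mf.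
  by rewrite preimage_set0.
exists (c A); have [Be ce] : [set A' | B A' /\ c A' = c A] (e (c A)).
  by apply: (@xgetI _ set0 _ A).
have eA : e (c A) = A by apply: c_inj; rewrite ?inE.
by rewrite /= eA.
Qed.

Section Marker.
Context d (X : measurableType d) (R : realType) (mu : probability X R).
Variables (T : int -> X -> X).
Hypotheses (T0 : forall x, T 0 x = x)
  (TD : forall k l x, T (k + l) x = T k (T l x))
  (mT : forall k A, measurable A -> measurable (T k @^-1` A))
  (muT : forall k A, measurable A -> mu (T k @^-1` A) = mu A).
Variables (U : nat -> set X).
Hypotheses (mU : forall i, measurable (U i))
  (Usep : forall x y, x <> y -> exists i, U i x /\ ~ U i y).
Variable N : nat.

Definition separated (A : set X) :=
  forall x k, A x -> (0 < k < N)%N -> ~ A (T k%:Z x).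

(** If U (s k) contains x but not its k-th translate, then that translate is outside the cell. By
    freeness every point has such an s, and there are countably many s. *)
Definition separated_cell (s : {ffun 'I_N -> nat}) : set X :=
  [set x | forall k : 'I_N, (0 < k)%N -> U (s k) x /\ ~ U (s k) (T k%:Z x)].

Definition cell (i : nat) : set X :=
  if unpickle i is Some s then separated_cell s else set0.

Lemma cell_measurable i : measurable (cell i).
Proof.
rewrite /cell; case: unpickle => // s.
rewrite (_ : separated_cell s = \bigcap_(k in [set k : 'I_N | (0 < k)%N])
    (U (s k) `&` ~` (T k%:Z @^-1` U (s k)))).
  apply: fin_bigcap_measurable => // k _; apply: measurableI => //.
  by apply: measurableC; exact: mT.
by apply/seteqP; split=> x xs k /xs.
Qed.

Lemma cell_separated i : separated (cell i).
Proof.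
rewrite /cell; case: unpickle => [s|] x k //= xs /andP[k0 kN] Txs.
have [_] := xs (Ordinal kN) k0; apply.
by have [] := Txs (Ordinal kN) k0.
Qed.

Lemma cell_cover x : (forall k : int, k != 0 -> T k x <> x) -> exists i, cell i x.
Proof.
move=> free.
have [s sP] : exists s : {ffun 'I_N -> nat}, separated_cell s x.
  have ex (k : 'I_N) : exists i, (0 < k)%N -> U i x /\ ~ U i (T k%:Z x).
    have [k0|k0] := boolP (0 < k)%N; last by exists 0%N.
    have [|i iP] := @Usep x (T k%:Z x); last by exists i.
    by apply/nesym/free; rewrite -lt0n.
  have [s sP] := choice ex; exists [ffun k => s k] => k k0.
  by rewrite ffunE; exact: sP.
by exists (pickle s); rewrite /cell pickleK.
Qed.

Definition near (A : set X) : set X :=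
  [set x | exists2 k : 'I_N, (0 < k)%N & A (T k%:Z x) \/ A (T (- k%:Z) x)].

Lemma near_measurable A : measurable A -> measurable (near A).
Proof.
move=> mA; rewrite (_ : near A = \bigcup_(k in [set k : 'I_N | (0 < k)%N])
    (T k%:Z @^-1` A `|` T (- k%:Z) @^-1` A)).
  by apply: fin_bigcup_measurable => // k _; apply: measurableU; exact: mT.
by apply/seteqP; split=> x [k k0 kA]; exists k.
Qed.

(** Countable greedy construction: from each cell only the points that are far along their orbit
    from the set built so far are added. The union is separated and meets every free orbit with
    bounded gaps. *)
Fixpoint greedy (i : nat) : set X :=
  if i is i'.+1 then greedy i' `|` (cell i' `\` near (greedy i')) else set0.

Lemma greedy_measurable i : measurable (greedy i).
Proof.
elim: i => //= i IHi; apply: measurableU => //; apply: measurableD.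
  exact: cell_measurable.
exact: near_measurable.
Qed.

Lemma T_opp k x : T (- k) (T k x) = x.
Proof. by rewrite -TD addNr T0. Qed.

Lemma greedy_separated i : separated (greedy i).
Proof.
elim: i => [|i IHi] x k //= xA /andP[k0 kN] TxA.
case: xA TxA => [xA|[xc xn]] [TxA|[Txc Txn]].
- by apply: (IHi x k) TxA; rewrite ?k0.
- apply: Txn; exists (Ordinal kN) => //; right; by rewrite /= T_opp.
- by apply: xn; exists (Ordinal kN) => //; left.
- by apply: (@cell_separated i x k); rewrite ?k0.
Qed.

Lemma greedy_mono i l : (i <= l)%N -> greedy i `<=` greedy l.
Proof.
move=> /subnK <-; elim: (l - i)%N => [//|k IHk] x /IHk.
by rewrite addSn; left.
Qed.

Definition marker : set X := \bigcup_i greedy i.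

Lemma marker_measurable : measurable marker.
Proof. by apply: bigcupT_measurable => i; exact: greedy_measurable. Qed.

Lemma marker_separated : separated marker.
Proof.
move=> x k [i _ xi] kN [l _ Txl].
apply: (@greedy_separated (maxn i l) x k) => //.
  exact: greedy_mono (leq_maxl _ _) _ xi.
exact: greedy_mono (leq_maxr _ _) _ Txl.
Qed.

(** A point of cell i either is within N - 1 steps of the earlier set, in one of the two directions,
    or is itself added. Writing times as N - i prepares the shift by N that makes all visits
    backward ones. *)
Lemma marker_cover x : (0 < N)%N -> (forall k : int, k != 0 -> T k x <> x) ->
  exists2 i : nat, (i < N.*2)%N & marker (T (N%:Z - i%:Z) x).
Proof.
move=> N0 /cell_cover[i xi].
have [[k k0 [kA|kA]]|xn] := pselect (near (greedy i) x).
- exists (N - k)%N; first by rewrite -addnn; lia.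
  have -> : N%:Z - (N - k)%N%:Z = k%:Z by have := ltn_ord k; lia.
  by exists i.
- exists (N + k)%N; first by have := ltn_ord k; rewrite -addnn; lia.
  have -> : N%:Z - (N + k)%N%:Z = - k%:Z by lia.
  by exists i.
- exists N; first by rewrite -addnn; lia.
  by rewrite subrr T0; exists i.+1 => //; right.
Qed.

(** Separation makes the N preimages under T 0, ..., T (N - 1) disjoint, and they all have the
    measure of the marker. *)
Lemma marker_small : N%:R * fine (mu marker) <= 1.
Proof.
have mM := marker_measurable.
have mF k : measurable (T k%:Z @^-1` marker) by exact: mT.
have := @measure_semi_additive_ord_I _ _ _ mu (fun k => T k%:Z @^-1` marker) N
  (fun k _ => mF k).
have -> : (\sum_(i < N) mu (T i%:Z @^-1` marker) = \sum_(i < N) mu marker)%E.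
  by apply: eq_bigr => i _; rewrite muT.
have -> : mu marker = (fine (mu marker))%:E by rewrite fineK// fin_num_measure.
rewrite sumEFin sumr_const card_ord => muE; rewrite mulr_natl -lee_fin -muE.
- by apply: probability_le1; apply: bigsetU_measurable.
- have disj k l x : (k < l < N)%N -> marker (T k%:Z x) -> ~ marker (T l%:Z x).
    move=> /andP[kl lN] kx.
    have -> : T l%:Z x = T (l - k)%N%:Z (T k%:Z x) by rewrite -TD; congr T; lia.
    by apply: marker_separated kx _; lia.
  move=> k l /= kN lN [x [kx lx]].
  have [kl|kl|//] := ltngtP k l.
    by have := @disj k l x; rewrite kl lN => /(_ isT kx).
  by have := @disj l k x; rewrite kl kN => /(_ isT lx).
- exact: bigsetU_measurable.
Qed.

End Marker.

(** * The cheap complex of an action of the integers *)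

Section FirstReturn.
Context d (X : measurableType d) (R : realType) (mu : probability X R).
Context (H : groupType) (a : pmp_action mu H) (Z : normed_ring R).
Context (f : int -> H).
Hypothesis fD : forall k l, f (k + l) = (f k * f l)%g.
Context (A : set X) (M : nat).
Hypothesis mA : measurable A.
Hypothesis cover : \forall x \ae mu, exists2 i : nat, (i <= M)%N & A (a (f (- i%:Z)) x).
Notation LH := (linf_action a Z).
Notation RH := (crossed_product LH).

Lemma int_morph0 : f 0 = 1%g.
Proof. by apply: (mulgI (f 0)); rewrite -fD addr0 mulg1. Qed.

Lemma int_morphN k : f (- k) = (f k)^-1%g.
Proof. by apply: (mulgI (f k)); rewrite -fD subrr int_morph0 mulgV. Qed.

(** The points whose backward orbit avoids A at times 0 to j; [late M] is null by [cover]. *)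
Definition late (j : nat) : set X :=
  [set x | forall i : nat, (i <= j)%N -> ~ A (a (f (- i%:Z)) x)].

Lemma late_measurable j : measurable (late j).
Proof.
rewrite (_ : late j = \bigcap_(i in [set i | (i <= j)%N])
    ~` (a (f (- i%:Z)) @^-1` A)).
  apply: fin_bigcap_measurable => [|i _].
    by apply: sub_finite_set (finite_II j.+1) => i.
  apply: measurableC; rewrite -[X in measurable X]setTI.
  exact: (pact_measurable a _ measurableT mA).
by apply/seteqP; split=> x xj i /xj.
Qed.

Definition lat j : Linf mu Z := linf_indic mu Z (late j).

Lemma late0 : late 0 = ~` A.
Proof.
apply/seteqP; split=> x.
  by move=> /(_ 0%N isT); rewrite oppr0 int_morph0 pact1.
by move=> xA [|i]//= _; rewrite oppr0 int_morph0 pact1.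
Qed.

Lemma lat_end : lat M = 0.
Proof.
rewrite -[RHS](indic0 mu Z); apply: indic_eq => //; first exact: late_measurable.
apply: filterS cover => x [i iM xA]; split=> // /(_ i iM); exact.
Qed.

Lemma lat0 : cp_term LH 1%g (lat 0) = 1 - idem a Z A.
Proof.
by rewrite /lat late0 indicC// (raddfB (cp_term LH 1%g)).
Qed.

Lemma translate_late i j : LH (f i%:Z) (lat j) =
  linf_indic mu Z [set x | late j (a (f (- i%:Z)) x)].
Proof. by rewrite /lat indic_translate -?int_morphN//; exact: late_measurable. Qed.

Lemma measurable_translate i j :
  measurable [set x | late j (a (f (- i%:Z)) x)].
Proof.
rewrite -[X in measurable X]setTI.
exact: (pact_measurable a _ measurableT (late_measurable j)).
Qed.

Lemma act_add_nat (i j : nat) x :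
  a (f (- i%:Z)) (a (f (- j%:Z)) x) = a (f (- (i + j)%N%:Z)) x.
Proof. by rewrite -pactM -fD; congr (a (f _) x); lia. Qed.

Lemma lat_idem0 j : lat j * LH (f j%:Z) (lat 0) = lat j.
Proof.
rewrite translate_late indicM; [|exact: late_measurable|exact: measurable_translate].
congr linf_indic; apply/seteqP; split=> [x []//|x xj]; split=> // i.
by rewrite leqn0 => /eqP ->; rewrite act_add_nat add0n; exact: xj.
Qed.

Lemma lat_next j : lat j * LH (f j.+1%:Z) (lat 0) = lat j.+1.
Proof.
rewrite translate_late indicM; [|exact: late_measurable|exact: measurable_translate].
congr linf_indic; apply/seteqP; split=> x.
  move=> [xj xj1] i; rewrite leq_eqVlt => /predU1P[->|/xj//].
  by have := xj1 0%N isT; rewrite act_add_nat add0n.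
move=> xj; split=> [i ij|i]; first by apply: xj; exact: leqW.
by rewrite leqn0 => /eqP ->; rewrite act_add_nat add0n; exact: xj.
Qed.

Lemma lat0_idem j : lat 0 * lat j = lat j.
Proof.
rewrite indicM; [|exact: late_measurable|exact: late_measurable].
congr linf_indic; apply/seteqP; split=> [x []//|x xj]; split=> // i.
by rewrite leqn0 => /eqP ->; exact: xj.
Qed.

Lemma lat0_next j : lat 0 * LH (f 1) (lat j) = lat j.+1.
Proof.
rewrite (translate_late 1) indicM; [|exact: late_measurable|exact: measurable_translate].
congr linf_indic; apply/seteqP; split=> x.
  move=> [x0 xj] [|i]; first by move=> _; exact: x0.
  by move=> /xj; rewrite act_add_nat addn1.
move=> xj; split=> [i|i ij]; first by rewrite leqn0 => /eqP ->; exact: xj.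
by rewrite act_add_nat addn1; exact: xj.
Qed.

Definition tau : RH := cp_term LH (f 1) 1.
(** At a point whose first backward visit to A occurs at time i, the terms j < i survive. Hence 1 +
    ret (tau - 1) telescopes to f i there: it evaluates functions at the last visit, which is why it
    sends the indicator of A to 1. *)
Definition ret : RH := \sum_(j < M) cp_term LH (f j%:Z) (lat j).
(* rho carries the indicator of A to 1 (rho_aug), and tau - 1 intertwines rho with
   ups (tau_rho). Hence R -> R given by tau - 1 may be replaced by the complex
   <A> -> <A> given by (tau - 1) * rho. *)
Definition rho : RH := 1 + ret * (tau - 1).
Definition ups : RH := 1 + (tau - 1) * ret.
Notation Q := (cp_term LH 1%g (lat 0)).

Definition ret' : RH := \sum_(j < M) cp_term LH (f j.+1%:Z) (lat j.+1).

(** The sum telescopes; its upper end is zero because [late M] is null, and its lower end is the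
    complement of A. *)
Lemma ret'B : ret' - ret = - Q.
Proof.
rewrite /ret' /ret -sumrB -(big_mkord xpredT (fun j =>
  cp_term LH (f j.+1%:Z) (lat j.+1) - cp_term LH (f j%:Z) (lat j))).
rewrite (telescope_sumr (fun j => cp_term LH (f j%:Z) (lat j)))//.
by rewrite lat_end raddf0 sub0r int_morph0.
Qed.

Lemma ret_mul (q : RH) : ret * q = \sum_(j < M) cp_term LH (f j%:Z) (lat j) * q.
Proof. exact: (cp_mul_suml (s := LH)). Qed.

Lemma mul_ret (q : RH) : q * ret = \sum_(j < M) q * cp_term LH (f j%:Z) (lat j).
Proof. exact: (cp_mul_sumr (s := LH)). Qed.

Lemma retQ : ret * Q = ret.
Proof.
by rewrite ret_mul; apply: eq_bigr => j _; rewrite cp_termM mulg1 lat_idem0.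
Qed.

Lemma f_succ (j : nat) : (f j%:Z * f 1)%g = f j.+1%:Z.
Proof. by rewrite -fD; congr f; lia. Qed.

Lemma f_succ' (j : nat) : (f 1 * f j%:Z)%g = f j.+1%:Z.
Proof. by rewrite -fD; congr f; lia. Qed.

Lemma ret_tauQ : ret * tau * Q = ret'.
Proof.
have tauQ : tau * Q = cp_term LH (f 1) (LH (f 1) (lat 0)).
  by rewrite /tau cp_termM mulg1 mul1r.
rewrite -mulrA ret_mul; apply: eq_bigr => j _.
by rewrite tauQ cp_termM f_succ -ractM f_succ lat_next.
Qed.

Lemma Qret : Q * ret = ret.
Proof.
by rewrite mul_ret; apply: eq_bigr => j _; rewrite cp_termM mul1g ract1 lat0_idem.
Qed.

Lemma Qtau_ret : Q * tau * ret = ret'.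
Proof.
rewrite mul_ret; apply: eq_bigr => j _.
by rewrite !cp_termM mul1g ract1 mulr1 f_succ' lat0_next.
Qed.

Lemma rhoQ : rho * Q = 0.
Proof.
rewrite /rho mulrDl mul1r mulrBr mulr1 mulrBl ret_tauQ retQ ret'B.
exact: subrr.
Qed.

Lemma Qups : Q * ups = 0.
Proof.
rewrite /ups mulrDr mulr1 mulrBl mul1r mulrBr mulrA Qtau_ret Qret ret'B.
exact: subrr.
Qed.

Lemma rho_idem : rho * idem a Z A = rho.
Proof.
have -> : idem a Z A = 1 - Q by rewrite lat0 subKr.
by rewrite mulrBr mulr1 rhoQ subr0.
Qed.

Lemma idem_ups : idem a Z A * ups = ups.
Proof.
have -> : idem a Z A = 1 - Q by rewrite lat0 subKr.
by rewrite mulrBl mul1r Qups subr0.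
Qed.

Lemma tau_rho : (tau - 1) * rho = ups * (tau - 1).
Proof. by rewrite /rho mulrDr mulr1 mulrA /ups [RHS]mulrDl mul1r. Qed.

Lemma tau_aug (x : base_module LH) : x = (1 : Linf mu Z) -> (tau - 1) *: x = 0.
Proof.
by move=> ->; rewrite scalerBl [tau *: _]cp_term_base ract_one mulr1 scale1r subrr.
Qed.

Lemma indic_idem_base : linf_indic mu Z A =
  idem a Z A *: ((1 : Linf mu Z) : base_module LH) :> Linf mu Z.
Proof. by rewrite cp_term_base ract1 mulr1. Qed.

Lemma rho_aug : rho *: (linf_indic mu Z A : base_module LH) = (1 : Linf mu Z).
Proof.
rewrite indic_idem_base [LHS](scalerA rho (idem a Z A)) rho_idem.
by rewrite /rho scalerDl -scalerA tau_aug// scaler0 addr0 scale1r.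
Qed.

(** Lies in the corner cut out by [idem A] on both sides, by [rho_idem] on the right and by
    [tau_rho] with [idem_ups] on the left; so it gives an endomorphism of <A>. *)
Definition delta : RH := (tau - 1) * rho.

Lemma delta_aug : delta *: (linf_indic mu Z A : base_module LH) = 0.
Proof. by rewrite /delta -scalerA; apply: tau_aug; exact: rho_aug. Qed.

Lemma delta_idem : delta * idem a Z A = delta.
Proof. by rewrite /delta -mulrA rho_idem. Qed.

Lemma idem_delta : idem a Z A * delta = delta.
Proof. by rewrite /delta tau_rho mulrA idem_ups. Qed.

Definition return_complex : marked_complex a Z :=
  two_term mA mA rho_aug delta_aug.

(* Fox derivative: the unique cocycle with fox (f 1) = 1. *)
Definition fox_int (k : int) : RH :=
  match k with
  | Posz m => \sum_(i < m) cp_term LH (f i%:Z) 1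
  | Negz m => - \sum_(i < m.+1) cp_term LH (f (- i.+1%:Z)) 1
  end.

Lemma fox_intS k : fox_int (k + 1) = fox_int k + cp_term LH (f k) 1.
Proof.
case: k => [m|m].
  by rewrite -PoszD addn1 /= big_ord_recr.
rewrite NegzE; case: m => [|m].
  by rewrite addNr /= big_ord0 big_ord1 addNr.
have -> : - (m.+2)%:Z + 1 = Negz m by rewrite NegzE; lia.
by rewrite -NegzE /= [in RHS]big_ord_recr/= opprD -NegzE subrK.
Qed.

Lemma fox_intD k l : fox_int (k + l) = fox_int k + cp_term LH (f k) 1 * fox_int l.
Proof.
(* The defect of the identity is unchanged under m -> m + 1, which serves both directions of the
   induction over the integers. *)
have step m : fox_int (k + (m + 1)) - (fox_int k + cp_term LH (f k) 1 * fox_int (m + 1))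
    = fox_int (k + m) - (fox_int k + cp_term LH (f k) 1 * fox_int m).
  rewrite addrA !fox_intS mulrDr cp_termM ract_one mulr1 -fD.
  by rewrite [in X in _ - X]addrA opprD addrACA subrr addr0.
suff : fox_int (k + l) - (fox_int k + cp_term LH (f k) 1 * fox_int l) = 0.
  by move/subr0_eq.
elim/int_rec: l => [|m IHm|m IHm].
- by rewrite addr0 /= big_ord0 mulr0 addr0 subrr.
- by rewrite -addn1 PoszD step.
- by rewrite -step (_ : - m.+1%:Z + 1 = - m%:Z); last lia.
Qed.

Lemma fox_int_tau k : fox_int k * (tau - 1) = cp_term LH (f k) 1 - 1.
Proof.
have step m : fox_int (m + 1) * (tau - 1) - (cp_term LH (f (m + 1)) 1 - 1) =
    fox_int m * (tau - 1) - (cp_term LH (f m) 1 - 1).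
  rewrite fox_intS mulrDl [cp_term _ (f m) 1 * _]mulrBr mulr1 cp_termM -fD.
  rewrite ract_one mulr1.
  have cancel (V : zmodType) (x y z w : V) : x + (y - z) - (y - w) = x - (z - w).
    zmod.
  exact: cancel.
suff : fox_int k * (tau - 1) - (cp_term LH (f k) 1 - 1) = 0 by move/subr0_eq.
elim/int_rec: k => [|m IHm|m IHm].
- by rewrite /= big_ord0 mul0r int_morph0 cp_term1 subrr subrr.
- by rewrite -addn1 PoszD step.
- by rewrite -step (_ : - m.+1%:Z + 1 = - m%:Z); last lia.
Qed.

Context (g : H -> int).
Hypotheses (fK : cancel f g) (gK : cancel g f).

Definition fox (x : H) : RH := fox_int (g x).

Lemma foxM x y : fox (x * y)%g = fox x + cp_term LH x 1 * fox y.
Proof.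
rewrite /fox (_ : g (x * y)%g = g x + g y) ?fox_intD ?gK//.
by apply: (can_inj fK); rewrite gK fD !gK.
Qed.

Lemma fox_tau x : fox x * (tau - 1) = cp_term LH x 1 - 1.
Proof. by rewrite /fox fox_int_tau gK. Qed.

(** In degree 1 the boundary is (fox y - fox x) (tau - 1) rho = (y - x) rho by [fox_tau], the
    difference of the values at the vertices. In degree 2 the Fox differences of a triangle
    cancel. *)
Definition return_bar k (c : seq H) : return_complex k :=
  match k return return_complex k with
  | 0 => if c is x :: _ then cp_term LH x 1 *: (rho *: tt_gen a Z mA mA 0) else 0
  | 1 => if c is [:: x, y & _] then (fox y - fox x) *: tt_gen a Z mA mA 1 else 0
  | _ => 0
  end.

Lemma return_bar_map n :
  exists phi, @bar_map _ _ _ _ _ _ _ return_complex n phi.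
Proof.
exists (fun k c => if size c == k.+1 then return_bar k c else 0).
apply: bar_map_truncate => [k h c|k c _ sc|x].
- case: k => [|[|k]]; last exact/esym/(morphB0 (@gactB _ _ _ _ _)).
  + case: c => [|x c]; first exact/esym/(morphB0 (@gactB _ _ _ _ _)).
    by rewrite /= /gact [RHS]scalerA cp_termM ract_one mulr1.
  + case: c => [|x [|y c]]; try exact/esym/(morphB0 (@gactB _ _ _ _ _)).
    rewrite /= /gact [RHS]scalerA !foxM; congr (_ *: _).
    by rewrite mulrBr opprD addrACA subrr add0r.
- case: k sc => [|[|k]].
  + case: c => [//|x [//|y [|//]]] _.
    rewrite /= subr0 linearZZ tt_d_gen0 !scalerA.
    rewrite -[in RHS]scalerBl; congr (_ *: _).
    rewrite idem_delta /delta mulrA mulrBl !fox_tau.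
    rewrite -mulrBl; congr (_ * _); zmod.
  + case: c => [//|x [//|y [//|z [|//]]]] _.
    rewrite raddf0 /= !subr0 -!scalerBl -[LHS](scale0r (tt_gen a Z mA mA 1)).
    congr (_ *: _); zmod.
  + by rewrite raddf0 bd0.
- rewrite /= !linearZZ tt_aug_gen rho_aug.
  by rewrite [LHS]cp_term_base ract_one mulr1.
Qed.

End FirstReturn.

(** * Lifting the cheap complex to bar chains with linear bounds *)

Section ReturnLift.
Context d (X : measurableType d) (R : realType) (mu : probability X R).
Context (H G : groupType) (j : {multiplicative H -> G}) (aG : pmp_action mu G).
Context (Z : normed_ring R) (f : int -> H).
Hypothesis fD : forall k l, f (k + l) = (f k * f l)%g.
Context (A : set X) (M : nat).
Hypothesis mA : measurable A.
Notation a := (restrict_action j aG).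
Hypothesis cover : \forall x \ae mu, exists2 i : nat, (i <= M)%N & A (a (f (- i%:Z)) x).
Notation LH := (linf_action a Z).
Notation LG := (linf_action aG Z).
Notation pushf := (@cp_map H G j _ LH LG).
Notation D0 := (return_complex Z fD mA cover).
Notation ups := (ups a Z f A M).
Notation delta := (delta a Z f A M).

Lemma pushfM : {morph pushf : r r' / r * r'}.
Proof. exact: (cp_mapM (@restrict_compat _ _ _ _ _ _ j aG Z)). Qed.

(** The vertex and the edge of the line on which the integers act; they do not involve A or M. *)
Definition return_cell (k : nat) : seq G :=
  if k is 0 then [:: 1%g] else [:: 1%g; j (f 1)].

(** The weight [ups] in degree 1 is dictated by ups (tau - 1) = (tau - 1) rho, the condition for a
    chain map from <A> -> <A> to the edge and the vertex. *)
Definition return_weight (k : nat) : crossed_product LH :=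
  if k is 0 then idem a Z A else ups.

Definition return_psi k : D0 k -> bar LG :=
  match k return D0 k -> bar LG with
  | 0 => sext (M := D0 0) (fun=> bar_term LG (return_cell 0) 1)
  | 1 => sext (M := D0 1) (fun=> pushf ups *: bar_term LG (return_cell 1) 1)
  | _ => fun=> 0
  end.

Lemma return_psi_gen k : (k <= 1)%N ->
  return_psi (tt_gen a Z mA mA k : D0 k) =
  pushf (return_weight k) *: bar_term LG (return_cell k) 1.
Proof.
case: k => [|[|//]] _.
  by rewrite /return_psi /= [LHS]sext_mgen /= cp_map_idem.
rewrite /return_psi /= [LHS]sext_mgen /= scalerA -(cp_map_idem j) -pushfM.
by rewrite (idem_ups Z fD mA cover).
Qed.

Lemma bar_d_return_cell : bar_d (bar_term LG (return_cell 1) 1) =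
  pushf (tau a Z f - 1) *: bar_term LG (return_cell 0) 1.
Proof.
rewrite bar_dU /= subr0 cp_mapB scalerBl cp_map_term -(cp_term1 LH) cp_map_term.
by rewrite multiplicative1 !bar_scaleE !ract_one !mulr1 /translate /= !mulg1.
Qed.

Lemma return_psiP : bar_lift return_psi.
Proof.
have semi k : semilinear (V := bar LG) (@return_psi k).
  by case: k => [|[|k]]; [exact: sext_semilinear|exact: sext_semilinear|exact: semilinear0].
split=> // [k x|x].
- case: k x => [|k] x; last first.
    rewrite [LHS](raddf0 (@bar_d _ _ LG)) [mc_d _ _ _]tt_d_eq0.
    exact/esym/(morphB0 (semi k.+1).1).
  apply: (eq_semilinear (f := @bar_d _ _ LG \o @return_psi 1)
    (f' := @return_psi 0 \o mc_d D0 0)) => [||[]].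
  + exact: (linear_semilinear (@bar_d _ _ LG) (semi 1%N)).
  + exact: (semilinear_comp (mc_d D0 0) (semi 0%N)).
  + rewrite [LHS](congr1 (@bar_d _ _ LG) (return_psi_gen (isT : (1 <= 1)%N))).
    rewrite [LHS]bar_dZ bar_d_return_cell scalerA -pushfM.
    rewrite [RHS](congr1 (@return_psi 0) (tt_d_gen0 mA mA delta)).
    rewrite !(semi 0%N).2 (return_psi_gen (isT : (0 <= 1)%N)) !scalerA -!pushfM.
    rewrite (idem_delta Z fD mA cover) (delta_idem Z fD mA cover).
    by rewrite /delta tau_rho.
- apply: (eq_semilinear (f := @bar_d _ _ LG \o @return_psi 0)
    (f' := fun x => bar_term LG [::] (mc_aug D0 x))) => [||[]].
  + exact: (linear_semilinear (@bar_d _ _ LG) (semi 0%N)).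
  + exact: bar_aug_semilinear.
  + rewrite [LHS](congr1 (@bar_d _ _ LG) (return_psi_gen (isT : (0 <= 1)%N))).
    rewrite [LHS]bar_dZ bar_dU /= subr0 tt_aug_gen cp_map_idem bar_scaleE.
    by rewrite ract1 mulr1.
Qed.

Section Bounds.
Hypotheses (Z0 : nr_norm (0 : Z) = 0) (Z1 : nr_norm (1 : Z) <= 1).
Variable N : marked_module aG Z.
Implicit Type y : N.

Lemma indic_norm (B : set X) : measurable B ->
  \forall t \ae mu, nr_norm (linf_repr (linf_indic mu Z B) t) <= 1.
Proof.
move=> mB; apply: filterS (linf_classK (linf_pred_indic mu Z mB)) => t ->.
by rewrite /set_ind; case: ifP; rewrite ?Z0.
Qed.

Lemma term_bound_set g (B : set X) y K : measurable B -> 0 <= K -> term_bound y K ->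
  term_bound (cp_term LG g (linf_indic mu Z B) *: y) K.
Proof.
move=> mB K0 yK; rewrite -[K]mul1r; apply: term_bound_term => //.
exact: indic_norm.
Qed.

Lemma term_bound_ret y K : 0 <= K -> term_bound y K ->
  term_bound (pushf (ret a Z f A M) *: y) (M%:R * K).
Proof.
move=> K0 yK.
have -> : pushf (ret a Z f A M) =
    \sum_(i < M) cp_term LG (j (f i%:Z)) (lat a Z f A i).
  rewrite /ret (big_morph pushf (id1 := 0) (op1 := +%R)); last 2 first.
  - exact: (morphBD (@cp_mapB _ _ _ _ _ _)).
  - exact: (morphB0 (@cp_mapB _ _ _ _ _ _)).
  by apply: eq_bigr => i _; rewrite cp_map_term.
rewrite scaler_suml mulr_natl -[M in _ *+ M]card_ord -sumr_const.
apply: (big_ind2 (fun y K => term_bound (y : N) K)).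
- exact: term_bound0.
- by move=> ? ? ? ?; exact: term_boundD.
- by move=> i _; apply: term_bound_set => //; exact: late_measurable.
Qed.

Lemma term_bound_tau y K : 0 <= K -> term_bound y K ->
  term_bound (pushf (tau a Z f - 1) *: y) (K + K).
Proof.
move=> K0 yK; rewrite cp_mapB scalerBl cp_map_term -(cp_term1 LH) cp_map_term.
rewrite multiplicative1 cp_term1 scale1r; apply: term_boundB => //.
by rewrite -(indicT mu Z); apply: term_bound_set.
Qed.

(** [ret] has M terms with coefficients of norm at most 1, and tau - 1 doubles the bound; the
    identity accounts for the 1. *)
Lemma term_bound_ups y K : 0 <= K -> term_bound y K ->
  term_bound (pushf ups *: y) ((1 + M.*2%:R) * K).
Proof.
move=> K0 yK; have MK : 0 <= M%:R * K by rewrite mulr_ge0.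
have -> : pushf ups *: y = y + pushf (tau a Z f - 1) *: (pushf (ret a Z f A M) *: y).
  rewrite scalerA -pushfM /ups (morphBD (@cp_mapB _ _ _ _ _ _)) scalerDl.
  by rewrite -(cp_term1 LH) cp_map_term multiplicative1 cp_term1 scale1r.
rewrite -addnn natrD mulrDl mulrDl mul1r.
by apply: term_boundD => //; apply: term_bound_tau => //; exact: term_bound_ret.
Qed.

Lemma term_bound_delta y K : 0 <= K -> term_bound y K ->
  term_bound (pushf delta *: y) ((1 + M.*2%:R) * (K + K)).
Proof.
move=> K0 yK; rewrite /delta tau_rho pushfM -scalerA.
by apply: term_bound_ups; [exact: addr_ge0|exact: term_bound_tau].
Qed.

Lemma term_bound_weight k y K : 0 <= K -> term_bound y K ->
  term_bound (pushf (return_weight k) *: y) ((1 + M.*2%:R) * K).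
Proof.
move=> K0 yK; case: k => [|k]; last exact: term_bound_ups.
apply: (@term_bound_le _ _ _ _ _ _ _ _ _ K).
  by rewrite mulrDl mul1r lerDl mulr_ge0.
by rewrite cp_map_idem; exact: term_bound_set.
Qed.

End Bounds.

End ReturnLift.

(** * Amalgams over the integers *)

Section MevolIntegers.
Context d (X : measurableType d) (R : realType) (mu : probability X R).
Context (G0 G1 G2 G : groupType).
Context (i1 : {multiplicative G0 -> G1}) (i2 : {multiplicative G0 -> G2}).
Context (j1 : {multiplicative G1 -> G}) (j2 : {multiplicative G2 -> G}).
Hypothesis amalgam : amalgamated_product i1 i2 j1 j2.
Context (alpha : pmp_action mu G).
Notation Z := (normed_int R).
Notation alpha0 := (restrict_action (j1 \o i1) alpha).
Notation alpha1 := (restrict_action j1 alpha).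
Notation alpha2 := (restrict_action j2 alpha).
Notation LG := (linf_action alpha Z).
Notation Z0 := (@int_norm0 R).
Notation Z1 := (@int_norm1 R).

Lemma term_bound_induce (K : groupType) (j : {multiplicative K -> G})
    (M : marked_module (restrict_action j alpha) Z) (N : marked_module alpha Z)
    (u : mm_idx M -> mm_idx N) (y : M) (k : R) :
  term_bound y k -> term_bound (induce u y) k.
Proof.
move=> yk l; apply: le_trans (yk l).
have -> : cp_term LG 1%g l *: induce u y =
    induce u (cp_term (linf_action (restrict_action j alpha) Z) 1%g l *: y).
  by rewrite (induce_semilinear u).2 cp_map_term multiplicative1.
exact: (mnorm_induce Z0 Z1).
Qed.

Section Twist.
Context (n : nat).
Context (D1 : marked_complex alpha1 Z) (phi1 : forall k, seq G1 -> D1 k).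
Context (D2 : marked_complex alpha2 Z) (phi2 : forall k, seq G2 -> D2 k).
Hypotheses (phi1P : bar_map n.+1 phi1) (phi2P : bar_map n.+1 phi2).
Context (r1 : G -> G1) (r2 : G -> G2).
Hypotheses (r1M : forall h x, r1 (j1 h * x)%g = (h * r1 x)%g)
  (r2M : forall h x, r2 (j2 h * x)%g = (h * r2 x)%g).
Context (f : int -> G0).
Hypothesis fD : forall k l, f (k + l) = (f k * f l)%g.

(* The bound is linear in the return time M, with a constant that does not
   depend on A. *)
Lemma term_bound_twist k : (k <= 1)%N -> exists2 C : R, 1 <= C &
  forall (A : set X) (M : nat) (mA : measurable A)
    (cover : \forall x \ae mu, exists2 i : nat, (i <= M)%N & A (alpha0 (f (- i%:Z)) x)),
  term_bound (twist (D0 := return_complex Z fD mA cover) phi1 phi2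
      (@return_psi _ _ _ _ _ _ _ _ Z f fD A M mA cover) r1 r2 (tt_gen alpha0 Z mA mA k))
    ((1 + M.*2%:R) * C).
Proof.
move=> k1; pose c := return_cell (j1 \o i1) f k.
have [C1 C10 C1P] := term_bound_exists Z0 Z1 (phi1 k (map r1 c)).
have [C2 C20 C2P] := term_bound_exists Z0 Z1 (phi2 k (map r2 c)).
(* C1 and C2 bound the values of phi1 and phi2 on the fixed cell; the 2 comes from the factor tau -
   1 of [delta] on a generator of norm at most 1. *)
exists (C1 + C2 + 2) => [|A M mA cover].
  by rewrite (le_trans (_ : 1 <= 2))// ?ler1n// lerDr addr_ge0.
rewrite !mulrDr; apply: (term_boundB Z0); first apply: (term_boundB Z0).
- rewrite return_psi_gen//.
  rewrite /ev1 ev_semi; last exact: (bar1_equiv0 D2 _ phi1P r1M).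
  apply: (term_bound_weight _ _ _ mA Z0 Z1) => //.
  rewrite bar_evalU cp_term1 scale1r; exact: term_bound_induce.
- rewrite return_psi_gen//.
  rewrite /ev2 ev_semi; last exact: (bar2_equiv0 amalgam D1 _ phi2P r2M).
  apply: (term_bound_weight _ _ _ mA Z0 Z1) => //.
  rewrite bar_evalU cp_term1 scale1r; exact: term_bound_induce.
- case: k k1 {c C1P C2P} => [|[|//]] _.
    rewrite (morphB0 (iota0_semi _ _ _ _).1).
    by move=> l; rewrite scaler0 mnorm0 mulr_ge0 ?nl_ge0// addr_ge0// mulr1 addr_ge0.
  rewrite [shifted_d _](tt_d_gen0 mA mA) scalerA (idem_delta Z fD mA cover).
  rewrite (iota0_semi _ _ _ _).2 -mulrDr.
  apply: (term_bound_delta _ _ _ mA Z0 Z1) => //.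
  exact/term_bound_induce/term_bound_gen.
Qed.

End Twist.

(** With s = C (1 + 2 m), the argument is at most s^2, and ln (s^2) <= 2 s <= 6 C m. Thus the
    logarithm of a quantity of order m^2 grows at most linearly in m, against a marker of measure at
    most 1 / m^2. *)
Lemma log_plus_square (C : R) (m : nat) : 1 <= C -> (0 < m)%N ->
  log_plus ((1 + (m ^ 2).*2.*2%:R) * C) <= 6 * C * m%:R.
Proof.
move=> C1 m0; have C0 : 0 < C by exact: lt_le_trans C1.
have m1 : 1 <= m%:R :> R by rewrite ler1n.
pose s := C * (1 + 2 * m%:R).
have s0 : 0 < s by rewrite mulr_gt0// ltr_wpDr// mulr_ge0.
apply: (@le_trans _ _ (log_plus (s * s))).
  apply: log_plus_le; first by rewrite mulr_ge0// ?addr_ge0// ltW.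
  have C_le : C <= C * C by rewrite ler_peMl// ltW.
  rewrite /s mulrACA [C * C * _]mulrC ler_pM// ?addr_ge0// ?(ltW C0)//.
  rewrite -!muln2 !natrM; nra.
rewrite /log_plus ge_max lnM ?posrE//; apply/andP; split; last first.
  by rewrite !mulr_ge0// ltW.
apply: (@le_trans _ _ (s + s)); first by rewrite lerD// ltW// ln_sublinear.
rewrite /s; nra.
Qed.

Lemma mevol_integers (C : free_resolution Z G) (C1 : free_resolution Z G1)
    (C2 : free_resolution Z G2) n (f : int -> G0) :
  standard_action alpha -> bijective f ->
  (forall k l, f (k + l) = (f k * f l)%g) ->
  (mevol alpha C n <= mevol alpha1 C1 n + mevol alpha2 C2 n)%E.
Proof.
move=> [/standard_borel_separated[U mU Usep] _ free] [g fK gK] fD.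
apply: (mevol_amalgam amalgam) => D1 phi1 D2 phi2 r1 r2 e phi1P phi2P r1M r2M e0.
pose T k := alpha0 (f k).
have T0 x : T 0 x = x by rewrite /T (int_morph0 fD) pact1.
have TD k l x : T (k + l) x = T k (T l x) by rewrite /T fD pactM.
have mT k B : measurable B -> measurable (T k @^-1` B).
  move=> mB; rewrite -[X in measurable X]setTI.
  exact: (pact_measurable alpha0 _ measurableT mB).
have muT k B : measurable B -> mu (T k @^-1` B) = mu B.
  exact: (pact_preserving alpha0).
have T_free : \forall x \ae mu, forall k, k != 0 -> T k x <> x.
  apply: filterS free => x x_free k k0 /x_free fk1; case/negP: k0; apply/eqP.
  have [j1_inj _] := amalgam_inj amalgam; have [i1_inj _ _ _] := amalgam.
  apply/(can_inj fK)/i1_inj/j1_inj; rewrite (int_morph0 fD) !multiplicative1; exact: fk1.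
have ret_set N : (0 < N)%N -> exists A : set X, [/\ measurable A,
    \forall x \ae mu, exists2 i : nat, (i <= N.*2)%N & A (alpha0 (f (- i%:Z)) x) &
    N%:R * fine (mu A) <= 1].
  (* Pulling the marker back by T N turns the two-sided window of visits into backward times 0 to 2
     N. *)
  move=> N0; exists (T N%:Z @^-1` marker T U N); split.
  - exact/mT/marker_measurable.
  - apply: filterS T_free => x /(marker_cover T0 Usep N0)[i iN xi].
    by exists i; [exact: ltnW|rewrite TD in xi; exact: xi].
  - by rewrite muT; [exact: marker_small|exact: marker_measurable].
(* Above degree 1 the module D0 n is zero, so the size of the marker does not matter. *)
have [n1|n1] := leqP n 1; last first.
  have [A [mA cover _]] := ret_set 1%N isT.
  pose D0 := return_complex Z fD mA cover.
  have [K K0 KP] := term_bound_exists Z0 Z1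
    (twist phi1 phi2 (@return_psi _ _ _ _ _ _ _ _ Z f fD A _ mA cover) r1 r2
      (mgen (M := D0 n) tt)).
  have [phi0 phi0P] := return_bar_map Z fD mA cover fK gK n.
  exists D0, phi0, (@return_psi _ _ _ _ _ _ _ _ Z f fD A _ mA cover), K.
  split; [exact: phi0P|exact: return_psiP
    |exact: K0|by case; exact: KP|].
  have tt0 k : (1 < k)%N -> tt_set A A k tt = set0 by case: k => [|[|]].
  by rewrite mdim_two_term tt0// measure0 mul0r ltW.
have [K K1 KP] := term_bound_twist phi1P phi2P r1M r2M fD n1.
(* The excess will be at most 6 K / m, so m is taken with 6 K <= e m. *)
have [m m0 me] : exists2 m, (0 < m)%N & 6 * K <= e * m%:R.
  exists (Num.bound (6 * K / e)).+1 => //; rewrite [e * _]mulrC -ler_pdivrMr//.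
  have Ke0 : 0 <= 6 * K / e.
    by rewrite divr_ge0 ?mulr_ge0 ?(le_trans ler01 K1)// ltW.
  by rewrite (le_trans (ltW (archi_boundP Ke0)))// ler_nat.
(* The marker is taken with N = m^2, so the return bound M is 2 m^2 and 1 + 2 M equals 1 + 4 m^2. *)
have mm0 : (0 < m ^ 2)%N by rewrite expn_gt0 m0.
have [A [mA cover smallA]] := ret_set _ mm0.
have [phi0 phi0P] := return_bar_map Z fD mA cover fK gK n.
exists (return_complex Z fD mA cover), phi0,
  (@return_psi _ _ _ _ _ _ _ _ Z f fD A _ mA cover), ((1 + (m ^ 2).*2.*2%:R) * K).
split; [exact: phi0P|exact: return_psiP| |by case; exact: KP|].
  by rewrite mulr_ge0// (le_trans ler01).
have -> : mdim (return_complex Z fD mA cover n) = fine (mu A).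
  have ttA k : (k <= 1)%N -> tt_set A A k tt = A by case: k => [|[|]].
  by rewrite mdim_two_term ttA.
apply: le_trans (ler_wpM2l _ (log_plus_square K1 m0)) _; first exact: fine_ge0.
have mm : 0 < m%:R :> R by rewrite ltr0n.
rewrite natrM in smallA.
have muA0 : 0 <= fine (mu A) by exact: fine_ge0.
(* Multiplied by m, the left side is 6 K times m^2 mu(A), hence at most 6 K <= e m. *)
rewrite -(ler_pM2l mm); nra.
Qed.

End MevolIntegers.

Theorem proposition12p2
  (d : measure_display) (X : measurableType d) (R : realType)
  (mu : probability X R)
  (G0 G1 G2 G : groupType)
  (i1 : {multiplicative G0 -> G1}) (i2 : {multiplicative G0 -> G2})
  (j1 : {multiplicative G1 -> G}) (j2 : {multiplicative G2 -> G})
  (amalgam : amalgamated_product i1 i2 j1 j2)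
  (FP0 : type_FPinfty G0) (FP1 : type_FPinfty G1) (FP2 : type_FPinfty G2)
  (alpha : pmp_action mu G) (alpha_standard : standard_action alpha)
  (Z : normed_ring R) (Z_coef : coefficient_ring Z) (n : nat) :
  let alpha0 := restrict_action (j1 \o i1) alpha in
  let alpha1 := restrict_action j1 alpha in
  let alpha2 := restrict_action j2 alpha in
  [/\ forall (C : free_resolution Z G) (C0 : free_resolution Z G0)
        (C1 : free_resolution Z G1) (C2 : free_resolution Z G2),
        (medim alpha C n <=
          medim alpha1 C1 n + medim alpha2 C2 n + medim_pred alpha0 C0 n)%E,
      (forall g : G0, g = 1%g) -> (1 <= n)%N ->
        forall (C : free_resolution (normed_int R) G)
          (C1 : free_resolution (normed_int R) G1)
          (C2 : free_resolution (normed_int R) G2),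
        (mevol alpha C n <= mevol alpha1 C1 n + mevol alpha2 C2 n)%E &
      (exists2 f : int -> G0, bijective f &
        forall a b : int, f (a + b) = (f a * f b)%g) ->
        forall (C : free_resolution (normed_int R) G)
          (C1 : free_resolution (normed_int R) G1)
          (C2 : free_resolution (normed_int R) G2),
        (mevol alpha C n <= mevol alpha1 C1 n + mevol alpha2 C2 n)%E].
Proof.
split=> [C C0 C1 C2|triv n1 C C1 C2|[f f_bij fD] C C1 C2].
- exact: (medim_amalgam amalgam alpha C C0 C1 C2 n).
- exact: (mevol_free amalgam alpha C C1 C2 triv n1).
- exact: (mevol_integers amalgam C C1 C2 n alpha_standard f_bij fD).
Qed.
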